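(* Let $p\in(0,1)$ and let $\mathbb P$ be a probability measure on $\Omega$. In the case of a flow, assume that $\lim_{\varepsilon\to 0}\mathbb P(B_\varepsilon^0\cup B_\varepsilon^1)=0$. (1) Suppose that the point process $\mathcal N_\varepsilon$ on $[0,+\infty)\times\{0,1\}$ converges in distribution, with respect to $\mathbb P$, as $\varepsilon\to0$, to a Poisson point process of intensity $\lambda\times\mathcal B(p)$, where $\mathcal B(p)=(1-p)\delta_0+p\,\delta_1$ is the Bernoulli measure with parameter $p$ on $\{0,1\}$. Then $\mathcal M_\varepsilon$ converges in distribution with respect to $\mathbb P$, as $\varepsilon\to0$, to a random variable $\mathcal M$ with $\mathbb P(\mathcal M=k)=p^k(1-p)$ for every integer $k\ge 0$. In particular $$\lim_{\varepsilon\to0}\mathbb P(\tau_{B_\varepsilon^0}<\tau_{B_\varepsilon^1})=\lim_{\varepsilon\to0}\mathbb P(\mathcal M_\varepsilon=0)=1-p .$$ (2) In the case of a flow, let $(a_\varepsilon)_\varepsilon$ be positive numbers. Suppose that $a_\varepsilon\tau_{\Omega\setminus B_\varepsilon^1}$ converges to $0$ in probability with respect to $\mathbb P$, and that the point process $\mathcal L_\varepsilon$ on $[0,+\infty)\times\{0,1\}\times[0,+\infty]$ converges in distribution, with respect to $\mathbb P$, to a Poisson point process of intensity $\lambda\times\sum_{j=0}^1p_j(\delta_j\times m'_j)$, where $p_1=p$, $p_0=1-p$ and $m'_0,m'_1$ are probability measures. Then $a_\varepsilon\mathcal M'_\varepsilon$ converges in distribution with respect to $\mathbb P$ to $\sum_{i=1}^{\mathcal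 M}X_i$, where $(X_i)_{i\ge1}$ is a sequence of i.i.d. random variables with distribution $m'_1$, independent of $\mathcal M$, and $\mathcal M$ has the geometric distribution $\mathbb P(\mathcal M=k)=p^k(1-p)$, $k\ge0$.
   Context: Let $(\Omega,\mathcal F,\mu,T)$ (case of a transformation) or $(\Omega,\mathcal F,\mu,Y=(Y_t)_{t\ge0})$ (case of a flow) be a probability preserving dynamical system. For each $\varepsilon>0$ let $B_\varepsilon^0,B_\varepsilon^1$ be two disjoint measurable subsets of $\Omega$, set $A_\varepsilon=B_\varepsilon^0\cup B_\varepsilon^1$, and assume $\mu(A_\varepsilon)>0$ and $\mu(A_\varepsilon)\to0$ as $\varepsilon\to0$. $\lambda$ is the Lebesgue measure on $[0,+\infty)$. Entrance times (flow case): for the sets $B$ considered, the set $\{t\ge0: Y_t(x)\in B\}$ is, for every $x$, a locally finite union of intervals each containing its left endpoint; ''$Y_t(x)$ enters $B$'' at time $t>0$ means that $t$ is the left endpoint of one of its maximal intervals (connected components). Transformation case: $\tau_B(x)=\inf\{n\ge1: T^n(x)\in B\}$, $$\mathcal N_\varepsilon(x)=\sum_{n\ge1}\sum_{\ell=0}^1\mathbf 1_{B_\varepsilon^\ell}(T^nx)\,\delta_{(n\mu(A_\varepsilon),\ell)},\qquad \mathcal M_\varepsilon(x)=\sum_{n=1}^{\tau_{B_\varepsilon^0}(x)}\mathbf 1_{B_\varepsilon^1}(T^nx).$$ Flow case: let $(h_\varepsilon)_\varepsilon$ be positive normalizing numbers, $\tau_B(x)=\inf\{t>0: Y_t(x)\in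 B\}$ and $D_B:=\tau_{\Omega\setminus B}$. Then $$\mathcal N_\varepsilon(x)=\sum_{\ell=0}^1\ \sum_{t>0:\,Y_t(x)\text{ enters }B_\varepsilon^\ell}\delta_{(th_\varepsilon,\ell)},$$ $\mathcal M_\varepsilon(x)$ is the number of times $t\in(0,\tau_{B_\varepsilon^0}(x))$ at which $Y_t(x)$ enters $B_\varepsilon^1$, $$\mathcal M'_\varepsilon(x)=\int_0^{\tau_{B_\varepsilon^0}(x)}\mathbf 1_{B_\varepsilon^1}(Y_s(x))\,ds,\qquad \mathcal L_\varepsilon(x)=\sum_{j=0}^1\ \sum_{t>0:\,Y_t(x)\text{ enters }B_\varepsilon^j}\delta_{(th_\varepsilon,\;j,\;a_\varepsilon D_{B_\varepsilon^j}(Y_t(x)))}.$$ A Poisson point process of intensity $\eta$ on a space $E$ is a point process whose counts on pairwise disjoint Borel sets $B_1,\dots,B_n$ are independent Poisson variables with parameters $\eta(B_i)$. Convergence in distribution of point processes on $E$ is convergence in distribution in the space $M_p(E)$ of point measures on $E$ endowed with the topology of vague convergence. Here $[0,+\infty]$ carries its usual compact topology. *)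

(* Defs.v *)
From HB Require Import structures.
From mathcomp Require Import all_boot all_order all_algebra.
From mathcomp Require Import finmap.
From mathcomp Require Import all_classical all_reals all_analysis.
From mathcomp Require Import measurable_realfun.

Set Implicit Arguments.
Unset Strict Implicit.
Unset Printing Implicit Defensive.

Import Order.TTheory GRing.Theory Num.Theory.
Import numFieldNormedType.Exports.

Local Open Scope classical_set_scope.
Local Open Scope ring_scope.

(** State spaces of point processes: types carrying both a topology and a
    sigma-algebra.  The structure does not relate the two; on the instances
    below the sigma-algebra is the Borel one. *)
#[short(type="topMeasurableType")]
HB.structure Definition TopMeasurable d :=
  {T of Measurable d T & Topological T}.

HB.instance Definition _ := Measurable.on bool.
HB.instance Definition _ (R : realType) := Measurable.on R.
HB.instance Definition _ (R : realType) := Topological.on (\bar R).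
HB.instance Definition _ d1 d2
  (T1 : topMeasurableType d1) (T2 : topMeasurableType d2) :=
  Measurable.on (T1 * T2)%type.

HB.instance Definition _ d (T : measurableType d) (R : realType) :=
  gen_eqMixin (measure T R).
HB.instance Definition _ d (T : measurableType d) (R : realType) :=
  gen_choiceMixin (measure T R).

Section dirac_sum.
Context d (T : measurableType d) (R : realType) (C : choiceType).
Variables (I : set C) (z : C -> T).
Local Open Scope ereal_scope.

Definition dirac_sum (A : set T) : \bar R := \esum_(i in I) \d_(z i) A.

Let dirac_sum0 : dirac_sum set0 = 0.
Proof. by rewrite /dirac_sum esum1// => i _; rewrite measure0. Qed.

Let dirac_sum_ge0 A : 0 <= dirac_sum A.
Proof. exact: esum_ge0. Qed.

Let dirac_sum_sigma_additive : semi_sigma_additive dirac_sum.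
Proof.
move=> F mF tF mUF; apply: cvg_toP.
  by apply: ereal_nondecreasing_is_cvgn => m n mn; exact: lee_sum_nneg_natr.
rewrite nneseries_esumT//.
rewrite /dirac_sum esum_esum// (_ : _ `*`` _ = (setT : set nat) `*` I)//.
transitivity (\esum_(k in I `*` (setT : set nat)) (\d_(z k.1) (F k.2) : \bar R)).
  rewrite (reindex_esum (I `*` setT) _ (fun k => (k.2, k.1)))//.
  split => [[i n]/= [Ii _]|[i n] [j m] _ _ /= [-> ->]//|[n i]/= [_ Ii]] //.
  by exists (i, n).
rewrite (_ : I `*` setT = I `*`` (fun=> setT))// -(esum_esum (a := fun i n => \d_(z i) (F n)))//.
apply: eq_esum => i Ii; rewrite -nneseries_esumT//.
by apply/cvg_lim => //; exact: measure_semi_sigma_additive.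
Qed.

HB.instance Definition _ := isMeasure.Build _ _ _ dirac_sum
  dirac_sum0 dirac_sum_ge0 dirac_sum_sigma_additive.

End dirac_sum.

Section vague_topology.
Context d (T : topMeasurableType d) (R : realType) (S : set T).

(** Continuous functions with compact support on the subspace [S] of [T]. *)
Definition test_function : Type :=
  {f : T -> R | {within S, continuous f} /\
    exists K, [/\ compact K, K `<=` S & forall x, S x -> ~ K x -> f x = 0]}.

HB.instance Definition _ := gen_eqMixin test_function.
HB.instance Definition _ := gen_choiceMixin test_function.

Definition vague_eval (m : measure T R) : {ptws test_function -> R} :=
  fun f => \int[m]_(x in S) sval f x.

(** The coarsest topology making all [m |-> \int[m]_(x in S) f x] continuous.
    It is only meant to be used on Radon measures carried by [S], such as those
    of [point_measures]. *)
Definition vague_measure : Type := initial_topology vague_eval.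

HB.instance Definition _ := Topological.on vague_measure.

(** The set M_p(S) of point measures on [S]. *)
Definition point_measures : set vague_measure :=
  [set m : measure T R |
    (exists (I : set nat) (z : nat -> T), (forall i, I i -> S (z i)) /\
       forall A, measurable A -> m A = dirac_sum R I z A) /\
    (forall K, compact K -> K `<=` S -> (m K < +oo)%E)].

End vague_topology.
Arguments vague_measure {d T} R S.
Arguments point_measures {d T} R S.

Section convergence_in_distribution.
Context (R : realType) d (Omega : measurableType d) (P : probability Omega R).

(** [V] is viewed as a topological space with the topology induced by [W], and
    measurability is with respect to its Borel sigma-algebra. *)
Definition random_element (W : topologicalType) (V : set W)
    (X : Omega -> W) : Prop :=
  (forall x, V (X x)) /\ (forall U, open U -> measurable (X @^-1` U)).

Definition cvg_in_probability0 (X : R -> Omega -> \bar R) : Prop :=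
  forall r : R, 0 < r ->
    P [set x | (r%:E < `|X e x|)%E] @[e --> 0^'+] --> 0%E.

End convergence_in_distribution.

Definition cvg_in_distribution (R : realType)
    d (Omega : measurableType d) (P : probability Omega R)
    d' (Omega' : measurableType d') (P' : probability Omega' R)
    (W : topologicalType) (V : set W)
    (X : R -> Omega -> W) (X' : Omega' -> W) : Prop :=
  [/\ forall e : R, 0 < e -> random_element V (X e),
      random_element V X' &
      forall F : W -> R, {within V, continuous F} ->
        (exists c : R, forall w, V w -> `|F w| <= c) ->
        \int[P]_x F (X e x) @[e --> 0^'+] --> \int[P']_y F (X' y)].

Section random_variables.
Context (R : realType) d (Omega : measurableType d) (P : probability Omega R).

Definition mutually_independent (I : choiceType) (X : I -> Omega -> \bar R) :=
  forall (J : {fset I}) (A : I -> set (\bar R)),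
    (forall i, measurable (A i)) ->
    P (\bigcap_(i in [set` J]) (X i @^-1` A i)) =
    (\prod_(i <- J) P (X i @^-1` A i))%E.

(** For [r = +oo] all the weights vanish: the Poisson law of infinite parameter
    is the Dirac mass at [+oo].  The library's [poisson_pmf] is not used since
    it is identically 1 at rate 0. *)
Definition poisson_weight (r : \bar R) (k : nat) : \bar R :=
  if r is r'%:E then (r' ^+ k / k`!%:R * expR (- r'))%:E else 0%E.

Definition poisson_variable (X : Omega -> \bar R) (r : \bar R) : Prop :=
  measurable_fun setT X /\
  forall k : nat, P (X @^-1` [set k%:R%:E]) = poisson_weight r k.

Definition poisson_point_process dT (T : topMeasurableType dT) (S : set T)
    (eta : set T -> \bar R) (N : Omega -> vague_measure R S) : Prop :=
  random_element (point_measures R S) N /\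
  forall n (A : 'I_n -> set T),
    (forall i, measurable (A i)) -> (forall i, A i `<=` S) ->
    trivIset setT A ->
    (forall i, poisson_variable (fun w => (N w : measure T R) (A i)) (eta (A i)))
    /\ mutually_independent (fun i w => (N w : measure T R) (A i)).

Definition geometric_variable (p : R) (M : Omega -> nat) : Prop :=
  forall k, P (M @^-1` [set k]) = (p ^+ k * (1 - p))%:E.

End random_variables.

Section transformation.
Context (R : realType) d (Omega : measurableType d).
Implicit Types (T : Omega -> Omega) (B : bool -> set Omega) (x : Omega).

Definition measure_preserving_map (mu : probability Omega R) T : Prop :=
  measurable_fun setT T /\
  forall A, measurable A -> mu (T @^-1` A) = mu A.

Definition map_hitting T (B : set Omega) x : \bar R :=
  ereal_inf [set n%:R%:E | n in [set n | (1 <= n)%N /\ B (iter n T x)]].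

Definition map_process T B (c : R) (S : set (R * bool)) x : vague_measure R S :=
  dirac_sum R [set u : nat * bool | (1 <= u.1)%N /\ B u.2 (iter u.1 T x)]
    (fun u => (u.1%:R * c, u.2)).

Definition map_count T B x : \bar R :=
  \esum_(n in [set n : nat | (1 <= n)%N /\
                             (n%:R%:E <= map_hitting T (B false) x)%E])
    (\1_(B true) (iter n T x))%:E.

End transformation.

Section flow.
Context (R : realType) d (Omega : measurableType d).
Implicit Types (Y : R -> Omega -> Omega) (B : bool -> set Omega) (x : Omega).

(** Only the values of [Y] at nonnegative times are meaningful. *)
Definition measure_preserving_flow (mu : probability Omega R) Y : Prop :=
  [/\ forall t, 0 <= t -> measurable_fun setT (Y t),
      forall x, Y 0 x = x,
      forall s t x, 0 <= s -> 0 <= t -> Y (s + t) x = Y s (Y t x) &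
      forall t A, 0 <= t -> measurable A -> mu (Y t @^-1` A) = mu A].

Definition visit_times Y (A : set Omega) x : set R :=
  [set t | 0 <= t /\ A (Y t x)].

Definition locally_finite_left_closed (Z : set R) : Prop :=
  exists F : set (set R),
    [/\ Z = \bigcup_(J in F) J,
        forall J, F J -> is_interval J /\ exists2 l, J l & lbound J l &
        forall t, finite_set [set J | F J /\ J `&` `[0, t] !=set0]].

Definition enters Y (A : set Omega) x (t : R) : Prop :=
  let Z := visit_times Y A x in
  [/\ 0 < t, Z t & lbound (connected_component Z t) t].

Definition flow_hitting Y (A : set Omega) x : \bar R :=
  ereal_inf [set t%:E | t in [set t | 0 < t /\ A (Y t x)]].

Definition flow_process Y B (h : R) (S : set (R * bool)) x :
    vague_measure R S :=
  dirac_sum R [set u : R * bool | enters Y (B u.2) x u.1]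
    (fun u => (u.1 * h, u.2)).

Definition flow_count Y B x : \bar R :=
  counting [set t | enters Y (B true) x t /\
                    (t%:E < flow_hitting Y (B false) x)%E].

Definition flow_sojourn Y B x : \bar R :=
  (\int[@lebesgue_measure R]_(s in
      [set s | (0 < s%:E < flow_hitting Y (B false) x)%E])
    (\1_(B true) (Y s x))%:E)%E.

Definition flow_marked_process Y B (h a : R) (S : set (R * (bool * \bar R))) x :
    vague_measure R S :=
  dirac_sum R [set u : R * bool | enters Y (B u.2) x u.1]
    (fun u => (u.1 * h,
      (u.2, (a%:E * flow_hitting Y (~` B u.2) (Y u.1 x))%E))).

End flow.

Section state_spaces.
Context (R : realType).

Definition time_type : set (R * bool) := [set u | 0 <= u.1].

Definition time_type_mark : set (R * (bool * \bar R)) :=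
  [set u | 0 <= u.1 /\ (0 <= u.2.2)%E].

Definition halfline_lebesgue : set R -> \bar R :=
  mrestr (@lebesgue_measure R) (@measurable_itv R `[0%R, +oo[).

Definition marked_intensity (p : R) (m : bool -> probability (\bar R) R) :
    set (R * (bool * \bar R)) -> \bar R :=
  (halfline_lebesgue \x
    (fun A => \sum_(j : bool) (bernoulli_pmf p j)%:E * (\d_j \x m j) A))%E.

End state_spaces.

Arguments time_type R : clear implicits.
Arguments time_type_mark R : clear implicits.
Arguments halfline_lebesgue {R}.

(* Main.v *)
Require Import Defs.
From HB Require Import structures.
From mathcomp Require Import all_boot all_order all_algebra.
From mathcomp Require Import finmap.
From mathcomp Require Import all_classical all_reals all_analysis.
From mathcomp Require Import measurable_realfun.
From mathcomp Require Import ring lra.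

(** Label each entrance of the orbit by the set that is entered.  The quantities
    of interest are functions of the labelled entrance process stopped at its
    first point labelled 0 ([false]): the count [M_e] is the number of points
    labelled 1 ([true]) that precede it, and the sojourn time is the sum of the
    marks of these points, the mark of an entrance being the length of the visit
    that it begins.  For a Poisson process of intensity [lambda x B(p)] labels are
    independent of times, so this number is geometric, and the sum is a geometric
    sum of independent marks.  The proof transfers this to the limit.

    The stopped sum is not a continuous function of the point measure, and the
    space of point measures with the vague topology is used without a metric, so
    the continuous mapping theorem is replaced by a one-sided argument.  Call
    cozero the event that at least one of countably many inequalities [0 < F n],
    with [F n] continuous, holds; for such events the portmanteau inequality is
    true in any topological space ([portmanteau_cozero]).  For [O] open, [stopped_sum_event O] says that, for
    some times [q < s], the first point labelled 0 lies between [q] and [s], no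
    point labelled 1 does, and the sum of the marks before [q] is in [O].  It is
    cozero ([cozero_stopped_sum]), because counts are integers and are bounded on
    both sides by integrals of test functions.  On this event the stopped sum of the
    entrance process is in [O] ([stopped_entrances]).

    For the Poisson process the event has at least the probability that a compound
    geometric sum is in [O] ([stopped_sum_poisson_ge]).  Cut time by a grid and
    marks by small cells: the events that prescribe the cell of the first point
    labelled 0 and the numbers of preceding marks in each cell are disjoint, their
    probabilities are products of Poisson weights ([grid_event_prob]), and summing
    over the grid produces a negative binomial series, hence the geometric weights,
    as the step tends to 0 ([grid_weight_bound]).

    These two facts bound from below the lower limit of the probabilities of every
    open set.  Such bounds imply convergence in distribution ([portmanteau_open]),
    whence [cvg_stopped_sum].  For the event that a point labelled 0 comes first,
    a lower bound on the event and one on its complement add up to 1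
    ([cvg_no_success]).

    It remains to read a transformation or a flow as an entrance process.  For a
    flow, the locally finite structure of the visits gives each visit a start,
    identifies hitting times with first entrances unless the orbit begins inside
    the set, an event of vanishing probability, and decomposes the sojourn into
    visits ([flow_sojourn_entrances]).  Counts and hitting times are measurable
    because they are determined by the entrance process, the sojourn because
    visits can be tested along grids of times ([measurable_flow_sojourn]). *)

Set Implicit Arguments.
Unset Strict Implicit.
Unset Printing Implicit Defensive.

Import Order.TTheory GRing.Theory Num.Theory.
Import numFieldNormedType.Exports.

Local Open Scope classical_set_scope.
Local Open Scope ring_scope.

(** * Cozero sets and the portmanteau inequality *)

Section portmanteau.
Context {R : realType}.

Lemma cvge_near_gt (T : Type) (F : set_system T) (FF : Filter F)
    (f : T -> \bar R) (l c : \bar R) :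
  f @ F --> l -> (c < l)%E -> \forall x \near F, (c < f x)%E.
Proof.
move=> fl cl; apply: (fl [set y | (c < y)%E]).
by apply: open_nbhs_nbhs; split=> //; exact: open_ereal_gt_ereal.
Qed.

Section within_continuity.
Variables (W : topologicalType) (V : set W).
Implicit Types F G : W -> R.

Lemma within_cst (c : R) : {within V, continuous (fun=> c : R)}.
Proof. by move=> x; exact: cvg_cst. Qed.

Lemma withinM F G : {within V, continuous F} -> {within V, continuous G} ->
  {within V, continuous (fun w => F w * G w)}.
Proof. by move=> cF cG x; apply: cvgM; [exact: cF|exact: cG]. Qed.

Lemma withinB F G : {within V, continuous F} -> {within V, continuous G} ->
  {within V, continuous (fun w => F w - G w)}.
Proof. by move=> cF cG x; apply: cvgB; [exact: cF|exact: cG]. Qed.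

Lemma within_sum (F : nat -> W -> R) n :
  (forall i, {within V, continuous (F i)}) ->
  {within V, continuous (fun w => \sum_(i < n) F i w)}.
Proof.
move=> cF; elim: n => [|n IH].
  by under eq_fun do rewrite big_ord0; exact: within_cst.
under eq_fun do rewrite big_ord_recr.
by move=> x; apply: cvgD; [exact: IH|exact: cF].
Qed.

Lemma within_max F G : {within V, continuous F} -> {within V, continuous G} ->
  {within V, continuous (fun w => Order.max (F w) (G w))}.
Proof. by move=> cF cG x; apply: continuous_max; [exact: cF|exact: cG]. Qed.

Lemma within_min F G : {within V, continuous F} -> {within V, continuous G} ->
  {within V, continuous (fun w => Order.min (F w) (G w))}.
Proof. by move=> cF cG x; apply: continuous_min; [exact: cF|exact: cG]. Qed.

(** The preimage of an open interval is open relative to [V] only, which is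
    enough since [X] takes its values in [V]. *)
Lemma random_element_measurable d (Omega : measurableType d) (X : Omega -> W) F :
  random_element V X -> {within V, continuous F} ->
  measurable_fun setT (F \o X).
Proof.
move=> [XV mX] cF; apply: (measurability _ (RGenOpens.measurableE R)).
move=> _ [_ [a [b ->] <-]]; rewrite setTI.
have : open (F @^-1` `]a, b[%classic : set (subspace V)).
  by apply: open_comp => [x _|]; [exact: cF|exact: interval_open].
move=> /open_subspaceP[U oU UV].
rewrite (_ : _ @^-1` _ = X @^-1` U); first exact: mX.
apply/seteqP; split=> w /=.
  by move=> Fw; have [] : (U `&` V) (X w) by rewrite UV; split => //; exact: XV.
by move=> Uw; have [] : ((F @^-1` `]a, b[%classic) `&` V) (X w)
  by rewrite -UV; split => //; exact: XV.
Qed.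

End within_continuity.

(** In a topological space without a metric, the indicator of an open set need
    not be a limit of continuous functions.  The portmanteau inequality below
    is therefore restricted to the sets for which it visibly is one. *)
Definition cozero (W : topologicalType) (V O : set W) : Prop :=
  exists F : nat -> W -> R, (forall n, {within V, continuous (F n)}) /\
    forall w, V w -> (O w <-> exists n, 0 < F n w).

Section cozero_sets.
Variables (W : topologicalType) (V : set W).
Implicit Types O : set W.

Lemma cozero_gt0 (F : W -> R) : {within V, continuous F} -> cozero V [set w | 0 < F w].
Proof.
move=> cF; exists (fun=> F); split=> // w Vw /=.
by split=> [?|[_]//]; exists 0%N.
Qed.

Lemma cozero_eq O O' : (forall w, V w -> (O w <-> O' w)) ->
  cozero V O -> cozero V O'.
Proof.
by move=> OO' [F [cF FO]]; exists F; split => // w Vw; rewrite -OO'// FO.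
Qed.

(** The product of the positive parts of two functions is positive exactly
    where both are; pairs of indices are coded by natural numbers. *)
Lemma cozeroI O O' : cozero V O -> cozero V O' -> cozero V (O `&` O').
Proof.
move=> [F [cF FO]] [G [cG GO]].
pose H (n : nat) w : R := if @choice.unpickle (nat * nat)%type n is Some (i, j) then
  Order.max 0 (F i w) * Order.max 0 (G j w) else 0.
exists H; split.
  move=> n; rewrite /H; case: choice.unpickle => [[i j]|]; last exact: within_cst.
  by apply: withinM; apply: within_max => //; exact: within_cst.
move=> w Vw; split.
  move=> [/(FO _ Vw)[i Fi] /(GO _ Vw)[j Gj]]; exists (choice.pickle (i, j)).
  by rewrite /H choice.pickleK mulr_gt0// lt_max ?Fi ?Gj orbT.
move=> [n]; rewrite /H; case: choice.unpickle => [[i j]|]; last by rewrite ltxx.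
move=> /= FG; split.
  apply/(FO _ Vw); exists i; rewrite ltNge; apply/negP => Fi.
  by move: FG; rewrite (max_idPl Fi) mul0r ltxx.
apply/(GO _ Vw); exists j; rewrite ltNge; apply/negP => Gj.
by move: FG; rewrite (max_idPl Gj) mulr0 ltxx.
Qed.

Lemma cozero_bigcup (I : countType) (O : I -> set W) :
  (forall i, cozero V (O i)) -> cozero V [set w | exists i, O i w].
Proof.
move=> /choice[F FO].
pose H (n : nat) w : R := if @choice.unpickle (I * nat)%type n is Some (i, j) then F i j w else 0.
exists H; split.
  move=> n; rewrite /H; case: choice.unpickle => [[i j]|]; last exact: within_cst.
  by have [] := FO i.
move=> w Vw; split.
  move=> [i]; have [_ FOi] := FO i; move=> /(FOi _ Vw)[j Fij].
  by exists (choice.pickle (i, j)); rewrite /H choice.pickleK.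
move=> [n]; rewrite /H; case: choice.unpickle => [[i j]|]; last by rewrite ltxx.
by move=> Fij; exists i; have [_ FOi] := FO i; apply/(FOi _ Vw); exists j.
Qed.

Lemma cozero_set0 : cozero V set0.
Proof.
by exists (fun _ _ => 0); split=> [_|w _]; [exact: within_cst|
  split=> // -[_]; rewrite ltxx].
Qed.

Lemma cozero_and (A : Prop) O : (A -> cozero V O) -> cozero V [set w | A /\ O w].
Proof.
have [a cO|na _] := pselect A.
  by apply: cozero_eq (cO a) => w _; split => // -[].
by apply: cozero_eq cozero_set0 => w _; split=> // -[].
Qed.

Lemma cozero_measurable d (Omega : measurableType d) (X : Omega -> W) O :
  random_element V X -> cozero V O -> measurable (X @^-1` O).
Proof.
move=> rX [F [cF FO]]; have [XV mX] := rX.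
rewrite (_ : _ @^-1` _ = \bigcup_n [set w | 0 < F n (X w)]).
  apply: bigcupT_measurable => n; rewrite -[X in measurable X]setTI.
  exact: (measurable_fun_ltr (f := cst 0) (measurable_cst _)
    (random_element_measurable rX (cF n))).
by apply/seteqP; split=> w /=; [move=> /(FO _ (XV w))[n] Fn; exists n|
  move=> [n _ Fn]; apply/(FO _ (XV w)); exists n].
Qed.

End cozero_sets.

Lemma Rintegral_bounded d (Omega : measurableType d) (P : probability Omega R)
    (h : Omega -> R) : measurable_fun setT h -> (forall x, 0 <= h x <= 1) ->
  (\int[P]_x h x)%R%:E = (\int[P]_x (h x)%:E)%E.
Proof.
move=> mh h01; rewrite /Rintegral fineK// ge0_fin_numE; last first.
  by apply: integral_ge0 => x _; rewrite lee_fin; have /andP[] := h01 x.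
apply: (@le_lt_trans _ _ (\int[P]_x (cst 1%E x))%E).
  apply: ge0_le_integral => //=.
  - by move=> x _; rewrite lee_fin; have /andP[] := h01 x.
  - exact/measurable_EFinP.
  - by move=> x _; rewrite lee_fin; have /andP[] := h01 x.
by rewrite integral_cst// mul1e; apply: le_lt_trans (probability_le1 P measurableT) _; rewrite ltry.
Qed.

Section portmanteau_inequality.
Context d (Omega : measurableType d) (P : probability Omega R).
Context d' (Omega' : measurableType d') (P' : probability Omega' R).

(** One half of the portmanteau theorem: the indicator of a cozero set is an
    increasing limit of continuous functions with values in [0, 1]. *)
Lemma portmanteau_cozero (W : topologicalType) (V : set W)
    (X : R -> Omega -> W) (X' : Omega' -> W) (O : set W) (c : \bar R) :
  cvg_in_distribution P P' V X X' -> cozero V O -> (c < P' (X' @^-1` O))%E ->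
  \forall e \near 0^'+, (c < P (X e @^-1` O))%E.
Proof.
move=> [rX rX' cX] cO cP; have [F [cF FO]] := cO.
(* [H n] increases to the indicator of [O]. *)
pose s n w : R := \sum_(i < n) Order.max 0 (F i w).
pose H n w : R := Order.min 1 (n%:R * s n w).
have s0 n w : 0 <= s n w by apply: sumr_ge0 => i _; rewrite le_max lexx.
have cH n : {within V, continuous (H n)}.
  apply: within_min; first exact: within_cst.
  apply: withinM; first exact: within_cst.
  apply: (within_sum (F := fun i w => Order.max 0 (F i w))) => i.
  by apply: within_max => //; exact: within_cst.
have H01 n w : 0 <= H n w <= 1.
  by rewrite le_min ler01 ge_min lexx /= andbT mulr_ge0.
have sO n w : V w -> ~ O w -> s n w = 0.
  move=> Vw nOw; apply: big1 => i _; apply/max_idPl; rewrite leNgt.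
  by apply/negP => Fi; apply: nOw; apply/(FO _ Vw); exists i.
have H0 n w : V w -> ~ O w -> H n w = 0.
  by move=> Vw nOw; rewrite /H sO// mulr0 min_r.
have ndH w : {homo (fun n => (H n w)%:E) : m n / (m <= n)%N >-> (m <= n)%E}.
  move=> m n mn; rewrite lee_fin /H le_min ge_min lexx /= ge_min.
  apply/orP; right; rewrite ler_pM ?ler_nat//.
  rewrite /s -!(big_mkord xpredT (fun i => Order.max 0 (F i w))).
  rewrite [leRHS](big_cat_nat (n := m))//= lerDl sumr_ge0// => i _.
  by rewrite le_max lexx.
have HO w : V w -> (H n w)%:E @[n --> \oo] --> (\1_O w : R)%:E.
  move=> Vw; have [Ow|nOw] := pselect (O w); last first.
    rewrite indicE memNset//; under eq_fun do rewrite H0//.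
    exact: cvg_cst.
  rewrite indicE mem_set//; have [i Fi] := (FO _ Vw).1 Ow.
  apply/fine_cvgP; split; first by near=> n.
  apply: cvg_near_cst; near=> n => /=; apply/min_idPl.
  have in_ : (i < n)%N by near: n; exact: nbhs_infty_gt.
  apply: (@le_trans _ _ (n%:R * F i w)).
    by rewrite -ler_pdivrMr// mul1r; near: n; exact: nbhs_infty_ger.
  rewrite ler_pM2l; last by rewrite ltr0n (leq_trans _ in_).
  rewrite /s (bigD1 (Ordinal in_))//= (le_trans (y := Order.max 0 (F i w)))//.
    by rewrite le_max lexx orbT.
  by rewrite lerDl sumr_ge0// => j _; rewrite le_max lexx.
have mX' := cozero_measurable rX' cO.
have IH d0 (Om : measurableType d0) (P0 : probability Om R) (Y : Om -> W) n :
  random_element V Y -> (\int[P0]_x H n (Y x))%R%:E = (\int[P0]_x (H n (Y x))%:E)%E.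
  move=> rY; apply: Rintegral_bounded; last by move=> x; exact: H01.
  exact: random_element_measurable rY (cH n).
have [n cn] : exists n, (c < (\int[P']_x H n (X' x))%R%:E)%E.
  have : (\int[P']_x (H n (X' x))%:E)%E @[n --> \oo] --> P' (X' @^-1` O).
    rewrite -[X in P' X]setIT -integral_indic//.
    have -> : (\int[P']_x (\1_(X' @^-1` O) x)%:E =
               \int[P']_x limn (fun n => (H n (X' x))%:E))%E.
      apply: eq_integral => x _; apply/esym/cvg_lim => //.
      by have := HO (X' x) (rX'.1 x); rewrite !indicE.
    apply: cvg_monotone_convergence => //.
    - move=> n; apply/measurable_EFinP.
      exact: random_element_measurable rX' (cH n).
    - by move=> n x _; rewrite lee_fin; have /andP[] := H01 n (X' x).
  move=> /cvge_near_gt/(_ cP)[N _ Nc].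
  by exists N; rewrite IH//; exact: (Nc N (leqnn N)).
have cvH := cX _ (cH n) (ex_intro _ 1 _).
have Hb w : V w -> `|H n w| <= 1.
  by move=> _; have /andP[h0 h1] := H01 n w; rewrite ger0_norm.
have : \forall e \near 0^'+, (c < (\int[P]_x H n (X e x))%R%:E)%E.
  have : ((\int[P]_x H n (X e x))%:E @[e --> 0^'+] -->
      (\int[P']_x H n (X' x))%:E)%E by apply: cvg_EFin; [near=> e|exact: cvH].
  by move=> /cvge_near_gt; exact.
move=> ce; near=> e.
have e0 : 0 < e by near: e; exact: nbhs_right_gt.
have /lt_le_trans -> // : (c < (\int[P]_x H n (X e x))%R%:E)%E by near: e.
have rXe := rX _ e0; have mXe := cozero_measurable rXe cO.
rewrite IH// -[X in P X]setIT -integral_indic//.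
apply: ge0_le_integral => //.
- by move=> x _; rewrite lee_fin; have /andP[] := H01 n (X e x).
- by apply/measurable_EFinP; exact: random_element_measurable rXe (cH n).
- by apply/measurable_EFinP; exact: measurable_indic.
move=> x _; rewrite lee_fin indicE.
have [Ox|nOx] := pselect (O (X e x)).
  by rewrite mem_set//; have /andP[] := H01 n (X e x).
by rewrite H0//; case: rXe.
Unshelve. all: by end_near.
Qed.

End portmanteau_inequality.
End portmanteau.
Arguments cozero R {W} V O.

(** * Convergence in distribution from open sets *)

Section converse_portmanteau.
Context {R : realType}.

(** The number of integers among 1, ..., [n] that lie below [x] recovers [x] up
    to one, as long as [x] does not exceed [n.+1]. *)
Lemma sum_lt_bounds (n : nat) (x : R) : 0 <= x ->
  let s : R := \sum_(i < n) (i.+1%:R < x)%R%:R in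
  [/\ x <= n.+1%:R -> x - 1 <= s, n%:R <= x - 1 -> n%:R <= s, s <= x & s <= n%:R].
Proof.
move=> x0 /=; elim: n => [|n [IH1 IH2 IH3 IH4]].
  by rewrite big_ord0; split=> //; lra.
rewrite big_ord_recr/= -[n.+2%:R]natr1; move: IH1 IH2 IH3 IH4.
rewrite -[n.+1%:R]natr1; set s := \sum_(_ < _) _; move: (n%:R) => a.
by case: ltP => ax h1 h2 h3 h4; split => /=;
  case: (lerP x (a + 1)) => xa; try have := h1 xa;
  case: (lerP a (x - 1)) => ax1; try have := h2 ax1; lra.
Qed.

(** Layer cake: rounding [g] down to a multiple of [1 / n] costs at most
    [1 / n], and the rounded function is a sum of indicators. *)
Lemma integral_stairs d (Omega : measurableType d) (P : probability Omega R)
    (g : Omega -> R) (n : nat) :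
  measurable_fun setT g -> (forall x, 0 <= g x <= 1) -> (0 < n)%N ->
  n%:R^-1 * \sum_(i < n) fine (P [set x | i.+1%:R < n%:R * g x])
    <= \int[P]_x g x <=
  n%:R^-1 * \sum_(i < n) fine (P [set x | i.+1%:R < n%:R * g x]) + n%:R^-1.
Proof.
move=> mg g01 n0; set s := _ * _; have n0R : 0 < n%:R :> R by rewrite ltr0n.
have mA (i : nat) : measurable [set x | i%:R < n%:R * g x].
  rewrite -[X in measurable X]setTI; apply: measurable_fun_ltr => //.
  exact: measurable_funM.
pose st x : R := n%:R^-1 * \sum_(i < n) (i.+1%:R < n%:R * g x)%R%:R.
have stE x : st x = n%:R^-1 * \sum_(i < n) \1_[set x | i.+1%:R < n%:R * g x] x.
  congr (_ * _); apply: eq_bigr => i _; rewrite indicE; congr (_ %:R).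
  by congr nat_of_bool; apply/idP/idP => [?|]; [rewrite inE|rewrite inE].
have st0 x : 0 <= st x by rewrite mulr_ge0 ?invr_ge0 ?ler0n// sumr_ge0.
have mst : measurable_fun setT st.
  rewrite (funext stE).
  apply: measurable_funM => //; apply: measurable_sum => i.
  exact: measurable_indic.
have sE : (s%:E = \int[P]_x (st x)%:E)%E.
  under eq_integral do rewrite stE EFinM -sumEFin.
  rewrite ge0_integralZl_EFin ?invr_ge0//; last 2 first.
  - by move=> x _; apply: sume_ge0 => i _; rewrite lee_fin.
  - apply: emeasurable_sum => i; apply/measurable_EFinP; exact: measurable_indic.
  rewrite ge0_integral_sum//; last first.
    by move=> i; apply/measurable_EFinP; exact: measurable_indic.
  rewrite /s EFinM -sumEFin; congr (_ * _)%E; apply: eq_bigr => i _.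
  by rewrite integral_indic// setIT fineK// fin_num_measure.
have gst x : st x <= g x <= st x + n%:R^-1.
  have /andP[g0 g1] := g01 x.
  have [] := @sum_lt_bounds n (n%:R * g x) (mulr_ge0 (ltW n0R) g0).
  have h : n%:R * g x <= n.+1%:R.
    by rewrite (le_trans (y := n%:R))// ?ler_nat// ler_piMr// ltW.
  move=> /(_ h) h1 _ h2 _; rewrite /st -ler_pdivlMl ?invr_gt0// invrK h2/=.
  by rewrite -[X in _ + X]mulr1 -mulrDr -ler_pdivrMl ?invr_gt0// invrK -lerBlDr.
have G : ((\int[P]_x g x)%R%:E = \int[P]_x (g x)%:E)%E.
  exact: Rintegral_bounded.
rewrite -!lee_fin EFinD G sE; apply/andP; split.
  apply: ge0_le_integral => //; [by move=> x _; rewrite lee_fin| | |].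
  - exact/measurable_EFinP.
  - exact/measurable_EFinP.
  - by move=> x _; rewrite lee_fin; have /andP[] := gst x.
have -> : (n%:R^-1%:E = \int[P]_x (cst n%:R^-1%:E x) :> \bar R)%E.
  by rewrite integral_cst//= probability_setT mule1.
rewrite -ge0_integralD//; last 3 first.
- by move=> x _; rewrite lee_fin.
- exact/measurable_EFinP.
- by move=> x _; rewrite lee_fin invr_ge0.
apply: ge0_le_integral => //.
- by move=> x _; rewrite lee_fin; have /andP[] := g01 x.
- exact/measurable_EFinP.
- by apply: emeasurable_funD => //; exact/measurable_EFinP.
by move=> x _; rewrite lee_fin; have /andP[] := gst x.
Qed.

Context d (Omega : measurableType d) (P : probability Omega R).
Context d' (Omega' : measurableType d') (P' : probability Omega' R).

Section open_sets.
Variables (W : topologicalType) (Z : R -> Omega -> W) (Z' : Omega' -> W).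
Hypothesis rZ : forall e : R, 0 < e -> random_element setT (Z e).
Hypothesis rZ' : random_element setT Z'.
Hypothesis liminf_open : forall (O : set W) (c : R), open O ->
  (c%:E < P' (Z' @^-1` O))%E -> \forall e \near 0^'+, (c%:E < P (Z e @^-1` O))%E.

(** The superlevel sets of a continuous function are open, and by
    [integral_stairs] finitely many of them determine its integral. *)
Let lower_bound (G : W -> R) (a : R) : continuous G ->
  (forall w, 0 <= G w <= 1) -> a < \int[P']_y G (Z' y) ->
  \forall e \near 0^'+, a < \int[P]_x G (Z e x).
Proof.
move=> cG G01 aG; set b := \int[P']_y G (Z' y) in aG.
have cG' : {within setT, continuous G} by exact: continuous_subspaceT.
pose n := (Num.truncn (2 / (b - a))).+1.
have nba : 2 * n%:R^-1 < b - a.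
  have ba0 : 0 < b - a by rewrite subr_gt0.
  rewrite ltr_pdivrMr ?ltr0n// mulrC -ltr_pdivrMr//.
  by have /andP[_] := truncn_itv (divr_ge0 (ler0n R 2) (ltW ba0)).
pose L (i : nat) : set W := [set w | (i%:R : R) < n%:R * G w].
have oG (i : nat) : open (L i).
  apply: (@open_comp _ _ (fun w => n%:R * G w) [set y | i%:R < y]).
    by move=> w _; apply: cvgM; [exact: cvg_cst|exact: cG].
  exact: open_gt.
have n0 : (0 < n)%N by [].
have mG' := random_element_measurable rZ' cG'.
have /andP[_ hi] := integral_stairs P' mG' (fun y => G01 (Z' y)) n0.
have near_all : \forall e \near 0^'+, forall i : 'I_n,
   fine (P' (Z' @^-1` L i.+1)) - n%:R^-1 <
   fine (P (Z e @^-1` L i.+1)).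
  apply: filter_forall => i.
  have mi' := rZ'.2 _ (oG i.+1).
  have : ((fine (P' (Z' @^-1` L i.+1)) - n%:R^-1)%:E <
      P' (Z' @^-1` L i.+1))%E.
    rewrite -[ltRHS]fineK ?fin_num_measure// lte_fin gtrBl.
    by rewrite invr_gt0 ltr0n.
  move=> /(liminf_open (oG i.+1)) Ni; near=> e.
  have e0 : 0 < e by near: e; exact: nbhs_right_gt.
  have me := (rZ e0).2 _ (oG i.+1).
  rewrite -lte_fin [ltRHS]fineK ?fin_num_measure//.
  by near: e; exact: Ni.
near=> e.
have e0 : 0 < e by near: e; exact: nbhs_right_gt.
have mG := random_element_measurable (rZ e0) cG'.
have /andP[lo _] := integral_stairs P mG (fun y => G01 (Z e y)) n0.
apply: lt_le_trans lo; rewrite -/b in hi.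
apply: (@lt_le_trans _ _ (b - 2 * n%:R^-1)); first lra.
have : \sum_(i < n) (fine (P' (Z' @^-1` L i.+1)) - n%:R^-1) <=
   \sum_(i < n) fine (P (Z e @^-1` L i.+1)).
  by apply: ler_sum => i _; apply: ltW; move: i; near: e; exact: near_all.
rewrite sumrB sumr_const card_ord -[_^-1 *+ _]mulr_natl mulfV ?pnatr_eq0//.
move=> hs; have {}hs := ler_wpM2l (ltW (_ : 0 < n%:R^-1 :> R)) hs.
have {}hs := hs (ltac:(by rewrite invr_gt0 ltr0n)).
apply: le_trans hs; rewrite mulrBr mulr1.
set u := _ * _ in hi *; set v := (n%:R^-1 : R) in hi *.
by move: hi; rewrite -/u; move: (u) (v) => u' v' hi; lra.
Unshelve. all: by end_near.
Qed.

(** The other half of the portmanteau theorem: lower bounds on the integrals of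
    both [F] and [- F] determine the limit. *)
Lemma portmanteau_open : cvg_in_distribution P P' setT Z Z'.
Proof.
split=> // F cF [c Fc].
have {}cF : continuous F.
  by move=> w; move: (cF w); rewrite /continuous_at nbhs_subspaceT.
pose C := `|c| + 1; have C0 : 0 < C by rewrite ltr_wpDl.
have FC w : - C <= F w <= C.
  by rewrite -ler_norml (le_trans (Fc w I))// ler_wpDr// ler_norm.
have mF d0 (Om : measurableType d0) (Y : Om -> W) : random_element setT Y ->
    measurable_fun setT (F \o Y).
  by move=> rY; apply: (random_element_measurable rY); exact: continuous_subspaceT.
have affine (s : R) d0 (Om : measurableType d0) (P0 : probability Om R)
    (Y : Om -> W) : random_element setT Y ->
  \int[P0]_x (2^-1 + (s / (2 * C)) * F (Y x)) =
    2^-1 + (s / (2 * C)) * \int[P0]_x F (Y x).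
  move=> rY.
  have iF : P0.-integrable setT (EFin \o (F \o Y)).
    apply: (@le_integrable _ _ _ _ _ _ _ (EFin \o cst C)) => //.
    - exact/measurable_EFinP/mF.
    - by move=> x _ /=; rewrite lee_fin (ger0_norm (ltW C0)) ler_norml FC.
    - exact: finite_measure_integrable_cst.
  rewrite (@RintegralD _ _ _ P0 setT (cst 2^-1) (fun x => _ * F (Y x)))//.
  - by rewrite Rintegral_cst//= probability_setT mulr1 RintegralZl.
  - exact: finite_measure_integrable_cst.
  - by have := integrableZl measurableT (s / (2 * C)) iF.
(* [G] is [s * F], rescaled affinely to take its values in [0, 1]. *)
have key (s a : R) : `|s| = 1 -> a < s * \int[P']_y F (Z' y) ->
    \forall e \near 0^'+, a < s * \int[P]_x F (Z e x).
  move=> s1 aF.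
  pose G w := 2^-1 + (s / (2 * C)) * F w.
  have k (x : R) : s / (2 * C) * x = (s * x) / (2 * C) by rewrite mulrAC.
  have : 2^-1 + a / (2 * C) < \int[P']_y G (Z' y).
    by rewrite affine// ltrD2l k ltr_pM2r// invr_gt0 mulr_gt0.
  have cG : continuous G.
    move=> w; apply: cvgD; first exact: cvg_cst.
    by apply: cvgM; [exact: cvg_cst|exact: cF].
  have G01 w : 0 <= G w <= 1.
    have : `|s / (2 * C) * F w| <= 2^-1.
      rewrite k normrM normfV (gtr0_norm (mulr_gt0 _ C0))// normrM s1 mul1r.
      by rewrite ler_pdivrMr ?mulr_gt0// mulrA mulVf// mul1r ler_norml FC.
    by rewrite ler_norml /G; move: (_ * F w) => u /andP[]; lra.
  move=> /(lower_bound cG G01) lb; near=> e.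
  have e0 : 0 < e by near: e; exact: nbhs_right_gt.
  have : 2^-1 + a / (2 * C) < \int[P]_x G (Z e x) by near: e; exact: lb.
  by rewrite affine//; [rewrite ltrD2l k ltr_pM2r// invr_gt0 mulr_gt0|exact: rZ].
apply/cvgrPdist_lt => eps eps0.
have n1 : `|1 : R| = 1 by rewrite normr1.
have nN1 : `|-1 : R| = 1 by rewrite normrN normr1.
set l := \int[P']_y F (Z' y).
have up : \forall e \near 0^'+, l - eps < 1 * \int[P]_x F (Z e x).
  by apply: key => //; rewrite mul1r gtrBl.
have down : \forall e \near 0^'+, - l - eps < -1 * \int[P]_x F (Z e x).
  by apply: key => //; rewrite mulN1r gtrBl.
near=> e; rewrite ltr_norml.
have : l - eps < 1 * \int[P]_x F (Z e x) by near: e.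
have : - l - eps < -1 * \int[P]_x F (Z e x) by near: e.
by move: (\int[P]_x F (Z e x)) => u; rewrite mul1r mulN1r; lra.
Unshelve. all: by end_near.
Qed.

End open_sets.

(** Two lower bounds that add up to 1 determine the limit. *)
Lemma cvg_probability_two_sided (A : R -> set Omega) (c : R) :
  (forall e : R, 0 < e -> measurable (A e)) ->
  (forall a : R, a < c -> \forall e \near 0^'+, (a%:E < P (A e))%E) ->
  (forall a : R, a < 1 - c -> \forall e \near 0^'+, (a%:E < P (~` A e))%E) ->
  P (A e) @[e --> 0^'+] --> c%:E.
Proof.
move=> mA lo hi; have fA : \forall e \near 0^'+, P (A e) \is a fin_num.
  near=> e; rewrite fin_num_measure//; apply: mA.
  by near: e; exact: nbhs_right_gt.
apply/fine_cvgP; split=> //; apply/cvgrPdist_lt => eps eps0.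
have up : \forall e \near 0^'+, ((c - eps)%:E < P (A e))%E.
  by apply: lo; rewrite gtrBl.
have down : \forall e \near 0^'+, ((1 - c - eps)%:E < P (~` A e))%E.
  by apply: hi; rewrite gtrBl.
near=> e.
have e0 : 0 < e by near: e; exact: nbhs_right_gt.
have : ((1 - c - eps)%:E < P (~` A e))%E by near: e.
have : ((c - eps)%:E < P (A e))%E by near: e.
rewrite probability_setC; last exact: mA.
rewrite /= -[P (A e)]fineK; last by near: e.
by rewrite -EFinB !lte_fin ltr_norml; lra.
Unshelve. all: by end_near.
Qed.

End converse_portmanteau.

(** * Sums of Dirac masses *)

Section dirac_sums.
Context {R : realType} d (T : measurableType d) (C : choiceType).
Variables (I : set C) (z : C -> T).

Lemma dirac_sum_counting (A : set T) :
  dirac_sum R I z A = counting (I `&` z @^-1` A).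
Proof.
rewrite /dirac_sum.
have -> : (\esum_(i in I) (\d_(z i) A : \bar R) =
    \esum_(i in I `&` z @^-1` A) 1)%E.
  rewrite esum_mkcondr; apply: eq_esum => i Ii; rewrite diracE.
  have [zA|zA] := pselect (A (z i)); first by rewrite !mem_set.
  by rewrite !memNset.
rewrite /counting; set J := I `&` _; case: asboolP => [fJ|iJ].
  by rewrite esum_fset// fsbig_finite//= sumEFin big_const_seq count_predT
    iter_addr_0.
apply: eq_infty => r.
have [n rn] : exists n : nat, r <= n%:R.
  by exists (Num.truncn r).+1; rewrite ltW// truncnS_gt.
have [B BJ Bn] := infinite_set_fset n iJ.
apply: esum_ge; exists [set` B]; first by split.
rewrite fsbig_finite//= set_fsetK.
rewrite sumEFin big_const_seq count_predT iter_addr_0 lee_fin.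
by rewrite (le_trans rn)// ler_nat.
Qed.

(** On the measurable subsets of [A] the measure is a finite sum of Dirac
    masses, over the points that lie in [A]. *)
Lemma integral_dirac_sum (A : set T) (f : T -> \bar R) :
  measurable A -> finite_set (I `&` z @^-1` A) ->
  measurable_fun A f -> (forall u, A u -> (0 <= f u)%E) ->
  (\int[dirac_sum R I z]_(u in A) f u =
   \sum_(i <- fset_set (I `&` z @^-1` A)) f (z i))%E.
Proof.
move=> mA fJ mf f0; set J := I `&` _; set s : seq C := fset_set J.
have sJ i : i \in s -> A (z i).
  by rewrite in_fset_set// inE => -[].
have dsE B : measurable B -> B `<=` A ->
    dirac_sum R I z B = (\sum_(i <- s) \d_(z i) B)%E.
  move=> mB BA; rewrite /dirac_sum.
  transitivity (\esum_(i in J) (\d_(z i) B : \bar R))%E.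
    rewrite /J esum_mkcondr; apply: eq_esum => i Ii.
    case: ifPn => // /negP nA; rewrite diracE memNset// => /BA Az.
    by apply: nA; rewrite inE.
  by rewrite esum_fset// fsbig_finite.
have [s0|] := eqVneq s [::].
  rewrite s0 big_nil; apply: null_set_integral => //.
  by rewrite [LHS]dsE// s0 big_nil.
case: (s) sJ dsE => // c s' sJ dsE _; set t := c :: s' in sJ dsE *.
rewrite (eq_measure_integral (msum (fun i => \d_(z (nth c t i))) (size t))).
  rewrite ge0_integral_measure_sum// (big_nth c) big_mkord.
  apply: eq_bigr => i _; rewrite integral_dirac// diracE mem_set ?mul1e//.
  by apply: sJ; exact: mem_nth.
by move=> B mB BA; rewrite [LHS]dsE// (big_nth c) big_mkord.
Qed.

End dirac_sums.

(** * Marked point measures and their test functions *)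

(** Piecewise linear cutoff: 1 on the left of [a], 0 on the right of [b]. *)
Definition cutoff {R : realType} (a b t : R) : R :=
  Order.min 1 (Order.max 0 ((b - t) / (b - a))).

Section cutoff.
Context {R : realType}.
Implicit Types a b t : R.

Lemma cutoff01 a b t : 0 <= cutoff a b t <= 1.
Proof. by rewrite /cutoff le_min ler01 le_max lexx ge_min lexx. Qed.

Lemma cutoff1 a b t : a < b -> t <= a -> cutoff a b t = 1.
Proof.
move=> ab ta; apply/min_idPl; rewrite le_max; apply/orP; right.
by rewrite ler_pdivlMr ?subr_gt0// mul1r lerB.
Qed.

Lemma cutoff0 a b t : a < b -> b <= t -> cutoff a b t = 0.
Proof.
move=> ab bt; rewrite /cutoff (max_idPl _) ?min_r//.
by rewrite ler_pdivrMr ?subr_gt0// mul0r subr_le0.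
Qed.

Lemma continuous_cutoff a b : continuous (cutoff a b).
Proof.
pose f t : R := (b - t) / (b - a); have cf : continuous f.
  move=> t; apply: cvgM; last exact: cvg_cst.
  by apply: cvgB; [exact: cvg_cst|exact: cvg_id].
rewrite -[cutoff a b]/(fun t => Order.min (cst 1 t) (Order.max (cst 0 t) (f t))).
move=> t; apply: continuous_min; first exact: cvg_cst.
by apply: continuous_max; [exact: cvg_cst|exact: cf].
Qed.

End cutoff.

(** Truncation at level [c]: marks are unbounded, test functions are not. *)
Definition capped {R : realType} (c : R) (y : \bar R) : R :=
  fine (Order.min (Order.max y 0%E) c%:E).

Section capped.
Context {R : realType}.
Implicit Types (c : R) (y : \bar R).

Lemma cappedE c y : 0 <= c -> (0 <= y)%E -> (capped c y)%:E = Order.min y c%:E.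
Proof.
move=> c0 y0; rewrite /capped (max_idPl y0).
by case: y y0 => [r||]//= r0; rewrite -EFin_min. 
Qed.

Lemma capped_ge0 c y : 0 <= c -> 0 <= capped c y.
Proof.
by move=> c0; rewrite /capped fine_ge0// le_min lee_fin c0 andbT le_max lexx orbT.
Qed.

Lemma capped_le c y : 0 <= c -> capped c y <= c.
Proof.
move=> c0; rewrite -lee_fin /capped fineK ?ge_min ?lexx ?orbT//.
rewrite fin_numElt; apply/andP; split.
  by rewrite (@lt_le_trans _ _ 0%E)// le_min lee_fin c0 andbT le_max lexx orbT.
by rewrite (@le_lt_trans _ _ c%:E)// ?ltry// ge_min lexx orbT.
Qed.

Lemma capped_fin c (r : R) : 0 <= c -> capped c r%:E = Order.min (Order.max r 0) c.
Proof.
move=> c0; rewrite /capped -EFin_max -EFin_min//.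
Qed.

Lemma continuous_capped c : 0 <= c -> continuous (capped c).
Proof.
move=> c0 [r||].
- rewrite /continuous_at capped_fin//.
  have h : {for r, continuous (fun s : R => Order.min (Order.max s (cst 0 s)) (cst c s))}.
    apply: continuous_min; last exact: cvg_cst.
    by apply: continuous_max; [exact: cvg_id|exact: cvg_cst].
  move=> A /h rA.
  have : \forall s \near r, A (capped c s%:E).
    by near=> s; rewrite capped_fin//; near: s; exact: rA.
  by [].
- apply: (@cvg_near_cst _ _ _ _ (nbhs (+oo%E : \bar R))).
  exists c; split; first by rewrite num_real.
  by move=> y cy; rewrite /capped !min_r ?leey// le_max (ltW cy).
- apply: (@cvg_near_cst _ _ _ _ (nbhs (-oo%E : \bar R))).
  exists 0; split; first by rewrite num_real.
  by move=> y y0; rewrite /capped !max_r ?leNye// ltW.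
Unshelve. all: by end_near.
Qed.

End capped.

Section marked_point_measures.
Context {R : realType} dT (T : topMeasurableType dT) (S : set T).
Variables (tm : T -> R) (lb : T -> bool) (mk : T -> \bar R).

(** Points carry a time, a label and a nonnegative mark.  By [compact_time], a
    function that vanishes after some time has compact support, and a point
    measure has finitely many points before any given time. *)
Record marked_space : Prop := MarkedSpace {
  measurable_space : measurable S ;
  measurable_time : measurable_fun setT tm ;
  measurable_label : measurable_fun setT lb ;
  measurable_mark : measurable_fun setT mk ;
  continuous_time : continuous tm ;
  continuous_label : continuous lb ;
  continuous_mark : continuous mk ;
  time_ge0 : forall u, S u -> 0 <= tm u ;
  mark_ge0 : forall u, S u -> (0 <= mk u)%E ;
  compact_time : forall q, compact [set u | S u /\ tm u <= q] }.

Hypothesis HS : marked_space.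

Local Notation V := (point_measures R S).
Implicit Types (w : vague_measure R S) (A : set T) (q : R) (j : bool).

Definition points_before q j : set T := [set u | [/\ S u, tm u < q & lb u = j]].
Definition points_upto q j : set T := [set u | [/\ S u, tm u <= q & lb u = j]].

Local Notation N w := (w : measure T R).

Lemma point_measure_natural w A : V w -> measurable A ->
  N w A = +oo%E \/ exists n : nat, N w A = n%:R%:E.
Proof.
move=> [[I [z [_ wE]]] _] mA; rewrite wE// dirac_sum_counting /counting.
by case: ifP => _; [right; eexists|left].
Qed.

Lemma measurable_label_eq j : measurable [set u | lb u = j].
Proof.
rewrite -[X in measurable X]setTI.
exact: (measurable_label HS measurableT (Y := [set j])).
Qed.

Lemma measurable_points_before q j : measurable (points_before q j).
Proof.
rewrite (_ : points_before q j = S `&` [set u | tm u < q] `&` [set u | lb u = j]).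
  apply: measurableI; last exact: measurable_label_eq.
  apply: measurableI; first exact: measurable_space.
  rewrite -[X in measurable X]setTI; apply: measurable_fun_ltr => //.
  exact: measurable_time.
by apply/seteqP; split=> u /=; [case|case=> -[]].
Qed.

Lemma measurable_points_upto q j : measurable (points_upto q j).
Proof.
rewrite (_ : points_upto q j = S `&` [set u | tm u <= q] `&` [set u | lb u = j]).
  apply: measurableI; last exact: measurable_label_eq.
  apply: measurableI; first exact: measurable_space.
  rewrite -[X in measurable X]setTI; apply: measurable_fun_ler => //.
  exact: measurable_time.
by apply/seteqP; split=> u /=; [case|case=> -[]].
Qed.

Lemma points_upto_fin w q j : V w -> (N w (points_upto q j) < +oo)%E.
Proof.
move=> [_ fw]; have KS : [set u | S u /\ tm u <= q] `<=` S by move=> u [].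
apply: le_lt_trans (fw _ (compact_time HS (q := q)) KS).
apply: le_measure; rewrite ?inE.
- exact: measurable_points_upto.
- apply: measurableI; first exact: measurable_space.
  rewrite -[X in measurable X]setTI; apply: measurable_fun_ler => //.
  exact: measurable_time.
by move=> u [].
Qed.

Lemma points_before_upto q j : points_before q j `<=` points_upto q j.
Proof. by move=> u [? /ltW]. Qed.

Lemma points_upto_before q q' j : q < q' -> points_upto q j `<=` points_before q' j.
Proof. by move=> qq' u [Su tu lu]; split=> //; exact: le_lt_trans qq'. Qed.

Lemma points_before_le q q' j : q <= q' -> points_before q j `<=` points_before q' j.
Proof. by move=> qq' u [Su tu lu]; split=> //; exact: lt_le_trans qq'. Qed.

Lemma points_before_fin w q j : V w -> (N w (points_before q j) < +oo)%E.
Proof.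
move=> Vw; apply: le_lt_trans (points_upto_fin q j Vw); apply: le_measure.
- by rewrite inE; exact: measurable_points_before.
- by rewrite inE; exact: measurable_points_upto.
exact: points_before_upto.
Qed.

Definition test_integrand j (g : \bar R -> R) a b (u : T) : R :=
  cutoff a b (tm u) * (lb u == j)%:R * g (mk u).

Definition test_integral j g a b w : R :=
  (\int[N w]_(u in S) test_integrand j g a b u)%R.

(** Labels form a discrete space and the cutoff vanishes outside a compact set,
    so the integrand is an admissible test function for the vague topology. *)
Lemma continuous_test_integral j g a b : a < b -> continuous g ->
  {within V, continuous (test_integral j g a b)}.
Proof.
move=> ab cg; have cf : continuous (test_integrand j g a b).
  move=> u; apply: cvgM; last first.
    by apply: continuous_comp; [exact: continuous_mark|exact: cg].
  apply: cvgM.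
    by apply: continuous_comp; [exact: continuous_time|exact: continuous_cutoff].
  apply: (@continuous_comp _ _ _ lb (fun i : bool => (i == j)%:R : R)).
    exact: continuous_label.
  move=> A /nbhs_singleton Aj; rewrite /nbhs/=.
  by apply/principal_filterP.
have tf : {within S, continuous (test_integrand j g a b)} /\
    exists K, [/\ compact K, K `<=` S &
      forall x, S x -> ~ K x -> test_integrand j g a b x = 0].
  split; first exact: continuous_subspaceT.
  exists [set u | S u /\ tm u <= b]; split.
  - exact: compact_time.
  - by move=> u [].
  move=> u Su nK; rewrite /test_integrand cutoff0 ?mul0r//.
  by rewrite leNgt; apply/negP => ub; apply: nK; split=> //; exact: ltW.
apply: continuous_subspaceT => w.
have c1 := @initial_continuous _ _ (@vague_eval _ T R S) w.
have c2 := @proj_continuous _ (fun=> R) (exist _ _ tf : test_function R S)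
  (vague_eval (S := S) w).
exact: (cvg_comp _ _ c1 c2).
Qed.

End marked_point_measures.

(** * Counts of points in the vague topology *)

Section cozero_counts.
Context {R : realType} dT (T : topMeasurableType dT) (S : set T).
Variables (tm : T -> R) (lb : T -> bool) (mk : T -> \bar R).
Hypothesis HS : marked_space S tm lb mk.

Local Notation V := (point_measures R S).
Local Notation before := (points_before S tm lb).
Local Notation upto := (points_upto S tm lb).
Local Notation N w := (w : measure T R).
Local Notation test := (test_integral tm lb mk).
Implicit Types (w : vague_measure R S) (q : R) (j : bool).

Let mbefore q j := measurable_points_before HS q j.
Let mupto q j := measurable_points_upto HS q j.

Lemma measurable_test_integrand j (g : \bar R -> R) a b :
  measurable_fun setT (g \o mk) ->
  measurable_fun setT (test_integrand tm lb mk j g a b).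
Proof.
move=> mg; apply: measurable_funM => //; apply: measurable_funM.
  apply: (measurableT_comp (f := cutoff a b)); last exact: measurable_time HS.
  by apply: continuous_measurable_fun; exact: continuous_cutoff.
apply: (@measurableT_comp _ _ _ _ _ _ (fun i : bool => (i == j)%:R : R)) => //.
exact: measurable_label HS.
Qed.

Lemma measurable_capped_mark c : measurable_fun setT (capped c \o mk).
Proof.
apply: (measurableT_comp (f := fine)); first exact: fine_measurable.
apply: measurable_mine => //; apply: measurable_maxe => //.
exact: measurable_mark HS.
Qed.

Section bounded_marks.
Variables (g : \bar R -> R) (c a b : R) (j : bool) (w : vague_measure R S).
Hypotheses (mg : measurable_fun setT (g \o mk)) (gc : forall y, 0 <= g y <= c).
Hypotheses (ab : a < b) (Vw : V w).

Local Notation f := (test_integrand tm lb mk j g a b).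

Let f0 u : 0 <= f u.
Proof.
rewrite /test_integrand !mulr_ge0//; first by have /andP[] := cutoff01 a b (tm u).
by have /andP[] := gc (mk u).
Qed.

Let mf D : measurable_fun D (EFin \o f).
Proof.
by apply: measurable_funTS; apply/measurable_EFinP; exact: measurable_test_integrand.
Qed.

Lemma integral_test_before :
  (\int[N w]_(u in S) (f u)%:E = \int[N w]_(u in before b j) (f u)%:E)%E.
Proof.
have bS : before b j `<=` S by move=> u [].
have mS := measurable_space HS.
rewrite -[in LHS](setDUK bS) ge0_integral_setU//; last 3 first.
- exact: measurableD.
- by move=> u _; rewrite lee_fin.
- by apply/disj_setPS => u [Su [_ []]].
rewrite [X in (_ + X)%E]integral0_eq ?adde0// => u [Su nb]; congr EFin.
rewrite /test_integrand; case: eqP => [lj|]; last by rewrite mulr0 mul0r.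
rewrite cutoff0 ?mul0r// leNgt; apply/negP => ub; exact: nb.
Qed.

Lemma test_integralE :
  ((test j g a b w)%:E = \int[N w]_(u in S) (f u)%:E)%E.
Proof.
rewrite /test_integral /Rintegral fineK// ge0_fin_numE; last first.
  by apply: integral_ge0 => u _; rewrite lee_fin.
rewrite integral_test_before.
apply: (@le_lt_trans _ _ (\int[N w]_(u in before b j) (cst c%:E u))%E).
  apply: ge0_le_integral => //.
  - by move=> u _; rewrite lee_fin.
  move=> u _; rewrite lee_fin /test_integrand.
  have /andP[h0 h1] := gc (mk u); have /andP[k0 k1] := cutoff01 a b (tm u).
  rewrite (le_trans _ h1)// ler_piMl//; case: eqP; rewrite ?mulr1 ?mulr0//.
rewrite integral_cst// lte_mul_pinfty ?lee_fin//.
  by have /andP[/le_trans] := gc 0%E; exact.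
exact: (points_before_fin HS).
Qed.

(** Between two times that see the same points, the cutoff is invisible. *)
Lemma test_integral_stable (k : nat) :
  N w (before a j) = k%:R%:E -> N w (before b j) = k%:R%:E ->
  ((test j g a b w)%:E = \int[N w]_(u in before a j) (g (mk u))%:E)%E.
Proof.
move=> Nak Nbk; rewrite test_integralE integral_test_before.
have ab' : before a j `<=` before b j by apply: points_before_le; exact: ltW.
have N0 : N w (before b j `\` before a j) = 0.
  have : (N w (before b j) - N w (before b j `&` before a j) = 0)%E.
    by rewrite (setIidr ab') Nak Nbk -EFinB subrr.
  by rewrite measureD//; exact: (points_before_fin HS).
rewrite (ge0_negligible_integral _ _ _ _ N0)//; last 2 first.
- exact: measurableD.
- by move=> u _; rewrite lee_fin.
rewrite setDD (setIidr ab'); apply: eq_integral => u; rewrite inE => -[_ ua lj].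
by rewrite /test_integrand cutoff1// ?ltW// lj eqxx !mul1r.
Qed.

End bounded_marks.

Let g1 : \bar R -> R := cst 1.

(** Counts are not continuous in the vague topology; test integrals with the
    constant function 1 are, and they separate two counts. *)
Lemma test_count_bounds j a b w : a < b -> V w ->
  (N w (upto a j) <= (test j g1 a b w)%:E <= N w (before b j))%E.
Proof.
move=> ab Vw.
have mg : measurable_fun setT (g1 \o mk) by exact: measurable_cst.
have g01 y : 0 <= g1 y <= 1 by rewrite ler01 lexx.
have mS := measurable_space HS.
have indE (A : set T) : measurable A -> A `<=` S ->
    N w A = (\int[N w]_(u in S) (\1_A u)%:E)%E.
  by move=> mA AS; rewrite integral_indic// (setIidl AS).
rewrite (test_integralE j mg g01 ab Vw) !indE//; try by move=> ? [].
have mt D : measurable_fun D (EFin \o test_integrand tm lb mk j g1 a b).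
  by apply: measurable_funTS; apply/measurable_EFinP; exact: measurable_test_integrand.
have mi (A D : set T) : measurable A -> measurable_fun D (fun u => (\1_A u)%:E : \bar R).
  by move=> mA; apply/measurable_EFinP; exact: measurable_indic.
apply/andP; split; apply: ge0_le_integral => //; try exact: mi.
- move=> u Su; rewrite lee_fin indicE /test_integrand mulr1.
  have [[_ ua lj]|nu] := pselect (upto a j u).
    by rewrite mem_set ?lj ?eqxx ?mulr1 ?cutoff1//; split.
  by rewrite memNset// mulr_ge0//; have /andP[] := cutoff01 a b (tm u).
- by move=> u _; rewrite lee_fin /test_integrand mulr1 mulr_ge0//;
    have /andP[] := cutoff01 a b (tm u).
move=> u Su; rewrite lee_fin indicE /test_integrand mulr1.
have /andP[c0 c1] := cutoff01 a b (tm u).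
have [[_ ua lj]|nu] := pselect (before b j u).
  by rewrite mem_set ?lj ?eqxx ?mulr1//; split.
rewrite memNset//; case: eqP => lj; last by rewrite mulr0.
rewrite cutoff0 ?mul0r// leNgt; apply/negP => ub; exact: nu.
Qed.

Lemma continuous_test_count j a b : a < b -> {within V, continuous (test j g1 a b)}.
Proof. by move=> ab; apply: (continuous_test_integral HS) => // y; exact: cvg_cst. Qed.

(** Continuity of the measure along increasing unions: a strict lower bound on
    the count before [q] already holds at an earlier time. *)
Lemma points_before_approx j q w (c : \bar R) : V w -> (c < N w (before q j))%E ->
  exists2 r, r < q & (c < N w (upto r j))%E.
Proof.
move=> Vw cN; pose r (n : nat) := q - n.+1%:R^-1.
have rq n : r n < q by rewrite gtrBl invr_gt0.
have E : before q j = \bigcup_n upto (r n) j.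
  apply/seteqP; split=> u /=; last first.
    by move=> [n _ [Su un lj]]; split=> //; exact: le_lt_trans (rq n).
  move=> [Su uq lj]; have qu : 0 < q - tm u by rewrite subr_gt0.
  exists (Num.truncn (q - tm u)^-1) => //; split=> //.
  rewrite /r lerBrDl -lerBrDr.
  by rewrite invf_ple ?posrE// ltW// truncnS_gt.
have ndr : {homo (fun n => upto (r n) j) : m n / (m <= n)%N >-> (m <= n)%O}.
  move=> m n mn; apply/subsetPset => u [Su um lj]; split=> //.
  by rewrite (le_trans um)// lerB// lef_pV2 ?posrE// ler_nat.
have : N w (upto (r n) j) @[n --> \oo] --> N w (before q j).
  rewrite E; apply: nondecreasing_cvg_mu => //; first by rewrite -E.
by move=> /cvge_near_gt/(_ cN)[n _ /(_ n (leqnn n)) nc]; exists (r n).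
Qed.

(** The count before [q] is the supremum of the test integrals with rational
    cutoffs that vanish after [q]. *)
Lemma cozero_count_gt j q (c : R) : cozero R V [set w | (c%:E < N w (before q j))%E].
Proof.
pose O (i : rat * rat) : set (vague_measure R S) :=
  [set w | (ratr i.1 < ratr i.2 :> R /\ ratr i.2 <= q) /\
           0 < test j g1 (ratr i.1) (ratr i.2) w - c].
apply: (@cozero_eq _ _ _ [set w | exists i, O i w]) => [w Vw|].
  split=> [[[x y] [/=[xy yq]]]|].
    rewrite subr_gt0 => cI; have /andP[_] := test_count_bounds j xy Vw.
    rewrite /= => Iy; apply: (@lt_le_trans _ _ (N w (before (ratr y) j))).
      by apply: lt_le_trans Iy; rewrite lte_fin.
    by apply: le_measure; rewrite ?inE//; exact: points_before_le.
  move=> /(points_before_approx Vw)[r rq cr].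
  have [y] := rat_in_itvoo rq; rewrite in_itv/= => /andP[ry yq].
  have [x] := rat_in_itvoo ry; rewrite in_itv/= => /andP[rx xy].
  exists (x, y); split=> /=; first by split=> //; exact: ltW.
  have /andP[Ix _] := test_count_bounds j xy Vw.
  rewrite subr_gt0 -lte_fin (lt_le_trans _ Ix)// (lt_le_trans cr)//.
  apply: le_measure; rewrite ?inE// => u [Su ur lj]; split=> //.
  exact: le_trans (ltW rx).
apply: cozero_bigcup => -[x y]; apply: cozero_and => /= -[xy _].
apply: cozero_gt0; apply: withinB; first exact: continuous_test_count.
exact: within_cst.
Qed.

End cozero_counts.

(** * The stopped sum event *)

Section stopped_sum.
Context {R : realType} dT (T : topMeasurableType dT) (S : set T).
Variables (tm : T -> R) (lb : T -> bool) (mk : T -> \bar R).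

Local Notation V := (point_measures R S).
Local Notation before := (points_before S tm lb).
Local Notation upto := (points_upto S tm lb).
Local Notation N w := (w : measure T R).
Local Notation test := (test_integral tm lb mk).
Implicit Types (w : vague_measure R S) (q s : R) (j : bool) (k : nat).

(** The first point labelled [false] occurs in the time interval [q, s[, which
    contains no point labelled [true]; hence the [k] points labelled [true]
    that precede it are exactly those before [q], and the sum of their marks
    lies in [O]. *)
Definition stopped_sum_at k (O : set (\bar R)) q s : set (vague_measure R S) :=
  [set w | [/\ N w (before q false) = 0, (0 < N w (before s false))%E,
    N w (before q true) = k%:R%:E, N w (before s true) = k%:R%:E &
    O (\int[N w]_(u in before q true) mk u)%E]].

Definition stopped_sum_event (O : set (\bar R)) : set (vague_measure R S) :=
  [set w | exists q s k, q < s /\ stopped_sum_at k O q s w].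

Hypothesis HS : marked_space S tm lb mk.

Let mbefore q j := measurable_points_before HS q j.
Let mupto q j := measurable_points_upto HS q j.

(** An open set of reals is a countable union of rational intervals. *)
Lemma cozero_open (W : topologicalType) (U : set W) (J : W -> R) (O : set R) :
  {within U, continuous J} -> open O -> cozero R U [set w | O (J w)].
Proof.
move=> cJ oO.
pose G (i : rat * rat) : set W := [set w |
  `]ratr i.1, ratr i.2[ `<=` O /\
  0 < Order.min (J w - ratr i.1) (ratr i.2 - J w)].
apply: (@cozero_eq _ _ _ [set w | exists i, G i w]) => [w Uw|].
  split=> [[[x y] [/= xyO]]|/= OJ].
    by rewrite lt_min !subr_gt0 => Jxy; apply: xyO; rewrite /= in_itv.
  have /nbhs_ballP[e /= e0 eO] : nbhs (J w) O by apply: open_nbhs_nbhs.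
  have [x] : exists i : rat, ratr i \in `]J w - e, J w[
    by apply: rat_in_itvoo; rewrite ltrBlDr ltrDl.
  rewrite in_itv/= => /andP[ex xJ].
  have [y] : exists i : rat, ratr i \in `]J w, J w + e[
    by apply: rat_in_itvoo; rewrite ltrDl.
  rewrite in_itv/= => /andP[Jy ye].
  exists (x, y); split => /=; last by rewrite lt_min !subr_gt0 xJ.
  move=> t /=; rewrite in_itv/= => /andP[xt ty]; apply: eO.
  by rewrite /ball/= ltr_distlC; apply/andP; split; lra.
apply: cozero_bigcup => -[x y]; apply: cozero_and => /= _.
apply: cozero_gt0; apply: within_min; apply: withinB => //; exact: within_cst.
Qed.

(** The real numbers [v] such that a capped sum equal to [v] forces the sum
    itself to be in [O]: below the cap nothing has been truncated. *)
Definition safe_below_cap (c : R) (O : set (\bar R)) : set R :=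
  [set v | (v < c /\ O v%:E) \/
           exists2 r : R, r < v & [set y | (r%:E < y)%E] `<=` O].

Lemma open_safe_below_cap c O : open O -> open (safe_below_cap c O).
Proof.
move=> oO; rewrite (_ : safe_below_cap c O =
   ([set v | v < c] `&` EFin @^-1` O) `|`
   \bigcup_(r in [set r : R | [set y | (r%:E < y)%E] `<=` O]) [set v | r < v]).
  apply: openU; last by apply: bigcup_open => r _; exact: open_gt.
  apply: openI; first exact: open_lt.
  by apply: open_comp => // r _ A; exact.
by apply/seteqP; split=> v [[? ?]|[r]]; [left|right; exists r|left|right; exists r].
Qed.

Section capped_sums.
Variables (w : vague_measure R S) (k : nat) (q : R).
Hypotheses (Vw : V w) (Nk : N w (before q true) = k%:R%:E).

Local Notation A := (before q true).
Local Notation Jc c := (\int[N w]_(u in A) (capped c (mk u))%:E)%E.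

Let mk0 u : A u -> (0 <= mk u)%E.
Proof. by move=> [Su _ _]; exact: (mark_ge0 HS). Qed.

Let mmk D : measurable_fun D mk.
Proof. by apply: measurable_funTS; exact: (measurable_mark HS). Qed.

Let mcap c D : measurable_fun D (fun u => (capped c (mk u))%:E).
Proof.
apply: measurable_funTS; apply/measurable_EFinP; exact: (measurable_capped_mark HS).
Qed.

Let capE c u : 0 <= c -> A u -> (capped c (mk u))%:E = Order.min (mk u) c%:E.
Proof. by move=> c0 Au; rewrite cappedE// mk0. Qed.

Lemma capped_sum_le c : 0 <= c -> (Jc c <= \int[N w]_(u in A) mk u)%E.
Proof.
move=> c0; apply: ge0_le_integral => //; try by move=> u _ /=; rewrite lee_fin ?capped_ge0.
by move=> u Au; rewrite capE// ge_min lexx.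
Qed.

(** Counts are integers: less than one point of mark at least [c] means none. *)
Lemma capped_sum_eq c : 0 <= c -> (Jc c < c%:E)%E -> Jc c = (\int[N w]_(u in A) mk u)%E.
Proof.
move=> c0 Jlt; pose B : set T := A `&` [set u | (c%:E <= mk u)%E].
have c_gt0 : 0 < c.
  rewrite -lte_fin (le_lt_trans _ Jlt)//; apply: integral_ge0 => u _.
  by rewrite lee_fin capped_ge0.
have mB : measurable B.
  apply: measurableI => //; rewrite -[X in measurable X]setTI.
  exact: emeasurable_fun_c_infty.
have BA : B `<=` A by move=> u [].
have cB : (c%:E * N w B <= Jc c)%E.
  rewrite -integral_cst//; apply: (@le_trans _ _ (\int[N w]_(u in B) (capped c (mk u))%:E)%E).
    apply: ge0_le_integral => //; try by move=> u _ /=; rewrite lee_fin ?capped_ge0.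
    by move=> u [Au cu]; rewrite capE// le_min cu lexx.
  by apply: ge0_subset_integral => // u _; rewrite lee_fin capped_ge0.
have NB0 : N w B = 0.
  have [NB|[n NB]] := point_measure_natural Vw mB.
    by move: cB; rewrite NB gt0_muley ?lte_fin// leye_eq => /eqP JE; rewrite JE in Jlt.
  have := le_lt_trans cB Jlt; rewrite NB -EFinM lte_fin gtr_pMr//.
  by rewrite ltrn1 ltnS leqn0 => /eqP ->.
have e0 (f : T -> \bar R) : measurable_fun A f -> (forall u, A u -> 0 <= f u)%E ->
    (\int[N w]_(u in A) f u = \int[N w]_(u in A `\` B) f u)%E.
  by move=> mf f0; exact: ge0_negligible_integral.
rewrite e0//; last by move=> u _; rewrite lee_fin capped_ge0.
rewrite [RHS]e0//; apply: eq_integral => u; rewrite inE => -[Au nB].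
rewrite capE//; apply/min_idPl; rewrite leNgt; apply/negP => cu.
by apply: nB; split=> //; exact: ltW.
Qed.

Lemma capped_sum_cvg : Jc n%:R @[n --> \oo] --> (\int[N w]_(u in A) mk u)%E.
Proof.
have -> : (\int[N w]_(u in A) mk u =
    \int[N w]_(u in A) (limn (fun n => (capped n%:R (mk u))%:E)))%E.
  apply: eq_integral => u; rewrite inE => Au; apply/esym/cvg_lim => //.
  under eq_fun do rewrite capE//.
  have := mk0 Au; case: (mk u) => [r r0||//].
    apply: cvg_near_cst; near=> n; apply/min_idPl; rewrite lee_fin.
    by near: n; exact: nbhs_infty_ger.
  move=> _; under eq_fun do rewrite min_r ?leey//.
  by apply/cvgenyP; exact: cvg_id.
apply: cvg_monotone_convergence => //.
- by move=> n u _; rewrite lee_fin capped_ge0.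
- move=> u Au m n mn; rewrite !capE// le_min ge_min lexx/= ge_min lee_fin ler_nat.
  by rewrite mn orbT.
Unshelve. all: by end_near.
Qed.

(** A finite sum is reached by the capped sums as soon as the cap exceeds it,
    and an infinite one is approached by them from below. *)
Lemma safe_below_capP (O : set (\bar R)) : open O ->
  O (\int[N w]_(u in A) mk u)%E <->
  exists c : nat, safe_below_cap c%:R O (fine (Jc c%:R)).
Proof.
have fJ (c : nat) : Jc c%:R \is a fin_num.
  rewrite ge0_fin_numE; last by apply: integral_ge0 => u _; rewrite lee_fin capped_ge0.
  apply: (@le_lt_trans _ _ (\int[N w]_(u in A) (cst c%:R%:E u))%E).
    apply: ge0_le_integral => //; try by move=> u _ /=; rewrite lee_fin ?capped_ge0.
    by move=> u _; rewrite lee_fin capped_le.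
  by rewrite integral_cst// Nk -EFinM ltry.
move=> oO; split=> [|[c [[Jc_ OJ]|[r rJ rO]]]]; last first.
- apply: rO => /=; rewrite (lt_le_trans _ (capped_sum_le (ler0n _ c)))//.
  by rewrite -[Jc _]fineK// lte_fin.
- by rewrite -(capped_sum_eq (ler0n _ c)) -[Jc _]fineK// lte_fin.
have psi0 : (0 <= \int[N w]_(u in A) mk u)%E by exact: integral_ge0.
case E : (\int[N w]_(u in A) mk u)%E psi0 => [r||]//; rewrite ?lee_fin => r0 Or.
  exists (Num.truncn r).+1; left.
  have rc : r < (Num.truncn r).+1%:R by rewrite truncnS_gt.
  have JE : Jc (Num.truncn r).+1%:R = r%:E.
    by rewrite capped_sum_eq// (le_lt_trans (capped_sum_le _))// E lte_fin.
  by rewrite JE.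
have [M [_ MO]] : nbhs +oo%E O by apply: open_nbhs_nbhs.
have := capped_sum_cvg; rewrite E => /cvgeyPgt/(_ M)[n _ /(_ n (leqnn n)) Mn].
by exists n; right; exists M; rewrite // -lte_fin fineK.
Qed.

End capped_sums.

(** The counts in [stopped_sum_at] are integers, so strict inequalities between
    test integrals at distance less than one force their values.  Once the
    counts at two rational times agree, the capped sum is itself a test
    integral, because the cutoff between these times sees no point. *)
Lemma cozero_stopped_sum (O : set (\bar R)) : open O ->
  cozero R V (stopped_sum_event O).
Proof.
move=> oO.
pose g1 : \bar R -> R := cst 1.
pose G (i : (rat * rat * rat) * (rat * rat * rat) * (nat * nat)) :
    set (vague_measure R S) :=
  let: ((r, q, q1), (s0, s, s1), (k, c)) := i in
  [set w | [/\ ratr r < ratr q :> R, ratr q < ratr q1 :> R,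
     ratr s0 < ratr s :> R, ratr s < ratr s1 :> R & ratr q < ratr s :> R] /\
   ([set w | 0 < test true g1 (ratr r) (ratr q) w - (k%:R - 1)] `&`
    [set w | 0 < 1 - test false g1 (ratr q) (ratr q1) w] `&`
    [set w | 0 < test false g1 (ratr s0) (ratr s) w] `&`
    [set w | 0 < (k%:R + 1) - test true g1 (ratr s) (ratr s1) w] `&`
    [set w | safe_below_cap c%:R O (test true (capped c%:R) (ratr q) (ratr s) w)])
   w].
have nat_eq0 w B : V w -> measurable B -> (N w B < 1)%E -> N w B = 0.
  move=> Vw mB; have [->//|[n ->]] := point_measure_natural Vw mB.
  by rewrite lte_fin ltrn1 ltnS leqn0 => /eqP ->.
have nat_ge w B k : V w -> measurable B -> ((k%:R - 1)%:E < N w B)%E -> (k%:R%:E <= N w B)%E.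
  move=> Vw mB; have [->|[n ->]] := point_measure_natural Vw mB; first by rewrite leey.
  by rewrite lte_fin lee_fin ltrBlDr natr1 ltr_nat ler_nat ltnS.
have nat_le w B k : V w -> measurable B -> (N w B < (k%:R + 1)%:E)%E -> (N w B <= k%:R%:E)%E.
  move=> Vw mB; have [->//|[n ->]] := point_measure_natural Vw mB.
  by rewrite lte_fin lee_fin natr1 ltr_nat ler_nat ltnS.
have lecount w B C : measurable B -> measurable C -> B `<=` C -> (N w B <= N w C)%E.
  by move=> mB mC BC; apply: le_measure; rewrite ?inE.
have stable k c q s w : V w -> q < s -> N w (before q true) = k%:R%:E ->
    N w (before s true) = k%:R%:E ->
    test true (capped c%:R) q s w =
      fine (\int[N w]_(u in before q true) (capped c%:R (mk u))%:E)%E.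
  move=> Vw qs Nq Ns.
  have mg := measurable_capped_mark HS (c%:R : R).
  have gc y : 0 <= capped (c%:R : R) y <= c%:R by rewrite capped_ge0//= capped_le.
  by rewrite -(test_integral_stable HS mg gc qs Vw Nq Ns).
apply: (@cozero_eq _ _ _ [set w | exists i, G i w]) => [w Vw|].
  split.
    move=> [[[[[r q] q1] [[s0 s] s1]] [k c]]] [] [rq qq1 ss0 ss1 qs] /=.
    rewrite !subr_gt0 => -[[[[C1 C2] C3] C4] C5].
    have /andP[_ B1] := test_count_bounds HS true rq Vw.
    have /andP[B2 _] := test_count_bounds HS false qq1 Vw.
    have /andP[_ B3] := test_count_bounds HS false ss0 Vw.
    have /andP[B4 _] := test_count_bounds HS true ss1 Vw.
    have k1 : (k%:R%:E <= N w (before (ratr q) true))%E.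
      by apply: nat_ge => //; apply: lt_le_trans B1; rewrite lte_fin.
    have k2 : (N w (before (ratr s) true) <= k%:R%:E)%E.
      apply: (@le_trans _ _ (N w (upto (ratr s) true))).
        by apply: lecount => //; exact: points_before_upto.
      by apply: nat_le => //; apply: le_lt_trans B4 _; rewrite lte_fin.
    have k3 : (N w (before (ratr q) true) <= N w (before (ratr s) true))%E.
      by apply: lecount => //; apply: points_before_le; exact: ltW.
    have Nq : N w (before (ratr q) true) = k%:R%:E.
      by apply/eqP; rewrite eq_le k1 (le_trans k3 k2).
    have Ns : N w (before (ratr s) true) = k%:R%:E.
      by apply/eqP; rewrite eq_le k2 (le_trans k1 k3).
    exists (ratr q), (ratr s), k; split=> //; split=> //.
    - apply: nat_eq0 => //; apply: (@le_lt_trans _ _ (N w (upto (ratr q) false))).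
        by apply: lecount => //; exact: points_before_upto.
      by apply: le_lt_trans B2 _; rewrite lte_fin.
    - by apply: lt_le_trans B3; rewrite lte_fin.
    - apply/(safe_below_capP Vw Nq oO); exists c.
      by rewrite -(stable _ _ _ _ _ Vw qs Nq Ns).
  move=> [q [s [k [qs [N0 Ns0 Nq Ns Opsi]]]]].
  (* Three rational times below [q], after which no point labelled [true]
     occurs before [q], and three others between [q] and [s]. *)
  have [r0 r0q kr0] : exists2 r, r < q & ((k%:R - 1)%:E < N w (upto r true))%E.
    by apply: (points_before_approx HS Vw); rewrite Nq lte_fin gtrBl.
  have [s00 s00s Ns00] := points_before_approx HS Vw Ns0.
  have [x] := rat_in_itvoo r0q; rewrite in_itv/= => /andP[r0x xq].
  have [y] := rat_in_itvoo xq; rewrite in_itv/= => /andP[xy yq].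
  have [y1] := rat_in_itvoo yq; rewrite in_itv/= => /andP[yy1 y1q].
  have ms : Order.max s00 q < s by rewrite gt_max s00s.
  have [z0] := rat_in_itvoo ms; rewrite in_itv/= gt_max => /andP[/andP[s00z0 qz0] z0s].
  have [z] := rat_in_itvoo z0s; rewrite in_itv/= => /andP[z0z zs].
  have [z1] := rat_in_itvoo zs; rewrite in_itv/= => /andP[zz1 z1s].
  have yz : ratr y < ratr z :> R by rewrite (lt_trans yq)// (lt_trans qz0).
  have /andP[B1 _] := test_count_bounds HS true xy Vw.
  have /andP[_ B2] := test_count_bounds HS false yy1 Vw.
  have /andP[B3 _] := test_count_bounds HS false z0z Vw.
  have /andP[_ B4] := test_count_bounds HS true zz1 Vw.
  have Bx : ((k%:R - 1)%:E < N w (upto (ratr x) true))%E.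
    apply: lt_le_trans kr0 _; apply: lecount => // u [Su ur lj]; split=> //.
    exact: le_trans (ltW r0x).
  have k1 : (k%:R%:E <= N w (before (ratr y) true))%E.
    apply: nat_ge => //; apply: lt_le_trans Bx _.
    by apply: lecount => //; exact: points_upto_before.
  have Ny : N w (before (ratr y) true) = k%:R%:E.
    apply/eqP; rewrite eq_le k1 andbT -Nq.
    by apply: lecount => //; apply: points_before_le; exact: ltW.
  have Nz : N w (before (ratr z) true) = k%:R%:E.
    apply/eqP; rewrite eq_le; apply/andP; split.
      by rewrite -Ns; apply: lecount => //; apply: points_before_le; exact: ltW.
    by rewrite -Ny; apply: lecount => //; apply: points_before_le; exact: ltW.
  have psiE : (\int[N w]_(u in before q true) mk u =
      \int[N w]_(u in before (ratr y) true) mk u)%E.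
    have yq' : before (ratr y) true `<=` before q true by apply: points_before_le; exact: ltW.
    rewrite (@ge0_negligible_integral _ _ _ _ (before q true)
       (before q true `\` before (ratr y) true))//.
    - by rewrite setDD (setIidr yq').
    - exact: measurableD.
    - by apply: measurable_funTS; exact: (measurable_mark HS).
    - by move=> u [Su _ _]; exact: (mark_ge0 HS).
    have : (N w (before q true) - N w (before q true `&` before (ratr y) true) = 0)%E.
      by rewrite (setIidr yq') Nq Ny -EFinB subrr.
    by move=> <-; rewrite measureD//; exact: (points_before_fin HS).
  have [c Sc] : exists c : nat, safe_below_cap c%:R O
      (fine (\int[N w]_(u in before (ratr y) true) (capped c%:R (mk u))%:E)%E).
    by apply/(safe_below_capP Vw Ny oO); rewrite -psiE.
  exists (((x, y, y1), (z0, z, z1)), (k, c)); split; first by split.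
  split; last by rewrite /= (stable _ _ _ _ _ Vw yz Ny Nz).
  split; first split; first split.
  - by rewrite /= subr_gt0 -lte_fin (lt_le_trans Bx).
  - rewrite /= subr_gt0 -lte_fin (le_lt_trans B2)//.
    rewrite (@le_lt_trans _ _ (N w (before q false)))//; last by rewrite N0 lte_fin.
    by apply: lecount => //; apply: points_before_le; exact: ltW.
  - rewrite /= -lte_fin (lt_le_trans _ B3)// (lt_le_trans Ns00)//.
    apply: lecount => // u [Su ur lj]; split=> //; exact: le_trans (ltW s00z0).
  - rewrite /= subr_gt0 -lte_fin (le_lt_trans B4)//.
    rewrite (@le_lt_trans _ _ (N w (before s true)))//.
      by apply: lecount => //; apply: points_before_le; exact: ltW.
    by rewrite Ns lte_fin ltrDl.
apply: cozero_bigcup => -[[[[r q] q1] [[s0 s] s1]] [k c]].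
apply: cozero_and => -[rq qq1 s0s ss1 qs].
have ct := continuous_test_count HS.
apply: cozeroI; last first.
  apply: cozero_open; last exact: open_safe_below_cap.
  by apply: (continuous_test_integral HS) => //; exact: continuous_capped.
apply: cozeroI; last first.
  by apply: cozero_gt0; apply: withinB; [exact: within_cst|exact: ct].
apply: cozeroI; last by apply: cozero_gt0; exact: ct.
apply: cozeroI; apply: cozero_gt0; apply: withinB;
  by [exact: within_cst|exact: ct].
Qed.

End stopped_sum.

(** * Words and the negative binomial series *)

Section words.
Variable Q : finType.
Implicit Types (s : seq Q) (q : Q).

Lemma prod_fact_count_rem s q : q \in s ->
  (\prod_r (count_mem r s)`! =
   count_mem q s * \prod_r (count_mem r (rem q s))`!)%N.
Proof.
move=> qs; rewrite (bigD1 q)//= [in RHS](bigD1 q)//= count_mem_rem eqxx subn1.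
rewrite mulnA; congr (_ * _)%N.
  by have := qs; rewrite -has_pred1 has_count; case: (count_mem q s).
by apply: eq_bigr => r rq; rewrite count_mem_rem eq_sym (negbTE rq) subn0.
Qed.

Lemma sum_count_mem s : (\sum_(q <- undup s) count_mem q s = size s)%N.
Proof.
rewrite -[RHS]sum1_size.
transitivity (\sum_(q <- undup s) iterop (count_mem q s) addn 1 0)%N; last first.
  exact: (big_undup_iterop_count addn s predT (fun=> 1%N)).
by apply: eq_bigr => q _; rewrite Monoid.iteropE iter_addn_0 mul1n.
Qed.

(** Removing the first letter [q] leaves an arrangement of the word with one [q]
    less: this is the recursion of the multinomial coefficients. *)
Lemma size_permutations_count s :
  (size (permutations s) * \prod_q (count_mem q s)`! = (size s)`!)%N.
Proof.
have [n] := ubnP (size s); elim: n s => // n IH s sn.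
have [->|s0] := eqVneq s [::]; first by rewrite big1.
have sz : (0 < size s)%N by rewrite lt0n size_eq0.
rewrite (perm_size (permutationsE sz)) size_allpairs_dep sumnE big_map.
rewrite big_distrl/= -(prednK sz) factS (prednK sz) -[X in _ = (X * _)%N]sum_count_mem.
rewrite big_distrl/= big_seq [RHS]big_seq; apply: eq_bigr => q; rewrite mem_undup => qs.
rewrite (prod_fact_count_rem qs) mulnCA; congr (_ * _)%N.
by have := IH (rem q s); rewrite size_rem//; apply; rewrite (prednK sz).
Qed.

End words.

Section negative_binomial.
Context {R : realType}.

Lemma ffact_le_expn (n k : nat) : (n ^_ k <= n ^ k)%N.
Proof. by elim: k => // k IH; rewrite ffactnSr expnSr leq_mul// leq_subr. Qed.

(** Exponential decay beats polynomial growth. *)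
Lemma cvg_bin_expr (z : R) k : 0 < z < 1 ->
  'C(n, k)%:R * z ^+ n @[n --> \oo] --> 0.
Proof.
move=> /andP[z0 z1]; pose d := - ln z; have d0 : 0 < d.
  by rewrite oppr_gt0 ln_lt0// z0.
pose c := k.+1`!%:R / d ^+ k.+1; have c0 : 0 < c.
  by rewrite divr_gt0 ?exprn_gt0// ltr0n fact_gt0.
apply: (@squeeze_cvgr _ _ _ _ (cst 0) (fun n => c * n%:R^-1)).
- near=> n; have n0 : (0 < n)%N by near: n; exact: nbhs_infty_gt.
  have n0R : 0 < n%:R :> R by rewrite ltr0n.
  apply/andP; split; first by rewrite mulr_ge0// exprn_ge0// ltW.
  apply: (@le_trans _ _ (n%:R ^+ k * z ^+ n)).
    rewrite ler_wpM2r ?exprn_ge0 ?(ltW z0)// -natrX ler_nat.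
    rewrite (leq_trans (leq_pmulr _ (fact_gt0 k)))// bin_ffact.
    exact: ffact_le_expn.
  have zE : z ^+ n = (expR (d * n%:R))^-1.
    by rewrite -expRN -[in LHS](@lnK _ z) ?posrE// -expRM_natr /d mulNr opprK.
  rewrite zE ler_pdivrMr ?expR_gt0//.
  have := @expR_ge1Dxn R (d * n%:R) k (mulr_ge0 (ltW d0) (ler0n _ _)).
  move=> /(le_trans _)-/(_ ((d * n%:R) ^+ k.+1 / k.+1`!%:R)).
  rewrite lerDr ler01 => /(_ isT) h.
  apply: le_trans (ler_wpM2l _ h); last by rewrite mulr_ge0 ?invr_ge0// ltW.
  rewrite le_eqVlt; apply/orP; left; apply/eqP; rewrite /c exprMn !exprS.
  have fk : k.+1`!%:R != 0 :> R by rewrite pnatr_eq0 -lt0n fact_gt0.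
  by field; rewrite fk !gt_eqF ?exprn_gt0.
- exact: cvg_cst.
- rewrite -(mulr0 c); apply: cvgM; first exact: cvg_cst.
  by rewrite -(cvg_shiftS (fun n : nat => (n%:R : R)^-1)); exact: cvg_harmonic.
Unshelve. all: by end_near.
Qed.

(** Pascal's rule gives a recursion on [k] for the partial sums, with a boundary
    term that vanishes in the limit. *)
Lemma cvg_sum_bin_expr (z : R) k : 0 < z < 1 ->
  \sum_(j < n) 'C(j, k)%:R * z ^+ j @[n --> \oo] --> z ^+ k / (1 - z) ^+ k.+1.
Proof.
move=> z01; have /andP[z0 z1] := z01; have z1' : 1 - z != 0 by rewrite subr_eq0 gt_eqF.
elim: k => [|k IH].
  have := @cvg_geometric_series R 1 z.
  rewrite ger0_norm ?(ltW z0)// => /(_ z1).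
  rewrite expr0 expr1; apply: cvg_trans; apply: near_eq_cvg; near=> n.
  rewrite /series /= big_mkord; apply: eq_bigr => j _.
  by rewrite bin0 /geometric.
have E n : \sum_(j < n.+1) 'C(j, k.+1)%:R * z ^+ j =
  (z * (\sum_(j < n) 'C(j, k)%:R * z ^+ j) - z * ('C(n, k.+1)%:R * z ^+ n)) / (1 - z).
  apply/(canRL (mulfK z1')); elim: n => [|n IHn].
    by rewrite big_ord1 !big_ord0 /= !bin_small// !(mul0r, mulr0) subr0.
  rewrite big_ord_recr/= mulrDl IHn [in RHS]big_ord_recr/= binS natrD exprS.
  ring.
rewrite -(cvg_shiftS (fun n => \sum_(j < n) 'C(j, k.+1)%:R * z ^+ j)).
under eq_fun do rewrite E.
have -> : z ^+ k.+1 / (1 - z) ^+ k.+2 =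
    (z * (z ^+ k / (1 - z) ^+ k.+1) - z * 0) / (1 - z).
  rewrite mulr0 subr0 exprS [in LHS]exprS invfM; ring.
apply: cvgM; last exact: cvg_cst.
apply: cvgB; first by apply: cvgM; [exact: cvg_cst|exact: IH].
by apply: cvgM; [exact: cvg_cst|exact: cvg_bin_expr].
Unshelve. all: by end_near.
Qed.

(** [grid_weight d j] is the probability that the first point labelled [false]
    falls in the [j]-th cell of a grid of step [d], that this cell contains no
    point labelled [true], and that [k] points labelled [true] precede it. *)
Definition grid_weight (p d : R) k (j : nat) : R :=
  expR (- ((1 - p) * (j%:R * d))) * (1 - expR (- ((1 - p) * d))) *
  expR (- (p * d)) *
  (expR (- (p * (j%:R * d))) * (p * (j%:R * d)) ^+ k / k`!%:R).

(** Bounding [j ^ k] from below by a falling factorial turns the sum into a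
    negative binomial series with ratio [expR (- d)], and [1 - expR (- d)] is at
    most [d]. *)
Lemma grid_weight_bound (p d : R) k : 0 < p < 1 -> 0 < d ->
  forall x, x < p ^+ k * (1 - p) * expR (- d) ^+ k.+1 ->
  \forall J \near \oo, x < \sum_(j < J) grid_weight p d k j.
Proof.
move=> /andP[p0 p1] d0 x xlt; set z := expR (- d) in xlt *.
have z01 : 0 < z < 1 by rewrite expR_gt0 /= expR_lt1 oppr_lt0.
have [z0 z1] := andP z01.
pose a := (1 - expR (- ((1 - p) * d))) * expR (- (p * d)) * (p * d) ^+ k.
have a0 : 0 <= a.
  rewrite !mulr_ge0 ?expR_ge0 ?exprn_ge0 ?mulr_ge0 ?(ltW p0) ?(ltW d0)//.
  by rewrite subr_ge0 ltW// expR_lt1 oppr_lt0 mulr_gt0// subr_gt0.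
have le_term j : a * ('C(j, k)%:R * z ^+ j) <= grid_weight p d k j.
  have -> : grid_weight p d k j = a * (j%:R ^+ k / k`!%:R * z ^+ j).
    have -> : z ^+ j = expR (- ((1 - p) * (j%:R * d))) * expR (- (p * (j%:R * d))).
      by rewrite -expRD -expRM_natr; congr expR; ring.
    by rewrite /grid_weight /a !exprMn; ring.
  rewrite ler_wpM2l// ler_wpM2r ?exprn_ge0 ?(ltW z0)//.
  rewrite ler_pdivlMr ?ltr0n ?fact_gt0// -natrM -natrX ler_nat bin_ffact.
  exact: ffact_le_expn.
have lim_ge : p ^+ k * (1 - p) * z ^+ k.+1 <= a * (z ^+ k / (1 - z) ^+ k.+1).
  have zd : 1 - z <= d by have := expR_ge1Dx (- d); rewrite -/z; lra.
  have z1d : 0 < 1 - z by rewrite subr_gt0.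
  have ea : (1 - p) * d * z <= (1 - expR (- ((1 - p) * d))) * expR (- (p * d)).
    have -> : z = expR (- ((1 - p) * d)) * expR (- (p * d)).
      by rewrite -expRD; congr expR; ring.
    rewrite mulrA ler_wpM2r ?expR_ge0//.
    have := expR_ge1Dx ((1 - p) * d); set y := (1 - p) * d.
    have y0 := expR_gt0 y; rewrite expRN ler_pdivrMr// mulrBl mulVf ?gt_eqF//.
    lra.
  apply: (@le_trans _ _ ((1 - p) * d * z * (p * d) ^+ k * (z ^+ k / d ^+ k.+1))).
    rewrite le_eqVlt; apply/orP; left; apply/eqP; rewrite !exprMn !exprS.
    by field; rewrite expf_neq0 ?gt_eqF.
  apply: ler_pM.
  - by rewrite !mulr_ge0 ?exprn_ge0 ?mulr_ge0 ?subr_ge0 ?(ltW p0) ?(ltW d0) ?(ltW p1) ?(ltW z0).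
  - by rewrite divr_ge0 ?exprn_ge0 ?(ltW z0) ?(ltW d0).
  - by rewrite ler_wpM2r// exprn_ge0// mulr_ge0// ltW.
  rewrite ler_wpM2l ?exprn_ge0 ?(ltW z0)// lef_pV2 ?posrE ?exprn_gt0//.
  by rewrite lerXn2r// nnegrE ltW.
have : a * (\sum_(j < n) 'C(j, k)%:R * z ^+ j) @[n --> \oo] -->
    a * (z ^+ k / (1 - z) ^+ k.+1).
  by apply: cvgM; [exact: cvg_cst|exact: cvg_sum_bin_expr].
move=> /cvgr_gt/(_ x (lt_le_trans xlt lim_ge)); apply: filterS => J xJ.
by apply: lt_le_trans xJ _; rewrite mulr_sumr; apply: ler_sum => j _.
Qed.

End negative_binomial.

(** * Finite families of Poisson counts *)

Section finite_unions.
Context {R : realType} d (T : measurableType d) (mu : {measure set T -> \bar R}).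

Lemma measure_bigsetU_seq (I : eqType) (s : seq I) (F : I -> set T) :
  (forall i, measurable (F i)) -> uniq s -> trivIset [set` s] F ->
  mu (\big[setU/set0]_(i <- s) F i) = (\sum_(i <- s) mu (F i))%E.
Proof.
move=> mF us tF.
have mU : measurable (\big[setU/set0]_(i <- s) F i) by exact: bigsetU_measurable.
have indE A : measurable A -> mu A = (\int[mu]_(x in A) (cst 1%E x))%E.
  by move=> mA; rewrite integral_cst// mul1e.
rewrite indE// ge0_integral_bigsetU//.
by apply: eq_bigr => i _; rewrite -indE.
Qed.

Lemma sum_measure_le (I : finType) (P : pred I) (F : I -> set T) (E : set T) :
  measurable E -> (forall i, measurable (F i)) -> trivIset [set i | P i] F ->
  (forall i, P i -> F i `<=` E) -> (\sum_(i | P i) mu (F i) <= mu E)%E.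
Proof.
move=> mE mF tF FE; rewrite -big_filter.
have memP i : i \in [seq i <- index_enum I | P i] -> P i.
  by rewrite mem_filter => /andP[].
rewrite -measure_bigsetU_seq//.
- apply: le_measure; rewrite ?inE//; first exact: bigsetU_measurable.
  rewrite -bigcup_seq => x [i /= /memP Pi Fx]; exact: FE Fx.
- by rewrite filter_uniq// index_enum_uniq.
- by apply: sub_trivIset tF => i /memP.
Qed.

Lemma measure_bigsetU_le (I : Type) (s : seq I) (P : pred I) (F : I -> set T) :
  (forall i, measurable (F i)) ->
  (mu (\big[setU/set0]_(i <- s | P i) F i) <= \sum_(i <- s | P i) mu (F i))%E.
Proof.
move=> mF; elim: s => [|i s IH]; first by rewrite !big_nil measure0.
rewrite !big_cons; case: ifP => // _.
apply: le_trans (measureU2 _ _ _) _ => //; first exact: bigsetU_measurable.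
by rewrite leeD2l.
Qed.

End finite_unions.

Section poisson_families.
Context {R : realType} dT (T : topMeasurableType dT) (S : set T).
Context d' (Omega' : measurableType d') (P' : probability Omega' R).
Variables (eta : set T -> \bar R) (N : Omega' -> vague_measure R S).
Hypothesis PN : poisson_point_process P' eta N.

Local Notation cnt A w := ((N w : measure T R) A).

Lemma measurable_poisson_count (A : set T) : measurable A -> A `<=` S ->
  measurable_fun setT (fun w => cnt A w).
Proof.
move=> mA AS; have [_ /(_ 1%N (fun=> A))] := PN.
case=> //; first by move=> i j _ _ _; rewrite !ord1.
by move=> /(_ ord0)[].
Qed.

Lemma poisson_count (A : set T) (r : R) (k : nat) :
  measurable A -> A `<=` S -> eta A = r%:E ->
  P' [set w | cnt A w = k%:R%:E] = (r ^+ k / k`!%:R * expR (- r))%:E.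
Proof.
move=> mA AS etaA; have [_ /(_ 1%N (fun=> A))] := PN.
case=> //; first by move=> i j _ _ _; rewrite !ord1.
by move=> /(_ ord0)[_ /(_ k)]; rewrite etaA.
Qed.

(** The independence in the definition of a Poisson process is stated for
    families indexed by ordinals; here it is transported to a finite type. *)
Lemma poisson_family (I : finType) (A : I -> set T) (D : I -> set (\bar R)) :
  (forall i, measurable (A i)) -> (forall i, A i `<=` S) -> trivIset setT A ->
  (forall i, measurable (D i)) ->
  P' (\bigcap_(i in [set: I]) [set w | D i (cnt (A i) w)]) =
  (\prod_i P' [set w | D i (cnt (A i) w)])%E.
Proof.
move=> mA AS tA mD; pose e (i : 'I_#|I|) := @enum_val I predT i.
have tAe : trivIset setT (A \o e).
  by move=> i j _ _ /(tA _ _ Logic.I Logic.I)/enum_val_inj.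
have [_ /(_ #|I| (A \o e))] := PN.
case=> // [i|i|_ indep]; [exact: mA|exact: AS|].
pose J := seq_fset tt (enum 'I_#|I|).
have := indep J (D \o e) (fun i => mD (e i)).
have -> : \bigcap_(i in [set` J]) ((fun w => cnt ((A \o e) i) w) @^-1` (D \o e) i) =
    \bigcap_(i in [set: I]) [set w | D i (cnt (A i) w)].
  apply/seteqP; split=> w /= h i; last by move=> _; exact: h.
  move=> _; have := h (enum_rank i); rewrite /e enum_rankK; apply.
  by rewrite /= /J seq_fsetE mem_enum.
move=> ->.
rewrite (perm_big (enum 'I_#|I|)); last first.
  apply: uniq_perm; [exact: fset_uniq|exact: enum_uniq|move=> i].
  by rewrite /J seq_fsetE.
rewrite big_enum/= [RHS](reindex e)//.
by exists enum_rank => i _; rewrite /e ?enum_valK ?enum_rankK.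
Qed.

End poisson_families.

(** * Stopped sums of a Poisson process along a grid *)

Section poisson_lower_bound.
Context {R : realType} dT (T : topMeasurableType dT) (S : set T).
Variables (tm : T -> R) (lb : T -> bool) (mk : T -> \bar R).
Hypothesis HS : marked_space S tm lb mk.
Context d' (Omega' : measurableType d') (P' : probability Omega' R).
Variables (eta : set T -> \bar R) (N : Omega' -> vague_measure R S).
Hypothesis PN : poisson_point_process P' eta N.

Local Notation V := (point_measures R S).
Local Notation before := (points_before S tm lb).
Local Notation cnt A w := ((N w : measure T R) A).

Definition block (a b : R) (j : bool) (D : set (\bar R)) : set T :=
  [set u | [/\ S u, a <= tm u, tm u < b, lb u = j & D (mk u)]].

Lemma measurable_block a b j D : measurable D -> measurable (block a b j D).
Proof.
move=> mD; rewrite (_ : block a b j D = before b j `&`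
    ([set u | a <= tm u] `&` mk @^-1` D)).
  apply: measurableI; first exact: measurable_points_before HS _ _.
  apply: measurableI.
    rewrite -[X in measurable X]setTI; apply: measurable_fun_ler => //.
    exact: (measurable_time HS).
  by rewrite -[X in measurable X]setTI; apply: (measurable_mark HS).
by apply/seteqP; split=> u /=; [case|case=> -[? ? ?] []].
Qed.

Lemma before_block b j : before b j = block 0 b j setT.
Proof.
apply/seteqP; split=> u [] // Su *; split=> //.
exact: (time_ge0 HS).
Qed.

Variables (p : R) (m : bool -> probability (\bar R) R).
Hypothesis p01 : 0 < p < 1.
Hypothesis intensity : forall (a b : R) (j : bool) (D : set (\bar R)),
  0 <= a <= b -> measurable D ->
  eta (block a b j D) = (((b - a) * (if j then p else 1 - p))%:E * m j D)%E.
Hypothesis m_ge0 : m true [set y | (0 <= y)%E] = 1%E.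

Section partition.
Variables (Q : finType) (Qs : Q -> set (\bar R)) (lo up : Q -> \bar R).
Hypothesis mQs : forall q, measurable (Qs q).
Hypothesis tQs : trivIset setT Qs.
Hypothesis coverQs : forall y : \bar R, (0 <= y)%E -> exists q, Qs q y.
Hypothesis lo_ge0 : forall q, (0 <= lo q)%E.
Hypothesis loup : forall q y, Qs q y -> (lo q <= y <= up q)%E.

(** Knowing only how many marks fall in each cell guarantees that their sum is
    in [O]. *)
Definition sums_within (O : set (\bar R)) (n : Q -> nat) : Prop :=
  forall y : \bar R, (\sum_q (n q)%:R%:E * lo q <= y <= \sum_q (n q)%:R%:E * up q)%E ->
    O y.

(** One way for the stopped sum event to occur: no point labelled [false] before
    the [j]-th cell of the grid of step [d], at least one in this cell, which
    contains no point labelled [true], and [n q] points labelled [true] with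
    mark in [Qs q] before it. *)
Definition grid_block (d : R) (j : nat) (i : bool + unit + Q) : set T :=
  match i with
  | inl (inl false) => block 0 (j%:R * d) false setT
  | inl (inl true) => block (j%:R * d) (j.+1%:R * d) false setT
  | inl (inr _) => block (j%:R * d) (j.+1%:R * d) true setT
  | inr q => block 0 (j%:R * d) true (Qs q)
  end.

Definition grid_count (n : Q -> nat) (i : bool + unit + Q) : set (\bar R) :=
  match i with
  | inl (inl true) => ~` [set 0%:R%:E]
  | inr q => [set (n q)%:R%:E]
  | _ => [set 0%:R%:E]
  end.

Definition grid_event (d : R) (j : nat) (n : Q -> nat) : set Omega' :=
  \bigcap_(i in [set: bool + unit + Q])
    [set w | grid_count n i (cnt (grid_block d j i) w)].

Let mq q := fine (m true (Qs q)).

Let mqE q : (mq q)%:E = m true (Qs q).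
Proof. by rewrite fineK// fin_num_measure. Qed.

Let mq_ge0 q : 0 <= mq q.
Proof. by rewrite fine_ge0. Qed.

Let sum_mq : \sum_q mq q = 1.
Proof.
apply/eqP; rewrite eq_le -!lee_fin -sumEFin; apply/andP; split.
  under eq_bigr do rewrite mqE.
  rewrite -(probability_setT (m true)); apply: sum_measure_le => //.
  exact: sub_trivIset tQs.
under eq_bigr do rewrite mqE.
rewrite -m_ge0.
apply: le_trans _ (measure_bigsetU_le _ _ _ _) => //.
apply: le_measure; rewrite ?inE//.
- rewrite -[X in measurable X]setTI; exact: emeasurable_fun_c_infty.
- exact: bigsetU_measurable.
by move=> y /coverQs[q Qy]; rewrite -bigcup_seq; exists q => //=; rewrite mem_index_enum.
Qed.

Let measurable_grid_block d j i : measurable (grid_block d j i).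
Proof. by case: i => [[[]|[]]|q]; exact: measurable_block. Qed.

Lemma grid_block_sub d j i : grid_block d j i `<=` S.
Proof. by case: i => [[[]|[]]|q] u []. Qed.

Lemma trivIset_grid_block d j : trivIset setT (grid_block d j).
Proof.
move=> i i' _ _ [u []].
case: i => [[[]|[]]|q]; case: i' => [[[]|[]]|q'] [Su a1 b1 l1 D1] [_ a2 b2 l2 D2] //;
  try (by move: l1; rewrite l2); try (by have := lt_le_trans b1 a2; rewrite ltxx);
  try (by have := lt_le_trans b2 a1; rewrite ltxx).
by congr inr; apply: tQs => //; exists (mk u).
Qed.

(** The blocks are disjoint, so the counts are independent Poisson variables;
    the exponential factors recombine because the masses [mq q] sum to 1. *)
Lemma grid_event_prob (d : R) (j : nat) (n : Q -> nat) : 0 < d ->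
  P' (grid_event d j n) = (grid_weight p d (\sum_q n q) j *
    ((\sum_q n q)`!%:R * \prod_q (mq q ^+ n q / (n q)`!%:R)))%:E.
Proof.
move=> d0; have [p0 p1] := andP p01.
have jd0 : 0 <= j%:R * d by rewrite mulr_ge0// ltW.
have jd1 : j%:R * d <= j.+1%:R * d by rewrite ler_pM2r// ler_nat.
have jdB : j.+1%:R * d - j%:R * d = d by rewrite -mulrBl -natrB ?subSnn ?mul1r.
have mc i : measurable (grid_count n i).
  case: i => [[[]|[]]|q] /=; [exact: measurableC|exact: emeasurable_set1..].
rewrite (poisson_family PN)//; last 2 first.
- exact: grid_block_sub.
- exact: trivIset_grid_block.
have cntP (a b : R) l (D : set (\bar R)) (r : R) k : 0 <= a <= b -> measurable D ->
    eta (block a b l D) = r%:E ->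
    P' [set w | cnt (block a b l D) w = k%:R%:E] = (r ^+ k / k`!%:R * expR (- r))%:E.
  move=> ab mD E; apply: (poisson_count PN) => //; first exact: measurable_block.
  by move=> u [].
have cntT (a b : R) (l : bool) k : 0 <= a <= b ->
    let r := (b - a) * (if l then p else 1 - p) in
    P' [set w | cnt (block a b l setT) w = k%:R%:E] = (r ^+ k / k`!%:R * expR (- r))%:E.
  by move=> ab r; apply: cntP => //; rewrite intensity// probability_setT mule1.
have mcnt (a b : R) l (D : set (\bar R)) : measurable D -> measurable_fun setT (fun w => cnt (block a b l D) w).
  move=> mD; apply: (measurable_poisson_count PN); first exact: measurable_block.
  by move=> u [].
rewrite !big_sumType big_bool /= (big_pred1 tt)//=.
have jd01 : (0 : R) <= 0 <= j%:R * d by rewrite lexx.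
have jd12 : 0 <= j%:R * d <= j.+1%:R * d by rewrite jd0 jd1.
have -> : P' [set w | ~ cnt (block (j%:R * d) (j.+1%:R * d) false setT) w = 0%:R%:E] =
    (1 - expR (- ((1 - p) * d)))%:E.
  rewrite -[X in P' X]/(~` [set w | cnt (block (j%:R * d) (j.+1%:R * d) false setT) w = 0%:R%:E]).
  rewrite probability_setC; last first.
    rewrite -[X in measurable X]setTI.
    exact: (mcnt _ _ _ _ measurableT measurableT _ (emeasurable_set1 _)).
  by rewrite cntT// jdB expr0 fact0 divr1 mul1r -EFinB mulrC.
rewrite !cntT// jdB subr0 !expr0 fact0 !divr1 !mul1r.
have -> : (\prod_q P' [set w | cnt (block 0 (j%:R * d) true (Qs q)) w = (n q)%:R%:E] =
   (\prod_q ((j%:R * d * p) ^+ n q * (mq q ^+ n q / (n q)`!%:R) *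
       expR (- (j%:R * d * p * mq q))))%:E)%E.
  rewrite -prodEFin; apply: eq_bigr => q _.
  rewrite (cntP _ _ _ _ (j%:R * d * p * mq q))//.
    by rewrite exprMn mulrA.
  by rewrite intensity// subr0 -mqE EFinM.
rewrite !big_split/= -!EFinM; congr EFin.
rewrite prodrXr.
have -> : \prod_q expR (- (j%:R * d * p * mq q)) = expR (- (j%:R * d * p)).
  by rewrite -expR_sum sumrN -mulr_sumr sum_mq mulr1.
rewrite /grid_weight; set k := \sum_q n q.
have kf : k`!%:R != 0 :> R by rewrite pnatr_eq0 -lt0n fact_gt0.
set A := \prod_q _; set B := \prod_q _.
rewrite [p * (j%:R * d)]mulrC [(1 - p) * (j%:R * d)]mulrC [p * d]mulrC.
set x1 := expR _; set x2 := expR _; set x3 := expR _; set x4 := expR _; set x5 := _ ^+ k.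
by field.
Qed.


Lemma measurable_grid_event d j n : measurable (grid_event d j n).
Proof.
apply: fin_bigcap_measurable => [|i _]; first exact: finite_finset.
have mc : measurable_fun setT (fun w => cnt (grid_block d j i) w).
  by apply: (measurable_poisson_count PN) => //; exact: grid_block_sub.
rewrite -[X in measurable X]setTI; apply: mc => //.
by case: i => [[[]|[]]|q] /=; [exact: measurableC|exact: emeasurable_set1..].
Qed.

Let tblock b : trivIset setT (fun q => block 0 b true (Qs q)).
Proof.
by move=> q q' _ _ [u [[_ _ _ _ D1] [_ _ _ _ D2]]]; apply: tQs => //; exists (mk u).
Qed.

Let before_split b :
  before b true = \big[setU/set0]_q block 0 b true (Qs q).
Proof.
rewrite -bigcup_seq; apply/seteqP; split=> u /=.
  move=> [Su ub lu]; have [q Qu] := coverQs (mark_ge0 HS Su).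
  exists q => /=; first by rewrite mem_index_enum.
  by split=> //; exact: (time_ge0 HS).
by move=> [q _ []].
Qed.

Let ibefore d j n w : grid_event d j n w ->
  (\sum_q (n q)%:R%:E * lo q <=
     \int[(N w : measure T R)]_(u in before (j%:R * d) true) mk u <=
   \sum_q (n q)%:R%:E * up q)%E.
Proof.
move=> Gw; rewrite before_split.
have mb q : measurable (block 0 (j%:R * d) true (Qs q)) by exact: measurable_block.
have mk0 q u : block 0 (j%:R * d) true (Qs q) u -> (0 <= mk u)%E.
  by move=> [Su *]; exact: (mark_ge0 HS).
have mmk D : measurable_fun D mk by apply: measurable_funTS; exact: (measurable_mark HS).
rewrite ge0_integral_bigsetU//; last 3 first.
- exact: index_enum_uniq.
- by apply: (sub_trivIset _ (@tblock _)).
- by move=> u; rewrite -bigcup_seq => -[q _ /mk0].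
have cE q c : (c * cnt (block 0 (j%:R * d) true (Qs q)) w = (n q)%:R%:E * c)%E.
  by have := Gw (inr q) Logic.I; rewrite /= => ->; rewrite muleC.
apply/andP; split; apply: lee_sum => q _; rewrite -cE -integral_cst//.
  apply: ge0_le_integral => //; try by move=> u Bu; exact: mk0 Bu.
    by move=> u _; exact: lo_ge0.
  by move=> u [_ _ _ _ /loup/andP[]].
apply: ge0_le_integral => //; try by move=> u Bu; exact: mk0 Bu.
by move=> u [_ _ _ _ /loup/andP[]].
Qed.

Lemma grid_event_stopped d j n O w : 0 < d -> sums_within O n ->
  grid_event d j n w -> stopped_sum_event tm lb mk O (N w).
Proof.
move=> d0 nO Gw; have Vw : V (N w) by case: PN.1.
exists (j%:R * d), (j.+1%:R * d), (\sum_q n q)%N.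
split; first by rewrite ltr_pM2r// ltr_nat.
have mB a b l D : measurable D -> measurable (block a b l D) by exact: measurable_block.
have Nq : cnt (before (j%:R * d) true) w = (\sum_q n q)%N%:R%:E.
  rewrite before_split measure_bigsetU_seq//.
  - rewrite natr_sum -sumEFin; apply: eq_bigr => q _.
    exact: (Gw (inr q) Logic.I).
  - by move=> q; exact: mB.
  - exact: index_enum_uniq.
  - by apply: (sub_trivIset _ (@tblock _)).
split=> //.
- by rewrite before_block; exact: (Gw (inl (inl false)) Logic.I).
- have := Gw (inl (inl true)) Logic.I; rewrite /= => /eqP N0.
  apply: (@lt_le_trans _ _ (cnt (block (j%:R * d) (j.+1%:R * d) false setT) w)).
    by rewrite lt0e N0 measure_ge0.
  apply: le_measure; rewrite ?inE; [exact: mB|exact: (measurable_points_before HS)|].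
  by move=> u [].
- rewrite (_ : before (j.+1%:R * d) true = before (j%:R * d) true `|`
    block (j%:R * d) (j.+1%:R * d) true setT); last first.
    apply/seteqP; split=> u /=.
      move=> [Su us lu]; have [uq|uq] := ltP (tm u) (j%:R * d); first by left; split.
      by right; split.
    move=> [[Su uq lu]|[Su _ us lu _]]; split=> //.
    by rewrite (lt_le_trans uq)// ler_pM2r// ler_nat.
  have N0 : cnt (block (j%:R * d) (j.+1%:R * d) true setT) w = 0.
    exact: (Gw (inl (inr tt)) Logic.I).
  rewrite measureU//; [|exact: (measurable_points_before HS)|exact: mB|].
    by rewrite [X in (_ + X)%E]N0 adde0.
  by apply/seteqP; split=> // u [[_ uq _] [_ qu _ _ _]]; have := lt_le_trans uq qu; rewrite ltxx.
by apply: nO; exact: ibefore.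
Qed.

(** The first point labelled [false] lies in a single cell of the grid. *)
Lemma grid_event_disjoint (d : R) j j' n n' w : 0 < d ->
  grid_event d j n w -> grid_event d j' n' w -> j = j' /\ n =1 n'.
Proof.
move=> d0 Gw Gw'.
have key i i' l l' : grid_event d i l w -> grid_event d i' l' w -> (i' <= i)%N.
  move=> Gi Gi'; rewrite leqNgt; apply/negP => ii'.
  have h1 := Gi (inl (inl true)) Logic.I; apply: h1 => /=.
  have h2 := Gi' (inl (inl false)) Logic.I; rewrite /= in h2.
  apply/eqP; rewrite eq_le measure_ge0 andbT -[leRHS]h2.
  apply: le_measure; rewrite ?inE; [exact: measurable_block..|].
  move=> u [Su iu ui lu _]; split=> //; first exact: (time_ge0 HS).
  by rewrite (lt_le_trans ui)// ler_pM2r// ler_nat.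
have jj' : j = j'.
  by apply/eqP; rewrite eqn_leq (key _ _ _ _ Gw' Gw) (key _ _ _ _ Gw Gw').
split=> // q; subst j'; apply/eqP; rewrite -(eqr_nat R); apply/eqP.
have := Gw (inr q) Logic.I; have := Gw' (inr q) Logic.I; rewrite /= => -> [].
by move=> ->.
Qed.

Lemma prod_count_mem (f : Q -> R) (s : seq Q) :
  \prod_(q <- s) f q = \prod_q f q ^+ count_mem q s.
Proof.
elim: s => [|x s IH]; first by rewrite big_nil big1.
rewrite big_cons IH /=; under [RHS]eq_bigr do rewrite exprD.
rewrite big_split/=; congr (_ * _); rewrite (bigD1 x)//= eqxx expr1 big1 ?mulr1//.
by move=> q /negbTE qx; rewrite eq_sym qx.
Qed.

(** Words with the same letter counts have the same weight; counting them
    turns a sum over words into a sum over counts. *)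
Lemma sum_words_le (O : set (\bar R)) (K k : nat) : (k <= K)%N ->
  \sum_(w : k.-tuple Q | `[< sums_within O (fun q => count_mem q w) >])
     \prod_(q <- w) mq q <=
  \sum_(n : {ffun Q -> 'I_K.+1} | `[< sums_within O (fun q => n q : nat) >] &&
                                 (\sum_q n q == k)%N)
     k`!%:R * \prod_q (mq q ^+ n q / (n q)`!%:R).
Proof.
move=> kK.
pose c (w : k.-tuple Q) : {ffun Q -> 'I_K.+1} := [ffun q => inord (count_mem q w)].
have cE w q : c w q = count_mem q w :> nat.
  by rewrite ffunE inordK// ltnS (leq_trans (count_size _ _))// size_tuple.
have cfun w : (fun q => c w q : nat) = (fun q => count_mem q w).
  by apply/funext => q; rewrite cE.
have sumc w : (\sum_q c w q = k)%N.
  under eq_bigr do rewrite cE.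
  rewrite -[RHS](size_tuple w) -sum1_size.
  under eq_bigr do rewrite -sum1_count.
  rewrite (exchange_big_dep xpredT)//=; apply: eq_bigr => x _.
  by rewrite (big_pred1 x)// => q; rewrite /= eq_sym.
rewrite (partition_big c (fun n => `[< sums_within O (fun q => n q : nat) >] &&
  (\sum_q n q == k)%N)); last by move=> w wO; rewrite cfun wO sumc eqxx.
apply: ler_sum => n /andP[nO nk].
have [w0 /andP[w0O /eqP cw0]|none] := pickP [pred w : k.-tuple Q |
    `[< sums_within O (fun q => count_mem q w) >] && (c w == n)]; last first.
  rewrite big_pred0// mulr_ge0//; apply: prodr_ge0 => q _.
  by rewrite divr_ge0// exprn_ge0.
have perm_w w : (c w == n) = perm_eq w w0.
  rewrite -cw0; apply/eqP/idP => [cww0|ww0].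
    apply/allP => q _ /=; rewrite -!cE cww0//.
  by apply/ffunP => q; apply/val_inj; rewrite /= !cE; apply/permP.
rewrite [leLHS](eq_bigr (fun=> \prod_q mq q ^+ n q)); last first.
  by move=> w /andP[_ /eqP <-]; rewrite prod_count_mem; apply: eq_bigr => q _; rewrite cE.
rewrite sumr_const.
have -> : #|[pred w : k.-tuple Q | `[< sums_within O (fun q => count_mem q w) >]
     && (c w == n)]| = size (permutations w0).
  rewrite cardE -(size_map val); apply: perm_size; apply: uniq_perm.
  - by rewrite map_inj_uniq ?enum_uniq//; exact: val_inj.
  - exact: permutations_uniq.
  move=> s; rewrite mem_permutations; apply/mapP/idP => [[w]|sw0].
    by rewrite mem_enum inE perm_w => /andP[_ ?] ->.
  have sk : size s == k by rewrite (perm_size sw0) size_tuple.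
  exists (Tuple sk) => //; rewrite mem_enum inE perm_w andbC.
  apply/andP; split=> //; move: w0O; rewrite (_ : (fun _ => _) =
    (fun q : Q => count_mem q (Tuple sk)))//.
  by apply/funext => q; apply/esym/permP.
have := size_permutations_count w0; rewrite size_tuple.
under eq_bigr do rewrite -cE cw0.
move=> /(congr1 (fun x => x%:R : R)); rewrite natrM natr_prod => <-.
rewrite prodf_div; set A := \prod_q _; set B := \prod_q _.
have B0 : B != 0 by apply/prodf_neq0 => q _; rewrite pnatr_eq0 -lt0n fact_gt0.
by rewrite -[leRHS]mulrA [B * _]mulrC -mulrA mulVf// mulr1 mulr_natl.
Qed.


(** The grid events whose counts are compatible with [O] are disjoint and lie in
    the stopped sum event.  Summing their probabilities over the cells gives at
    least [p ^+ k * (1 - p)] up to an error that vanishes with the step [d]. *)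
Lemma sum_words_le_stopped (O : set (\bar R)) (K : nat) : open O ->
  \sum_(k < K) p ^+ k * (1 - p) *
    \sum_(w : k.-tuple Q | `[< sums_within O (fun q => count_mem q w) >])
      \prod_(q <- w) mq q <=
  fine (P' (N @^-1` stopped_sum_event tm lb mk O)).
Proof.
move=> oO; set E := N @^-1` _; have [p0 p1] := andP p01.
have mE : measurable E by apply: cozero_measurable PN.1 (cozero_stopped_sum HS oO).
pose W k := \sum_(w : k.-tuple Q | `[< sums_within O (fun q => count_mem q w) >])
      \prod_(q <- w) mq q.
have W0 k : 0 <= W k.
  by apply: sumr_ge0 => w _; elim/big_ind: _ => //; exact: mulr_ge0.
rewrite -[leLHS]/(\sum_(k < K) p ^+ k * (1 - p) * W k).
apply/ler_addgt0Pr => eps eps0.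
(* The step [d] makes the total error on each geometric weight less than [e'],
   and [e'] makes the sum of these errors, weighted by words, less than [eps]. *)
pose e' := eps / (\sum_(k < K) W k + 1).
have SW0 : 0 <= \sum_(k < K) W k by apply: sumr_ge0.
have e'0 : 0 < e' by rewrite divr_gt0// ltr_wpDl.
pose d := e' / K.+1%:R; have d0 : 0 < d by rewrite divr_gt0.
have near_k : \forall J \near \oo, forall k : 'I_K,
    p ^+ k * (1 - p) - e' < \sum_(j < J) grid_weight p d k j.
  apply: filter_forall => k; apply: grid_weight_bound => //.
  have q1 : p ^+ k * (1 - p) <= 1.
    by rewrite mulr_ile1 ?exprn_ge0 ?exprn_ile1 ?subr_ge0 ?(ltW p0) ?(ltW p1)// gerBl ltW.
  have q0 : 0 <= p ^+ k * (1 - p) by rewrite mulr_ge0 ?exprn_ge0 ?subr_ge0 ?(ltW p0) ?(ltW p1).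
  have h : 1 - e' < expR (- d) ^+ k.+1.
    rewrite -expRM_natr; apply: lt_le_trans (expR_ge1Dx _).
    rewrite ltrD2l mulNr ltrN2 /d mulrAC ltr_pdivrMr//.
    by rewrite ltr_pM2l// ltr_nat ltnS.
  have := expR_gt0 (- d); move: (expR _) h => x h x0.
  have : p ^+ k * (1 - p) * (1 - x ^+ k.+1) < e'.
    have [x1|x1] := leP (x ^+ k.+1) 1.
      apply: le_lt_trans (ler_piMl _ q1) _; rewrite ?subr_ge0//; lra.
    apply: le_lt_trans e'0; rewrite mulr_ge0_le0// subr_le0 ltW//.
  lra.
clearbody d.
have [J _ /(_ J (leqnn J)) HJ] := near_k.
pose G n := `[< sums_within O (fun q => (n : {ffun Q -> 'I_K.+1}) q : nat) >].
have key : \sum_(k < K) (\sum_(j < J) grid_weight p d k j) * W k <= fine (P' E).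
  rewrite -lee_fin fineK ?fin_num_measure//.
  pose F (i : 'I_J * {ffun Q -> 'I_K.+1}) := grid_event d i.1 (fun q => i.2 q : nat).
  have sumF : (\sum_(i : 'I_J * {ffun Q -> 'I_K.+1} | G i.2) P' (F i) <= P' E)%E.
    apply: sum_measure_le => //.
    - by move=> i; exact: measurable_grid_event.
    - move=> [j n] [j' n'] _ _ [w [/= h h']].
      have [/= jj' nn'] := grid_event_disjoint d0 h h'.
      by congr pair; [exact: val_inj|apply/ffunP => q; apply: val_inj; exact: nn'].
    - by move=> [j n] /= /asboolP Gn w; exact: grid_event_stopped.
  pose f (n : {ffun Q -> 'I_K.+1}) : R :=
     (\sum_q n q)`!%:R * \prod_q (mq q ^+ n q / (n q)`!%:R).
  have f0 n : 0 <= f n.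
    by rewrite mulr_ge0//; apply: prodr_ge0 => q _; rewrite divr_ge0// exprn_ge0.
  have gw0 k j : 0 <= grid_weight p d k j.
    rewrite /grid_weight !mulr_ge0 ?expR_ge0 ?exprn_ge0 ?mulr_ge0 ?(ltW p0) ?(ltW d0)//.
    by rewrite subr_ge0 ltW// expR_lt1 oppr_lt0 mulr_gt0// subr_gt0.
  apply: (@le_trans _ _ (\sum_(i : 'I_J * {ffun Q -> 'I_K.+1} | G i.2)
      (grid_weight p d (\sum_q i.2 q)%N i.1 * f i.2)%:E)%E); last first.
    apply: le_trans sumF; rewrite le_eqVlt; apply/orP; left; apply/eqP.
    by apply: eq_bigr => i _; rewrite /F grid_event_prob.
  rewrite sumEFin lee_fin -(pair_big_dep xpredT (fun (_ : 'I_J) n => G n)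
    (fun (j : 'I_J) n => grid_weight p d (\sum_q n q)%N j * f n))/=.
  under eq_bigr do rewrite mulr_suml.
  rewrite exchange_big/=; apply: ler_sum => j _.
  have Wle (k : 'I_K) : W k <= \sum_(n | G n && (\sum_q n q == k)%N) f n.
    apply: le_trans (sum_words_le O (ltnW (ltn_ord k))) _.
    by rewrite le_eqVlt; apply/orP; left; apply/eqP; apply: eq_bigr => n /andP[_ /eqP nk]; rewrite /f nk.
  apply: (@le_trans _ _ (\sum_(k < K) \sum_(n | G n)
     if (\sum_q n q == k)%N then grid_weight p d (\sum_q n q) j * f n else 0)).
    apply: ler_sum => k _; rewrite -big_mkcondr.
    rewrite (le_trans (ler_wpM2l (gw0 k j) (Wle k)))// mulr_sumr.
    by rewrite le_eqVlt; apply/orP; left; apply/eqP; apply: eq_bigr => n /andP[_ /eqP nk]; rewrite nk.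
  rewrite exchange_big/=; apply: ler_sum => n _.
  have [nK|nK] := ltnP (\sum_q n q)%N K.
    rewrite (bigD1 (Ordinal nK))//= [X in _ + X]big1 ?addr0 => [|k kn]; first by rewrite eqxx.
    by case: eqP => // nk; move: kn; rewrite -val_eqE /= nk eqxx.
  rewrite [leLHS]big1 => [|k _]; first exact: mulr_ge0 (gw0 _ _) (f0 _).
  case: eqP => // nk.
  by move: (ltn_ord k); rewrite -nk ltnNge nK.
rewrite -lerBlDr (le_trans _ key)// lerBlDr -lerBlDl -sumrB.
apply: (@le_trans _ _ (\sum_(k < K) e' * W k)).
  apply: ler_sum => k _; rewrite -mulrBl ler_wpM2r//.
  by rewrite lerBlDl -lerBlDr ltW.
rewrite -mulr_sumr /e' mulrAC ler_pdivrMr ?ltr_wpDl//.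
by rewrite ler_pM2l// lerDl.
Qed.

End partition.
End poisson_lower_bound.

(** * Comparison with the compound geometric law *)

Section mark_cells.
Context {R : realType}.
Variable L : nat.

(** The half-line [0, +oo] is cut into intervals of length [1 / L.+1] up to
    [L.+1], followed by the unbounded interval that starts at [L.+1]. *)
Definition mark_cell_index := 'I_(L.+1 * L.+1).+1.
Implicit Types (q : mark_cell_index) (y : \bar R).

Definition cell_lower q : \bar R := (q%:R / L.+1%:R)%:E.
Definition cell_upper q : \bar R :=
  if (q < L.+1 * L.+1)%N then (q.+1%:R / L.+1%:R)%:E else +oo%E.
Definition mark_cell q : set (\bar R) :=
  [set y | (cell_lower q <= y)%E /\
           ((q < L.+1 * L.+1)%N -> (y < cell_upper q)%E)].

Lemma measurable_mark_cell q : measurable (mark_cell q).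
Proof.
rewrite /mark_cell; have [qL|qL] := boolP (q < L.+1 * L.+1)%N.
  rewrite (_ : [set y | _] = [set y | (cell_lower q <= y)%E] `&`
    [set y | (y < cell_upper q)%E]).
    apply: measurableI; rewrite -[X in measurable X]setTI.
      exact: emeasurable_fun_c_infty.
    exact: emeasurable_fun_infty_o.
  by apply/seteqP; split=> y /= [? h]; split=> //; exact: h.
rewrite (_ : [set y | _] = [set y | (cell_lower q <= y)%E]).
  by rewrite -[X in measurable X]setTI; exact: emeasurable_fun_c_infty.
by apply/seteqP; split=> y /= => [[]|].
Qed.

Lemma trivIset_mark_cell : trivIset setT mark_cell.
Proof.
have key q q' y : (q < q')%N -> mark_cell q y -> mark_cell q' y -> False.
  move=> qq' [_ h] [h' _].
  have qL : (q < L.+1 * L.+1)%N by rewrite (leq_trans qq')// -ltnS.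
  have := h qL; rewrite /cell_upper qL ltNge => /negP; apply.
  by apply: le_trans h'; rewrite lee_fin ler_pM2r ?invr_gt0// ler_nat.
move=> q q' _ _ [y [Qy Q'y]]; apply/val_inj/eqP; rewrite eqn_leq.
by apply/andP; split; rewrite leqNgt; apply/negP => h;
  by [exact: key h Qy Q'y|exact: key h Q'y Qy].
Qed.

Lemma mark_cell_cover y : (0 <= y)%E -> exists q, mark_cell q y.
Proof.
move=> y0; have [yL|Ly] := ltP y L.+1%:R%:E; last first.
  exists ord_max; split; last by rewrite /= ltnn.
  apply: le_trans Ly; rewrite lee_fin /= natrM mulfK ?pnatr_eq0//.
case: y y0 yL => [r||]//; rewrite lee_fin lte_fin => r0 rL.
have L0 : 0 < L.+1%:R :> R by rewrite ltr0n.
have r0' : 0 <= r * L.+1%:R by rewrite mulr_ge0// ltW.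
have /andP[t1 t2] := truncn_itv r0'; set t := Num.truncn _ in t1 t2.
have tL : (t < L.+1 * L.+1)%N.
  by rewrite -(ltr_nat R) (le_lt_trans t1)// natrM ltr_pM2r.
exists (Ordinal (ltnW tL : (t < (L.+1 * L.+1).+1)%N)).
split=> [|_]; first by rewrite lee_fin /= ler_pdivrMr.
by rewrite /cell_upper /= tL lte_fin ltr_pdivlMr.
Qed.

Lemma cell_lower_ge0 q : (0 <= cell_lower q)%E.
Proof. by rewrite lee_fin divr_ge0. Qed.

Lemma mark_cell_bounds q y : mark_cell q y -> (cell_lower q <= y <= cell_upper q)%E.
Proof.
move=> [-> h]; rewrite /=; have [qL|qL] := boolP (q < L.+1 * L.+1)%N.
  by apply: ltW; exact: h.
by rewrite /cell_upper (negbTE qL) leey.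
Qed.

Lemma cell_upper_ge0 q : (0 <= cell_upper q)%E.
Proof. by rewrite /cell_upper; case: ifP => // _; rewrite lee_fin divr_ge0. Qed.

End mark_cells.

Section mark_cells_cvg.
Context {R : realType}.

(** The cells around a finite [y] shrink to [y]; the cells of [+oo] are the
    unbounded ones, whose lower ends tend to [+oo]. *)
Lemma cvg_cell_bounds (y : \bar R) (q : forall L, mark_cell_index L) :
  (forall L, mark_cell (q L) y) ->
  @cell_lower R L (q L) @[L --> \oo] --> y /\ @cell_upper R L (q L) @[L --> \oo] --> y.
Proof.
move=> qy; have y0 : (0 <= y)%E.
  by apply: le_trans (cell_lower_ge0 (q 0%N)) _; have [] := qy 0%N.
case: y y0 qy => [r||]// r0 qy; last first.
  have qL L : (q L < L.+1 * L.+1)%N = false.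
    by apply/negP => h; have [_ /(_ h)] := qy L; rewrite /cell_upper h.
  have qE L : val (q L) = (L.+1 * L.+1)%N.
    by apply/eqP; rewrite eqn_leq -ltnS ltn_ord /= leqNgt qL.
  split; last by under eq_fun do rewrite /cell_upper qL; exact: cvg_cst.
  under eq_fun do rewrite /cell_lower qE natrM mulfK ?pnatr_eq0//.
  have : (n%:R : R)%:E @[n --> \oo] --> +oo%E by apply/cvgenyP; exact: cvg_id.
  by rewrite -cvg_shiftS.
have bound : \forall L \near \oo, (q L < L.+1 * L.+1)%N.
  near=> L; rewrite ltnNge; apply/negP => h; have [+ _] := qy L.
  rewrite lee_fin; apply/negP; rewrite -ltNge.
  apply: (@lt_le_trans _ _ L.+1%:R).
    by rewrite (@lt_trans _ _ L%:R) ?ltr_nat//; near: L; exact: nbhs_infty_gtr.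
  by rewrite ler_pdivlMr ?ltr0n// -natrM ler_nat.
have low L : (q L < L.+1 * L.+1)%N ->
    [/\ @cell_lower R L (q L) = ((q L)%:R / L.+1%:R)%:E,
     @cell_upper R L (q L) = ((q L).+1%:R / L.+1%:R)%:E,
     (q L)%:R / L.+1%:R <= r & r < (q L).+1%:R / L.+1%:R].
  move=> h; have [] := qy L; rewrite /cell_upper h lee_fin => ? /(_ isT).
  by rewrite lte_fin; split.
have hr : L.+1%:R^-1 @[L --> \oo] --> (0 : R) by exact: cvg_harmonic.
split.
  apply: (@squeeze_cvge _ _ _ _ (fun L => (r - L.+1%:R^-1)%:E) _ (cst r%:E)).
  - near=> L; have qL : (q L < L.+1 * L.+1)%N by near: L.
    have [-> _ h1 h2] := low _ qL; rewrite !lee_fin h1 andbT lerBlDr.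
    by move: h2; rewrite -natr1 mulrDl mul1r => /ltW.
  - apply: cvg_EFin; first by near=> L.
    by rewrite -[X in _ --> X]subr0; apply: cvgB => //; exact: cvg_cst.
  - exact: cvg_cst.
apply: (@squeeze_cvge _ _ _ _ (cst r%:E) _ (fun L => (r + L.+1%:R^-1)%:E)).
- near=> L; have qL : (q L < L.+1 * L.+1)%N by near: L.
  have [_ -> h1 h2] := low _ qL; rewrite !lee_fin ltW//=.
  by rewrite -natr1 mulrDl mul1r lerD2r.
- exact: cvg_cst.
- apply: cvg_EFin; first by near=> L.
  by rewrite -[X in _ --> X]addr0; apply: cvgD => //; exact: cvg_cst.
Unshelve. all: by end_near.
Qed.

End mark_cells_cvg.

Section extended_real_random_elements.
Context {R : realType} d (Omega : measurableType d).

Lemma open_emeasurable (O : set (\bar R)) : open O -> measurable O.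
Proof.
move=> oO; rewrite (_ : O = EFin @` (EFin @^-1` O) `|` (O `&` [set -oo%E; +oo%E])).
  apply: measurableU.
    apply: measurable_image_EFin; apply: open_measurable.
    by apply: open_comp => // r _ A; exact.
  have [Oy|Oy] := pselect (O +oo%E); have [ON|ON] := pselect (O -oo%E).
  - rewrite setIidr; last by move=> y [->|->].
    by apply: measurableU; exact: emeasurable_set1.
  - rewrite (_ : _ `&` _ = [set +oo%E]); first exact: emeasurable_set1.
    by apply/seteqP; split=> [y [Oy' [yN|//]]|y ->]; [by rewrite (yN : y = _) in Oy'|split=> //; right].
  - rewrite (_ : _ `&` _ = [set -oo%E]); first exact: emeasurable_set1.
    by apply/seteqP; split=> [y [Oy' [//|yN]]|y ->]; [by rewrite (yN : y = _) in Oy'|split=> //; left].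
  - rewrite (_ : _ `&` _ = set0)//.
    by apply/seteqP; split=> y // [Oy' [yN|yN]]; rewrite (yN : y = _) in Oy'.
apply/seteqP; split=> y; last by move=> [[r Or <-]//|[]].
case: y => [r||] Oy; [left; exists r|right; split=> //; right|right; split=> //; left] => //.
Qed.

Lemma measurable_random_element (Z : Omega -> \bar R) :
  measurable_fun setT Z -> random_element setT Z.
Proof.
move=> mZ; split=> // O /open_emeasurable mO.
by rewrite -[X in measurable X]setTI; exact: mZ.
Qed.

Lemma measurable_stopped_sum (M : Omega -> nat) (X : nat -> Omega -> \bar R) :
  measurable_fun setT M -> (forall i, measurable_fun setT (X i)) ->
  measurable_fun setT (fun w => (\sum_(i < M w) X i w)%E).
Proof.
move=> mM mX _ A mA; rewrite setTI.
rewrite (_ : _ @^-1` A = \bigcup_k (M @^-1` [set k] `&`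
    ((fun w => (\sum_(i < k) X i w)%E) @^-1` A))); last first.
  apply/seteqP; split=> w /=; first by move=> h; exists (M w).
  by move=> [k _ [/= <-]].
apply: bigcupT_measurable => k; apply: measurableI.
  by rewrite -[X in measurable X]setTI; exact: mM.
have mS : measurable_fun setT (fun w => (\sum_(i < k) X i w)%E).
  by apply: emeasurable_sum => i; exact: mX.
by rewrite -[X in measurable X]setTI; exact: mS.
Qed.

End extended_real_random_elements.

Section poisson_stopped_sum.
Context {R : realType} dT (T : topMeasurableType dT) (S : set T).
Variables (tm : T -> R) (lb : T -> bool) (mk : T -> \bar R).
Hypothesis HS : marked_space S tm lb mk.
Context d' (Omega' : measurableType d') (P' : probability Omega' R).
Variables (eta : set T -> \bar R) (N : Omega' -> vague_measure R S).
Hypothesis PN : poisson_point_process P' eta N.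
Variables (p : R) (m : bool -> probability (\bar R) R).
Hypothesis p01 : 0 < p < 1.
Hypothesis intensity : forall (a b : R) (j : bool) (D : set (\bar R)),
  0 <= a <= b -> measurable D ->
  eta (block S tm lb mk a b j D) =
    (((b - a) * (if j then p else 1 - p))%:E * m j D)%E.
Hypothesis m_ge0 : m true [set y | (0 <= y)%E] = 1%E.

Context d2 (Omega2 : measurableType d2) (P2 : probability Omega2 R).
Variables (M : Omega2 -> nat) (X : nat -> Omega2 -> \bar R).
Hypothesis mM : measurable_fun setT M.
Hypothesis mX : forall i, measurable_fun setT (X i).
Hypothesis X_ge0 : forall i, P2 [set w | (X i w < 0)%E] = 0%E.
Hypothesis law : forall k (D : nat -> set (\bar R)), (forall i, measurable (D i)) ->
  P2 [set w | M w = k /\ forall i, (i < k)%N -> D i (X i w)] =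
  ((p ^+ k * (1 - p))%:E * \prod_(i < k) m true (D i))%E.

Let sum_count_mem_mul (Q : finType) (f : Q -> \bar R) (s : seq Q) :
  (forall q, 0 <= f q)%E ->
  (\sum_q (count_mem q s)%:R%:E * f q = \sum_(q <- s) f q)%E.
Proof.
move=> f0; elim: s => [|x s IH].
  by rewrite big_nil big1// => q _; rewrite mul0e.
rewrite big_cons -IH /=.
under eq_bigr do rewrite natrD EFinD ge0_muleDl ?lee_fin//.
rewrite big_split/=; congr (_ + _)%E; rewrite (bigD1 x)//= eqxx mul1e big1 ?adde0//.
by move=> q /negbTE qx; rewrite eq_sym qx mul0e.
Qed.

Let good O L k (w : k.-tuple (mark_cell_index L)) := `[< sums_within
  (@cell_lower R L) (@cell_upper R L) O (fun q => count_mem q w) >].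

Let word_event L k (w : k.-tuple (mark_cell_index L)) : set Omega2 :=
  [set x | M x = k /\ forall i, (i < k)%N -> mark_cell (nth ord0 w i) (X i x)].

Let measurable_law k (D : nat -> set (\bar R)) : (forall i, measurable (D i)) ->
  measurable [set w | M w = k /\ forall i, (i < k)%N -> D i (X i w)].
Proof.
move=> mD; rewrite (_ : [set w | _] = M @^-1` [set k] `&`
    \bigcap_(i in [set i | (i < k)%N]) (X i @^-1` D i)).
  apply: measurableI; first by rewrite -[X in measurable X]setTI; exact: mM.
  by apply: bigcap_measurableType => i _; rewrite -[X in measurable X]setTI; exact: mX.
by apply/seteqP; split=> w /= [? h]; split=> // i; exact: h.
Qed.

(** This event depends only on the number of rewards and on the cells that
    contain them, so its probability is a sum over words. *)
Let level_event O L : set Omega2 :=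
  \big[setU/set0]_(k < L) \big[setU/set0]_(w : k.-tuple (mark_cell_index L) | good O w)
    word_event w.

Let mword L k (w : k.-tuple (mark_cell_index L)) : measurable (word_event w).
Proof.
exact: (@measurable_law k (fun i => mark_cell (nth ord0 w i))
  (fun i => @measurable_mark_cell R L _)).
Qed.

Let level_event_le O L : open O ->
  (P2 (level_event O L) <= P' (N @^-1` stopped_sum_event tm lb mk O))%E.
Proof.
move=> oO.
have mE : measurable (N @^-1` stopped_sum_event tm lb mk O).
  exact: cozero_measurable PN.1 (cozero_stopped_sum HS oO).
have := sum_words_le_stopped HS PN p01 intensity m_ge0 (@measurable_mark_cell R L)
  (@trivIset_mark_cell R L) (@mark_cell_cover R L) (@cell_lower_ge0 R L)
  (@mark_cell_bounds R L) L oO.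
rewrite -lee_fin fineK ?fin_num_measure//; apply: le_trans.
rewrite -sumEFin; apply: le_trans (measure_bigsetU_le _ _ _ _) _.
  by move=> k; apply: bigsetU_measurable => w _; exact: mword.
apply: lee_sum => k _; apply: le_trans (measure_bigsetU_le _ _ _ _) _.
  by move=> w; exact: mword.
rewrite mulr_sumr -sumEFin; apply: lee_sum => w _.
have lawE : P2 (word_event w) = ((p ^+ k * (1 - p))%:E *
    \prod_(i < k) m true (mark_cell (nth ord0 w i)))%E.
  exact: (@law k (fun i => mark_cell (nth ord0 w i))
    (fun i => @measurable_mark_cell R L _)).
rewrite [leLHS]lawE [leRHS]EFinM -prodEFin big_tuple; rewrite le_eqVlt; apply/orP; left; apply/eqP.
congr (_ * _)%E; apply: eq_bigr => i _; rewrite (tnth_nth ord0) fineK//.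
by rewrite fin_num_measure//; exact: measurable_mark_cell.
Qed.

(** When the sum of the rewards lies in the open set [O], so does every sum of
    values in the same cells once these are fine enough.  The event is thus
    contained in the lower limit of the [level_event O L], up to the null event
    that a reward is negative. *)
Lemma stopped_sum_poisson_ge (O : set (\bar R)) : open O ->
  (P2 [set w | O (\sum_(i < M w) X i w)%E] <=
   P' (N @^-1` stopped_sum_event tm lb mk O))%E.
Proof.
move=> oO; set E := P' _.
pose G n : set Omega2 := \bigcap_(L in [set L | (n <= L)%N]) level_event O L.
have mlevel L : measurable (level_event O L).
  by apply: bigsetU_measurable => k _; apply: bigsetU_measurable => w _; exact: mword.
have mG n : measurable (G n) by apply: bigcap_measurableType => L _; exact: mlevel.
have GE n : (P2 (G n) <= E)%E.
  apply: le_trans (level_event_le n oO); apply: le_measure; rewrite ?inE//.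
  by move=> w /(_ n (leqnn n)).
have mUG : measurable (\bigcup_n G n) by exact: bigcupT_measurable.
have UGE : (P2 (\bigcup_n G n) <= E)%E.
  have cvgG : P2 (G n) @[n --> \oo] --> P2 (\bigcup_n G n).
    apply: nondecreasing_cvg_mu => //; move=> i j ij; apply/subsetPset => w Gw L /= jL.
    by apply: Gw; exact: leq_trans jL.
  by apply: (cvge_to_le cvgG); apply: nearW => n; exact: GE.
have mneg i : measurable [set w | (X i w < 0)%E].
  by rewrite -[X in measurable X]setTI; exact: emeasurable_fun_infty_o.
pose Z := \bigcup_i [set w | (X i w < 0)%E].
have mZ : measurable Z by exact: bigcupT_measurable.
have Z0 : P2 Z = 0.
  apply/eqP; rewrite -measure_le0.
  apply: le_trans (measure_sigma_subadditive _ mneg mZ (@subset_refl _ _)) _.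
  by rewrite eseries0// => i _ _; exact: X_ge0.
have sub : [set w | O (\sum_(i < M w) X i w)%E] `<=` (\bigcup_n G n) `|` Z.
  move=> w /= OS; have [|nZ] := pselect (Z w); [by right|left].
  have X0 i : (0 <= X i w)%E by rewrite leNgt; apply/negP => h; apply: nZ; exists i.
  pose q L i : mark_cell_index L := projT1 (cid (mark_cell_cover L (X0 i))).
  have qP L i : mark_cell (q L i) (X i w) by exact: (projT2 (cid (mark_cell_cover L (X0 i)))).
  set k := M w in OS.
  pose word L : k.-tuple (mark_cell_index L) := [tuple q L i | i < k].
  have sumE L (f : mark_cell_index L -> \bar R) : (forall q, 0 <= f q)%E ->
      (\sum_q (count_mem q (word L))%:R%:E * f q = \sum_(i < k) f (q L i))%E.
    move=> f0; rewrite sum_count_mem_mul// big_tuple.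
    by apply: eq_bigr => i _; rewrite tnth_mktuple.
  pose S_ := (\sum_(i < k) X i w)%E.
  have cvg_lo : \sum_(i < k) (cell_lower (q L i))%E @[L --> \oo] --> S_.
    apply: cvg_nnesum => i _; first by apply: nearW => L; exact: cell_lower_ge0.
    by have [] := @cvg_cell_bounds R (X i w) (fun L => q L i) (fun L => qP L i).
  have cvg_up : \sum_(i < k) (cell_upper (q L i))%E @[L --> \oo] --> S_.
    apply: cvg_nnesum => i _; first by apply: nearW => L; exact: cell_upper_ge0.
    by have [] := @cvg_cell_bounds R (X i w) (fun L => q L i) (fun L => qP L i).
  (* [y L] is a witness against [good], if there is one. *)
  have ex_y L : exists y, (\sum_(i < k) cell_lower (q L i) <= y <=
      \sum_(i < k) cell_upper (q L i))%E /\ (O y -> good O (word L)).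
    have [g|/asboolPn] := boolP (good O (word L)).
      exists S_; split=> //; apply/andP; split; apply: lee_sum => i _;
      by have /andP[] := mark_cell_bounds (qP L i).
    rewrite /sums_within => /existsNP[y /not_implyP[]].
    rewrite (sumE _ _ (@cell_lower_ge0 R L)) (sumE _ _ (@cell_upper_ge0 R L)).
    by move=> yb nOy; exists y; split=> // /nOy.
  have [y yP] := choice ex_y.
  have cvg_y : y L @[L --> \oo] --> S_.
    apply: squeeze_cvge cvg_lo cvg_up.
    by apply: nearW => L; have [] := yP L.
  have nO : \forall L \near \oo, O (y L).
    by apply: cvg_y; apply: open_nbhs_nbhs.
  have [n _ nP] : \forall L \near \oo, O (y L) /\ (k < L)%N.
    by near=> L; split; near: L => //; exact: nbhs_infty_gt.
  exists n => // L /= nL; have [OyL kL] := nP L nL.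
  rewrite /level_event -bigcup_seq; exists (Ordinal kL) => /=; first by rewrite mem_index_enum.
  rewrite -bigcup_seq_cond; exists (word L) => /=.
    by rewrite mem_index_enum; exact: (yP L).2.
  split=> // i ik; rewrite (_ : nth _ _ _ = q L i); first exact: qP.
  by rewrite -[i]/(val (Ordinal ik)) -tnth_nth tnth_mktuple.
apply: (@le_trans _ _ (P2 (\bigcup_n G n `|` Z))).
  apply: le_measure; rewrite ?inE//; last exact: measurableU.
  rewrite -[X in measurable X]setTI.
  exact: (measurable_stopped_sum mM mX measurableT (open_emeasurable oO)).
apply: le_trans (measureU2 _ _ _) _ => //.
by rewrite [X in (_ + X)%E]Z0 adde0.
Unshelve. all: by end_near.
Qed.

End poisson_stopped_sum.

(** * Passing to the limit *)

Section liminf_events.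
Context {R : realType} d (Omega : measurableType d) (P : probability Omega R).
Context d' (Omega' : measurableType d') (P' : probability Omega' R).
Context (W : topologicalType) (V : set W).
Variables (X : R -> Omega -> W) (X' : Omega' -> W) (bad : R -> set Omega).
Hypothesis cvgX : cvg_in_distribution P P' V X X'.
Hypothesis mbad : forall e : R, 0 < e -> measurable (bad e).
Hypothesis bad0 : P (bad e) @[e --> 0^'+] --> 0%E.

(** The portmanteau inequality survives on events that contain a cozero event
    up to an exceptional set of vanishing probability. *)
Lemma liminf_event (O : set W) (A : R -> set Omega) (c : R) :
  cozero R V O -> (forall e : R, 0 < e -> measurable (A e)) ->
  (forall e x, 0 < e -> ~ bad e x -> O (X e x) -> A e x) ->
  (c%:E < P' (X' @^-1` O))%E -> \forall e \near 0^'+, (c%:E < P (A e))%E.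
Proof.
move=> cO mA XA cP; have [rX rX' _] := cvgX.
have mO' := cozero_measurable rX' cO.
set b := fine (P' (X' @^-1` O)).
have Pb : P' (X' @^-1` O) = b%:E by rewrite fineK// fin_num_measure.
pose eta := (b - c) / 2.
have eta0 : 0 < eta by rewrite divr_gt0// subr_gt0 -lte_fin -Pb.
have c'P : ((c + eta)%:E < P' (X' @^-1` O))%E.
  by rewrite Pb lte_fin /eta; rewrite Pb lte_fin in cP; lra.
have near1 := portmanteau_cozero cvgX cO c'P.
have near2 : \forall e \near 0^'+, (P (bad e) < eta%:E)%E.
  apply: (@bad0 [set y | (y < eta%:E)%E]).
  by apply: open_nbhs_nbhs; split; [exact: open_ereal_lt_ereal|rewrite /= lte_fin].
near=> e; have e0 : 0 < e by near: e; exact: nbhs_right_gt.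
have h1 : ((c + eta)%:E < P (X e @^-1` O))%E by near: e.
have h2 : (P (bad e) < eta%:E)%E by near: e.
have mO := cozero_measurable (rX e e0) cO.
have : (P (X e @^-1` O) <= P (A e) + P (bad e))%E.
  apply: le_trans (measureU2 _ (mA e e0) (mbad e0)); apply: le_measure.
  - by rewrite inE.
  - by rewrite inE; apply: measurableU; [exact: mA|exact: mbad].
  by move=> x Ox; have [?|nb] := pselect (bad e x); [right|left; exact: XA].
have [u uE] : exists u, P (A e) = u%:E.
  by exists (fine (P (A e))); rewrite fineK// fin_num_measure//; exact: mA.
have [v vE] : exists v, P (bad e) = v%:E.
  by exists (fine (P (bad e))); rewrite fineK// fin_num_measure//; exact: mbad.
rewrite uE; rewrite vE lte_fin in h2.
by rewrite vE -EFinD => /(lt_le_trans h1); rewrite !lte_fin; lra.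
Unshelve. all: by end_near.
Qed.

End liminf_events.

Section stopped_sum_limit.
Context {R : realType} dT (T : topMeasurableType dT) (S : set T).
Variables (tm : T -> R) (lb : T -> bool) (mk : T -> \bar R).
Hypothesis HS : marked_space S tm lb mk.
Context d (Omega : measurableType d) (P : probability Omega R).
Context d' (Omega' : measurableType d') (P' : probability Omega' R).
Variables (eta : set T -> \bar R) (N : Omega' -> vague_measure R S).
Hypothesis PN : poisson_point_process P' eta N.
Variables (p : R) (m : bool -> probability (\bar R) R).
Hypothesis p01 : 0 < p < 1.
Hypothesis intensity : forall (a b : R) (j : bool) (D : set (\bar R)),
  0 <= a <= b -> measurable D ->
  eta (block S tm lb mk a b j D) =
    (((b - a) * (if j then p else 1 - p))%:E * m j D)%E.
Hypothesis m_ge0 : m true [set y | (0 <= y)%E] = 1%E.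
Context d2 (Omega2 : measurableType d2) (P2 : probability Omega2 R).
Variables (M : Omega2 -> nat) (X : nat -> Omega2 -> \bar R).
Hypothesis mM : measurable_fun setT M.
Hypothesis mX : forall i, measurable_fun setT (X i).
Hypothesis X_ge0 : forall i, P2 [set w | (X i w < 0)%E] = 0%E.
Hypothesis law : forall k (D : nat -> set (\bar R)), (forall i, measurable (D i)) ->
  P2 [set w | M w = k /\ forall i, (i < k)%N -> D i (X i w)] =
  ((p ^+ k * (1 - p))%:E * \prod_(i < k) m true (D i))%E.
Variables (L : R -> Omega -> vague_measure R S) (bad : R -> set Omega).
Hypothesis cvgL : cvg_in_distribution P P' (point_measures R S) L N.
Hypothesis mbad : forall e : R, 0 < e -> measurable (bad e).
Hypothesis bad0 : P (bad e) @[e --> 0^'+] --> 0%E.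

(** By [portmanteau_open] a lower bound on open sets is enough, and it goes
    through the stopped sum event: from the compound geometric law to the
    Poisson process, then to its approximations. *)
Lemma cvg_stopped_sum (Z : R -> Omega -> \bar R) :
  (forall e : R, 0 < e -> measurable_fun setT (Z e)) ->
  (forall e x O, 0 < e -> ~ bad e x ->
     stopped_sum_event tm lb mk O (L e x) -> O (Z e x)) ->
  cvg_in_distribution P P2 [set: \bar R] Z (fun w => (\sum_(i < M w) X i w)%E).
Proof.
move=> mZ LZ; apply: portmanteau_open.
- by move=> e e0; exact: measurable_random_element (mZ e e0).
- by apply: measurable_random_element; exact: measurable_stopped_sum.
move=> O c oO cO.
apply: (liminf_event cvgL mbad bad0 (cozero_stopped_sum HS oO)).
- move=> e e0; rewrite -[X in measurable X]setTI.
  by apply: mZ => //; exact: open_emeasurable.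
- by move=> e x e0 nb; exact: LZ.
apply: lt_le_trans cO _.
exact: (stopped_sum_poisson_ge HS PN p01 intensity m_ge0 mM mX X_ge0 law).
Qed.

(** When all marks are 1, the stopped sum is the number of points labelled
    [true] before the first point labelled [false], so that the event that
    there is none has limit probability [1 - p]. *)
Lemma cvg_no_success (A : R -> set Omega) :
  (forall i, X i = cst 1%E) -> geometric_variable P2 p M ->
  (forall e : R, 0 < e -> measurable (A e)) ->
  (forall e x q s k O, 0 < e -> ~ bad e x -> q < s ->
     stopped_sum_at tm lb mk k O q s (L e x) -> O k%:R%:E /\ (A e x <-> k = 0%N)) ->
  P (A e) @[e --> 0^'+] --> (1 - p)%:E.
Proof.
move=> X1 geomM mA LA.
have sumX w : (\sum_(i < M w) X i w)%E = (M w)%:R%:E.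
  under eq_bigr do rewrite X1.
  by rewrite sumEFin sumr_const card_ord.
have half n : (n%:R < 2^-1 :> R) = (n == 0%N).
  case: n => [|n]; first by rewrite invr_gt0 ltr0n.
  by apply/negbTE; rewrite -leNgt (le_trans (y := 1))// ?invf_le1 ?ler1n ?ler1Sn.
have m0 : measurable (M @^-1` [set 0%N]).
  by rewrite -[X in measurable X]setTI; exact: mM.
have P0 : P2 (M @^-1` [set 0%N]) = (1 - p)%:E by rewrite geomM expr0 mul1r.
have lower (O : set (\bar R)) : open O ->
  (P2 [set w | O (M w)%:R%:E] <= P' (N @^-1` stopped_sum_event tm lb mk O))%E.
  move=> oO; rewrite (_ : [set w | _] = [set w | O (\sum_(i < M w) X i w)%E]).
    exact: (stopped_sum_poisson_ge HS PN p01 intensity m_ge0 mM mX X_ge0 law).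
  by apply/seteqP; split=> w /=; rewrite sumX.
apply: cvg_probability_two_sided => // a ha.
- pose O : set (\bar R) := [set y | (y < (2^-1)%:E)%E].
  have oO : open O by exact: open_ereal_lt_ereal.
  apply: (liminf_event cvgL mbad bad0 (cozero_stopped_sum HS oO)) => //.
    move=> e x e0 nb [q [s [k [qs LE]]]]; have [Ok Ak] := LA _ _ _ _ _ _ e0 nb qs LE.
    by apply/Ak/eqP; rewrite -half -lte_fin.
  apply: lt_le_trans (lower _ oO); rewrite (_ : [set w | _] = M @^-1` [set 0%N]).
    by rewrite P0 lte_fin.
  by apply/seteqP; split=> w; rewrite /O /= lte_fin half => /eqP.
- pose O : set (\bar R) := [set y | ((2^-1)%:E < y)%E].
  have oO : open O by exact: open_ereal_gt_ereal.
  have half' n : (2^-1 < n%:R :> R) = (n != 0%N).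
    case: n => [|n]; first by rewrite ltNge invr_ge0 ler0n.
    by rewrite (lt_le_trans (y := 1))// ?invf_lt1 ?ltr1n ?ler1n.
  apply: (liminf_event cvgL mbad bad0 (cozero_stopped_sum HS oO)) => //.
  + by move=> e e0; exact/measurableC/mA.
  + move=> e x e0 nb [q [s [k [qs LE]]]]; have [Ok Ak] := LA _ _ _ _ _ _ e0 nb qs LE.
    by move=> /Ak/eqP; apply/negP; rewrite -half' -lte_fin.
  apply: lt_le_trans (lower _ oO); rewrite (_ : [set w | _] = ~` (M @^-1` [set 0%N])).
    by rewrite probability_setC// P0 -EFinB lte_fin.
  by apply/seteqP; split=> w; rewrite /O /= lte_fin half' => /eqP.
Qed.

End stopped_sum_limit.

(** * Entrances and stopped sums *)

Section entrances.
Context {R : realType} dT (T : topMeasurableType dT) (S : set T).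
Variables (tm : T -> R) (lb : T -> bool) (mk : T -> \bar R).
Hypothesis HS : marked_space S tm lb mk.
Context (C : choiceType).
Variables (I : set C) (t : C -> R) (l : C -> bool) (z : C -> T) (h : R).
Hypothesis h0 : 0 < h.
Hypothesis zS : forall i, I i -> S (z i).
Hypothesis tmz : forall i, I i -> tm (z i) = t i * h.
Hypothesis lbz : forall i, I i -> lb (z i) = l i.

Local Notation before := (points_before S tm lb).

Definition first_entrance (j : bool) : \bar R :=
  ereal_inf [set (t i)%:E | i in [set i | I i /\ l i = j]].

Definition entrances_before_stop : set C :=
  [set i | [/\ I i, l i = true & ((t i)%:E < first_entrance false)%E]].

Local Notation ent q j := [set i | [/\ I i, l i = j & t i * h < q]].

Lemma before_entrances q j : (dirac_sum R I z) (before q j) = counting (ent q j).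
Proof.
rewrite dirac_sum_counting; congr counting; apply/seteqP; split=> i /=.
  by move=> [Ii [_ + +]]; rewrite tmz// lbz// => tq li.
by move=> [Ii li tq]; split=> //; split; rewrite ?tmz ?lbz//; exact: zS.
Qed.

Lemma counting_natP (A : set C) (k : nat) : counting A = k%:R%:E :> \bar R ->
  finite_set A /\ #|` fset_set A| = k.
Proof.
rewrite /counting; case: asboolP => // fA /eqP.
by rewrite eqe eqr_nat => /eqP.
Qed.

Lemma counting_eq0 (A : set C) : counting A = 0%E :> \bar R -> A = set0.
Proof.
move=> /(@counting_natP _ 0%N)[fA] /eqP; rewrite cardfs_eq0 => /eqP A0.
by rewrite -(fset_setK fA) A0; apply/seteqP; split=> x.
Qed.

Lemma counting_gt0 (A : set C) : (0 < counting A :> \bar R)%E -> A !=set0.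
Proof.
move=> A0; apply/set0P/eqP => AE; move: A0.
by rewrite AE /counting asboolT// fset_set0 ltxx.
Qed.

Lemma counting_set0 : counting (set0 : set C) = 0 :> \bar R.
Proof. by rewrite /counting asboolT// fset_set0. Qed.

Lemma counting_gt0P (A : set C) : A !=set0 -> (0 < counting A :> \bar R)%E.
Proof.
move=> [x Ax]; rewrite /counting; case: asboolP => // fA.
rewrite lte_fin ltr0n cardfs_gt0; apply/fset0Pn; exists x.
by rewrite in_fset_set// inE.
Qed.

Lemma le_first_entrance (j : bool) (a : R) :
  (forall i, I i -> l i = j -> a <= t i) -> (a%:E <= first_entrance j)%E.
Proof.
by move=> H; apply: le_ereal_inf_tmp => _ [i [Ii li] <-]; rewrite lee_fin H.
Qed.

Lemma first_entrance_le (j : bool) i : I i -> l i = j -> (first_entrance j <= (t i)%:E)%E.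
Proof. by move=> Ii li; apply: ereal_inf_lbound; exists i. Qed.

Lemma no_entrance_before q j : ent q j = set0 -> ((q / h)%:E <= first_entrance j)%E.
Proof.
move=> q0; apply: le_first_entrance => i Ii li; rewrite ler_pdivrMr// leNgt.
by apply/negP => tq; have : set0 i by rewrite -q0.
Qed.

(** The first entrance labelled [false] occurs, after rescaling, between [q] and
    [s], and no entrance labelled [true] does: those that precede it are exactly
    those counted before [q]. *)
Lemma stopped_entrances k (O : set (\bar R)) q s : q < s ->
  stopped_sum_at tm lb mk k O q s (dirac_sum R I z : vague_measure R S) ->
  [/\ finite_set entrances_before_stop, #|` fset_set entrances_before_stop| = k,
      (k = 0%N -> (first_entrance false < first_entrance true)%E),
      ((0 < k)%N -> (first_entrance true < first_entrance false)%E) &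
      O (\sum_(i <- fset_set entrances_before_stop) mk (z i))%E].
Proof.
move=> qs [N0 Ns Nq1 Ns1 Oint].
have NE q' j : ((dirac_sum R I z : vague_measure R S) : measure T R) (before q' j) =
   counting (ent q' j) by exact: before_entrances.
rewrite !NE in N0 Ns Nq1 Ns1.
have e0 := counting_eq0 N0; have [i0 [Ii0 li0 ti0]] := counting_gt0 Ns.
have [fq cq] := counting_natP Nq1; have [fs cs] := counting_natP Ns1.
have sub : ent q true `<=` ent s true by move=> i [? ? tq]; split=> //; exact: lt_trans qs.
have qsE : ent q true = ent s true.
  apply/seteqP; split=> // i si.
  have : fset_set (ent q true) = fset_set (ent s true).
    apply/eqP; rewrite eqEfcard cs -cq leqnn andbT.
    by apply/fsubsetP => x; rewrite !in_fset_set// !inE; exact: sub.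
  move=> /fsetP/(_ i); rewrite !in_fset_set//.
  by rewrite (mem_set si) => /set_mem.
have tau_q := no_entrance_before e0.
have tau_s : (first_entrance false < (s / h)%:E)%E.
  apply: le_lt_trans (first_entrance_le Ii0 li0) _.
  by rewrite lte_fin ltr_pdivlMr.
have JE : entrances_before_stop = ent q true.
  apply/seteqP; split=> i /=; last first.
    move=> [Ii li tq]; split=> //; apply: lt_le_trans tau_q.
    by rewrite lte_fin ltr_pdivlMr.
  move=> [Ii li ti]; have : ent s true i.
    by split=> //; rewrite -ltr_pdivlMr// -lte_fin (lt_trans ti).
  by rewrite -qsE.
rewrite JE; split=> //.
- move=> k0; rewrite k0 in Ns1; apply: lt_le_trans tau_s _.
  by apply: no_entrance_before; exact: counting_eq0.
- move=> k_gt0; have [i [Ii li ti]] : ent q true !=set0.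
    by apply: counting_gt0; rewrite Nq1 lte_fin ltr0n.
  apply: lt_le_trans tau_q; apply: le_lt_trans (first_entrance_le Ii li) _.
  by rewrite lte_fin ltr_pdivlMr.
have mb := measurable_points_before HS q true.
have bE : I `&` z @^-1` before q true = ent q true.
  apply/seteqP; split=> i /=.
    by move=> [Ii [_ + +]]; rewrite tmz// lbz// => tq li.
  by move=> [Ii li tq]; split=> //; split; rewrite ?tmz ?lbz//; exact: zS.
move: Oint; rewrite [X in O X](_ : _ = \int[dirac_sum R I z]_(u in before q true) mk u)%E//.
rewrite (integral_dirac_sum mb)//; rewrite ?bE//.
- by apply: measurable_funTS; exact: (measurable_mark HS).
- by move=> u [Su _ _]; exact: (mark_ge0 HS).
Qed.

Lemma counting_le (A B : set C) : A `<=` B -> (counting A <= counting B :> \bar R)%E.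
Proof.
move=> AB; rewrite /counting.
case: asboolP => [fA|iA]; case: asboolP => [fB|iB]; rewrite ?leey//.
  rewrite lee_fin ler_nat; apply: fsubset_leq_card; apply/fsubsetP => i.
  by rewrite !in_fset_set// !inE; exact: AB.
by exfalso; apply: iA; exact: sub_finite_set fB.
Qed.

Let ratr_between (a b : R) : a < b -> exists q : rat, a < ratr q < b.
Proof. by move=> /rat_in_itvoo[q]; rewrite in_itv/=; exists q. Qed.

(** This equivalence and the next two express comparisons of entrance times by
    counts at rational times, which makes them measurable. *)
Lemma lt_first_entranceP (j : bool) (a : R) :
  (a%:E < first_entrance j)%E <->
  exists q : rat, a * h < ratr q /\ (dirac_sum R I z) (before (ratr q) j) = 0.
Proof.
split=> [a_lt|[q [aq q0]]]; last first.
  rewrite before_entrances in q0; apply: lt_le_trans (no_entrance_before (counting_eq0 q0)).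
  by rewrite lte_fin ltr_pdivlMr.
have [b ab bt] : exists2 b : R, a < b & (b%:E <= first_entrance j)%E.
  move: a_lt; case: (first_entrance j) => [r|_|//].
    by rewrite lte_fin => ar; exists r.
  by exists (a + 1); rewrite ?ltrDl// leey.
have [q /andP[aq qb]] : exists q : rat, a * h < ratr q < b * h.
  by apply: ratr_between; rewrite ltr_pM2r.
exists q; split=> //; rewrite before_entrances.
rewrite (_ : [set i | _] = set0) ?counting_set0//; apply/seteqP; split=> // i [Ii li tq].
have : (b%:E <= (t i)%:E)%E by apply: le_trans bt _; exact: first_entrance_le.
rewrite lee_fin leNgt => /negP; apply.
by rewrite -(ltr_pM2r h0) (lt_trans tq).
Qed.

Lemma first_entrance_ltP :
  (first_entrance false < first_entrance true)%E <->
  exists q : rat, (0 < (dirac_sum R I z) (before (ratr q) false))%E /\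
                  (dirac_sum R I z) (before (ratr q) true) = 0.
Proof.
split=> [lt01|[q [q0 q1]]].
  have [_ [i [Ii li] <-] ti] := ereal_inf_lt lt01.
  have [q [tq q0]] := (lt_first_entranceP true (t i)).1 ti.
  exists q; split=> //; rewrite before_entrances; apply: counting_gt0P.
  by exists i; split.
rewrite before_entrances in q0; rewrite before_entrances in q1.
have [i [Ii li ti]] := counting_gt0 q0.
apply: le_lt_trans (first_entrance_le Ii li) _.
apply: lt_le_trans (no_entrance_before (counting_eq0 q1)).
by rewrite lte_fin ltr_pdivlMr.
Qed.

Lemma count_before_stopP (y : R) :
  (y%:E < counting entrances_before_stop)%E <->
  exists q : rat, (dirac_sum R I z) (before (ratr q) false) = 0 /\
                  (y%:E < (dirac_sum R I z) (before (ratr q) true))%E.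
Proof.
split=> [y_lt|[q [q0 q1]]]; last first.
  rewrite before_entrances in q0; rewrite before_entrances in q1.
  apply: lt_le_trans q1 _; apply: counting_le => i [Ii li ti]; split=> //.
  apply: lt_le_trans (no_entrance_before (counting_eq0 q0)).
  by rewrite lte_fin ltr_pdivlMr.
have [A [fA AJ yA]] : exists A : set C,
    [/\ finite_set A, A `<=` entrances_before_stop & (y%:E < counting A)%E].
  move: y_lt; rewrite {1}/counting; case: asboolP => [fJ|iJ].
    by exists entrances_before_stop; split=> //; rewrite /counting asboolT.
  move=> _; have [n yn] : exists n : nat, y < n%:R.
    by exists (Num.truncn y).+1; exact: truncnS_gt.
  have [B BJ nB] := infinite_set_fset n iJ.
  exists [set` B]; split=> //; rewrite /counting asboolT//= set_fsetK lte_fin.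
  by rewrite (lt_le_trans yn)// ler_nat.
have bound (r : seq C) : (forall i, i \in r -> entrances_before_stop i) ->
    exists2 q : rat, (dirac_sum R I z) (before (ratr q) false) = 0 &
      forall i, i \in r -> t i * h < ratr q.
  elim: r => [_|i r IH rJ].
    exists 0; last by move=> i; rewrite in_nil.
    rewrite (_ : before _ _ = set0) ?measure0//; apply/seteqP; split=> // u [Su].
    by rewrite raddf0 ltNge => /negP + _; apply; exact: (time_ge0 HS).
  have [|q' q'0 q'r] := IH.
    by move=> x xr; apply: rJ; rewrite in_cons xr orbT.
  have [_ _ /lt_first_entranceP[q [tq q0]]] := rJ i (mem_head _ _).
  have [qq'|q'q] := leP (ratr q : R) (ratr q').
    exists q' => // x; rewrite in_cons => /predU1P[->|]; last exact: q'r.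
    exact: lt_le_trans qq'.
  exists q => // x; rewrite in_cons => /predU1P[->//|/q'r xq].
  exact: lt_trans q'q.
have [|q q0 Aq] := bound (fset_set A).
  by move=> i; rewrite in_fset_set// inE; exact: AJ.
exists q; split=> //; apply: lt_le_trans yA _; rewrite before_entrances; apply: counting_le => i Ai.
have [Ii li _] := AJ i Ai; split=> //.
by apply: Aq; rewrite in_fset_set// inE.
Qed.

End entrances.

(** * The two state spaces and their intensities *)

Section carriers.
Context {R : realType}.

(** The contraction that defines the topology of the extended reals identifies
    the half-line with a segment. *)
Lemma compact_ge0e : compact [set y : \bar R | (0 <= y)%E].
Proof.
have -> : [set y : \bar R | (0 <= y)%E] = (@expand R) @` `[0, 1]%classic.
  apply/seteqP; split=> [y y0|_ [r r01 <-]].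
    exists (contract y); last exact: contractK.
    rewrite /= in_itv/=; apply/andP; split.
      by rewrite -(contract0 R) le_contract.
    by have := contract_le1 y; rewrite ler_norml => /andP[].
  rewrite /= in_itv/= in r01; have /andP[r0 r1] := r01.
  have := @le_expand_in R 0 r; rewrite /= expand0 => -> //.
    by rewrite inE normr0.
  by rewrite inE ger0_norm.
apply: continuous_compact; last exact: segment_compact.
apply/subspace_continuousP => r; rewrite /= in_itv/= => /andP[r0 r1].
apply/cvg_ballP => e e0; rewrite near_withinE; near=> s => /=.
rewrite in_itv/= => /andP[s0 s1].
rewrite /ball/= /ereal_ball !expandK ?inE ?(ger0_norm r0) ?(ger0_norm s0)//.
Unshelve. all: by end_near.
Qed.

(** All marks are 1, so that stopped sums are counts. *)
Lemma unmarked_space :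
  marked_space (time_type R) (fst : R * bool -> R) snd (fun=> 1%E).
Proof.
have mS : measurable [set u : R * bool | 0 <= u.1].
  rewrite (_ : [set u | _] = [set t : R | 0 <= t] `*` setT).
    apply: measurableX => //; rewrite -[X in measurable X]setTI.
    exact: (measurable_fun_ler (f := cst 0) (g := id)).
  by apply/seteqP; split=> u //= [].
split=> //.
- by move=> u; exact: cvg_fst.
- by move=> u; exact: cvg_snd.
- by move=> u; exact: cvg_cst.
- move=> q; rewrite (_ : [set u | _] = `[0, q]%classic `*` [set: bool]).
    by apply: compact_setX; [exact: segment_compact|exact: bool_compact].
  apply/seteqP; split=> u /=; rewrite /time_type /= in_itv/=.
    by move=> [-> ->].
  by move=> [/andP[]].
Qed.

Lemma marked_time_space :
  marked_space (time_type_mark R) (fst : R * (bool * \bar R) -> R)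
    (fun u => u.2.1) (fun u => u.2.2).
Proof.
split=> //.
- rewrite (_ : time_type_mark R = [set t : R | 0 <= t] `*`
    (setT `*` [set y : \bar R | (0 <= y)%E])).
    apply: measurableX; last apply: measurableX => //; rewrite -[X in measurable X]setTI.
      exact: (measurable_fun_ler (f := cst 0) (g := id)).
    exact: emeasurable_fun_c_infty.
  by apply/seteqP; split=> u [] //= ? []; split.
- exact: (measurableT_comp measurable_fst measurable_snd).
- exact: (measurableT_comp measurable_snd measurable_snd).
- by move=> u; exact: cvg_fst.
- by move=> u; apply: (cvg_comp _ _ cvg_snd); exact: cvg_fst.
- by move=> u; apply: (cvg_comp _ _ cvg_snd); exact: cvg_snd.
- by move=> u [].
- by move=> u [].
- move=> q; rewrite (_ : [set u | _] = `[0, q]%classic `*` ([set: bool] `*`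
    [set y : \bar R | (0 <= y)%E])).
    apply: compact_setX; first exact: segment_compact.
    by apply: compact_setX; [exact: bool_compact|exact: compact_ge0e].
  apply/seteqP; split=> u /=; rewrite /time_type_mark /= in_itv/=.
    by move=> [[-> ?] ->].
  by move=> [/andP[? ?] [_ ?]].
Qed.

(** The second factor is a bare set function, as in the intensities. *)
Lemma product_rectangle d1 d2 (T1 : measurableType d1) (T2 : measurableType d2)
    (m1 : {measure set T1 -> \bar R}) (m2 : set T2 -> \bar R) A1 A2 :
  measurable A1 -> m2 set0 = 0%E ->
  ((m1 \x m2) (A1 `*` A2) = m2 A2 * m1 A1)%E.
Proof.
move=> mA1 m20; rewrite /product_measure1 -integral_cst//.
rewrite [RHS]integral_mkcond; apply: eq_integral => x _ /=.
rewrite patchE; case: ifPn => xA1; first by rewrite in_xsectionX.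
by rewrite notin_xsectionX.
Qed.

Lemma halfline_lebesgue_itv (a b : R) : 0 <= a <= b ->
  halfline_lebesgue `[a, b[%classic = (b - a)%:E.
Proof.
move=> /andP[a0 ab]; rewrite /halfline_lebesgue /mrestr.
rewrite (_ : _ `&` _ = `[a, b[%classic).
  rewrite lebesgue_measure_itv/= lte_fin; have [_|ba] := ltP a b; first by rewrite EFinB.
  by rewrite (@le_anti _ _ a b) ?ab// subrr.
apply/seteqP; split=> x /=; rewrite !in_itv/=; first by case.
by move=> /andP[ax xb]; rewrite ax xb andbT (le_trans a0).
Qed.

Let halfline0 : (@halfline_lebesgue R) set0 = 0%E.
Proof. exact: (@measure0 _ _ _ (mrestr (@lebesgue_measure R) _)). Qed.

Let halfline_ge0 A : (0 <= (@halfline_lebesgue R) A)%E.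
Proof. exact: (@measure_ge0 _ _ _ (mrestr (@lebesgue_measure R) _)). Qed.

Let halfline_additive : semi_sigma_additive (@halfline_lebesgue R).
Proof.
exact: (@measure_semi_sigma_additive _ _ _ (mrestr (@lebesgue_measure R) _)).
Qed.

HB.instance Definition _ := isMeasure.Build _ _ _ (@halfline_lebesgue R)
  halfline0 halfline_ge0 halfline_additive.

Lemma halfline_rectangle d2 (T2 : measurableType d2) (m2 : set T2 -> \bar R) A2
    (a b : R) : 0 <= a <= b -> m2 set0 = 0%E ->
  ((halfline_lebesgue \x m2) (`[a, b[%classic `*` A2) = m2 A2 * (b - a)%:E)%E.
Proof.
move=> ab m20; rewrite -(halfline_lebesgue_itv ab).
by apply: product_rectangle => //; exact: measurable_itv.
Qed.

Lemma unmarked_intensity (p a b : R) (j : bool) (D : set (\bar R)) :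
  0 < p < 1 -> 0 <= a <= b -> measurable D ->
  ((halfline_lebesgue \x bernoulli_prob p)
     (block (time_type R) fst snd (fun=> 1) a b j D) =
   ((b - a) * (if j then p else 1 - p))%:E * \d_1 D)%E.
Proof.
move=> /andP[p0 p1] ab mD; have /andP[a0 _] := ab.
rewrite (_ : block _ _ _ _ _ _ _ _ = `[a, b[%classic `*`
   [set l | l = j /\ D 1%E]); last first.
  apply/seteqP; split=> u /=; rewrite /time_type in_itv/=.
    by move=> [_ -> -> -> ?].
  by move=> [/andP[au ub] [uj D1]]; split=> //=; exact: le_trans au.
have p01 : 0 <= p <= 1 by rewrite !ltW.
have b0 : bernoulli_prob p set0 = 0%E by exact: (@measure0 _ _ _ (bernoulli_prob p)).
rewrite halfline_rectangle// diracE.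
have [D1|D1] := pselect (D 1%E).
  rewrite (mem_set D1) mule1 (_ : [set l | _] = [set j]); last first.
    by apply/seteqP; split=> l //= [].
  rewrite bernoulli_probE// !diracE muleC; case: j => /=.
    by rewrite mem_set// memNset// mule1 mule0 adde0 EFinM.
  by rewrite memNset// mem_set// mule1 mule0 add0e EFinM.
rewrite (memNset D1) mule0 (_ : [set l | _] = set0) ?b0 ?mul0e//.
by apply/seteqP; split=> l // [].
Qed.

(** The state space keeps only nonnegative marks, and these carry the whole mass
    of [m j]. *)
Lemma marked_intensity_block (p a b : R) (j : bool) (D : set (\bar R))
    (m : bool -> probability (\bar R) R) :
  (forall j, m j [set y | (0 <= y)%E] = 1%E) ->
  0 <= a <= b -> measurable D ->
  (marked_intensity p m
     (block (time_type_mark R) fst (fun u => u.2.1) (fun u => u.2.2) a b j D) =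
   ((b - a) * (if j then p else 1 - p))%:E * m j D)%E.
Proof.
move=> m0 ab mD; have /andP[a0 _] := ab.
have mge0 : measurable [set y : \bar R | (0 <= y)%E].
  by rewrite -[X in measurable X]setTI; exact: emeasurable_fun_c_infty.
rewrite (_ : block _ _ _ _ _ _ _ _ = `[a, b[%classic `*`
   ([set j] `*` (D `&` [set y | (0 <= y)%E]))); last first.
  apply/seteqP; split=> u /=; rewrite /time_type_mark /= in_itv/=.
    by move=> [[_ ?] -> -> -> ?].
  by move=> [/andP[au ub] [uj [Du u0]]]; split=> //=; split=> //; exact: le_trans au.
have E l : (\d_l \x m l)%E ([set j] `*` (D `&` [set y | (0 <= y)%E])) =
    ((l == j)%:R%:E * m j D)%E.
  have mDD : measurable (D `&` [set y | (0 <= y)%E]) by exact: measurableI.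
  rewrite product_rectangle//.
  rewrite [X in (_ * X)%E]diracE muleC; case: eqP => [->|lj]; last by rewrite memNset// !mul0e.
  rewrite mem_set// !mul1e; apply/eqP; rewrite eq_le; apply/andP; split.
    by apply: le_measure; rewrite ?inE//; exact: subIsetl.
  have nul : m j (~` [set y | (0 <= y)%E]) = 0.
    by rewrite probability_setC// m0 subee.
  apply: (@le_trans _ _ (m j ((D `&` [set y | (0 <= y)%E]) `|` ~` [set y | (0 <= y)%E]))).
    apply: le_measure; rewrite ?inE//.
      by apply: measurableU => //; exact: measurableC.
    by move=> y Dy; have [?|?] := pselect (0 <= y)%E; [left|right].
  apply: le_trans (measureU2 _ _ _) _ => //; first exact: measurableC.
  by rewrite [X in (_ + X)%E]nul adde0.
rewrite /marked_intensity halfline_rectangle//; last first.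
  apply: big1 => l _; rewrite (_ : set0 = set0 `*` set0); last first.
    by rewrite set0X.
  by rewrite product_rectangle// (@measure0 _ _ _ (m l)) mul0e mule0.
rewrite (bigD1 j)//= big1 ?adde0 => [|l lj].
  by rewrite E eqxx mul1e muleC EFinM muleA.
by rewrite E (negbTE lj) mul0e mule0.
Qed.

End carriers.

(** * Visits of one orbit *)

Section visits.
Context {R : realType}.
Implicit Types (Z : set R) (s t u : R).

Definition starts Z : set R := [set t | Z t /\ lbound (connected_component Z t) t].

(** At [s = 0] this decides between two cases: the hitting time of [Z] is 0, or it
    is the first entrance into [Z]. *)
Definition visits_after Z s : Prop :=
  exists2 d, 0 < d & forall u, s < u < s + d -> Z u.

Definition hitting_time Z : \bar R := ereal_inf [set t%:E | t in [set t | 0 < t /\ Z t]].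

Lemma finite_set_min (A : set R) : finite_set A -> A !=set0 ->
  exists2 m, A m & forall x, A x -> m <= x.
Proof.
move=> fA A0.
suff min r : r != [::] -> exists2 m : R, m \in r & forall x, x \in r -> m <= x.
  have [|m] := min (fset_set A).
    have [x Ax] := A0; apply/eqP => rE.
    have : x \in (fset_set A : seq R) by rewrite in_fset_set// inE.
    by rewrite rE.
  rewrite in_fset_set// inE => Am mA; exists m => // x Ax.
  by apply: mA; rewrite in_fset_set// inE.
elim: r => // a [_ _|b r IH _]; first by exists a => [|x]; rewrite inE// => /eqP ->.
have [//|m mr mle] := IH; have [am|ma] := leP a m.
  exists a; first exact: mem_head.
  by move=> x; rewrite in_cons => /predU1P[->//|/mle]; exact: le_trans.
exists m; first by rewrite in_cons mr orbT.
by move=> x; rewrite in_cons => /predU1P[->|/mle//]; exact: ltW.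
Qed.

Lemma finite_set_gap (I : choiceType) (A : set I) (Q : I -> R -> Prop) :
  finite_set A -> (forall i, A i -> exists2 e, 0 < e & Q i e) ->
  (forall i e e', 0 < e' -> e' <= e -> Q i e -> Q i e') ->
  exists2 e, 0 < e & forall i, A i -> Q i e.
Proof.
move=> fA AQ Qle.
suff gap (r : seq I) : (forall i, i \in r -> A i) ->
    exists2 e, 0 < e & forall i, i \in r -> Q i e.
  have [i|e e0 Qe] := gap (fset_set A); first by rewrite in_fset_set// inE.
  by exists e => // i Ai; apply: Qe; rewrite in_fset_set// inE.
elim: r => [_|i r IH ir]; first by exists 1.
have [|e e0 Qe] := IH; first by move=> j jr; apply: ir; rewrite in_cons jr orbT.
have [e' e'0 Qe'] := AQ i (ir i (mem_head _ _)).
have m0 : 0 < Order.min e e' by rewrite lt_min e0.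
exists (Order.min e e') => // j; rewrite in_cons => /predU1P[->|/Qe].
  by apply: Qle Qe' => //; rewrite ge_min lexx orbT.
by apply: Qle => //; rewrite ge_min lexx.
Qed.

Variable Z : set R.
Hypothesis Z0 : forall t, Z t -> 0 <= t.
Hypothesis lfZ : locally_finite_left_closed Z.

Lemma component_itv t u : connected_component Z t u -> u <= t -> `[u, t]%classic `<=` Z.
Proof.
move=> Ztu ut s; rewrite /= in_itv/= => usv.
have : is_interval (connected_component Z t).
  by apply/connected_intervalP; exact: component_connected.
move=> /(_ u t Ztu _ s usv) H; apply: (@connected_component_sub _ Z t).
apply: H; apply: connected_component_refl; apply: contrapT => nZt.
by move: Ztu; rewrite connected_component_out// /mem/= inE.
Qed.

Lemma itv_component t u : u <= t -> `[u, t]%classic `<=` Z -> connected_component Z t u.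
Proof.
move=> ut utZ; have ivt : `[u, t]%classic t by rewrite /= in_itv/= ut lexx.
apply: (connected_component_max ivt utZ); last by rewrite /= in_itv/= lexx.
by apply/connected_intervalP; exact: interval_is_interval.
Qed.

Lemma starts_separated t t' : starts Z t' -> t < t' -> ~ `[t, t']%classic `<=` Z.
Proof.
move=> [_ lb] tt' /(itv_component (ltW tt')) /lb.
by rewrite leNgt tt'.
Qed.

(** Among the finitely many intervals met before [s], the leftmost left endpoint
    from which the visit lasts until [s] starts a connected component. *)
Lemma exists_start s : Z s -> exists t, [/\ t <= s, starts Z t & `[t, s]%classic `<=` Z].
Proof.
have [F [ZE FI Ffin]] := lfZ; move=> Zs.
pose E := [set t | [/\ t <= s, `[t, s]%classic `<=` Z &
  exists J, [/\ F J, J `&` `[0, s] !=set0, J t & lbound J t]]].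
have toE J u : F J -> J u -> u <= s -> `[u, s]%classic `<=` Z -> exists2 l, E l & l <= u.
  move=> FJ Ju us usZ; have [Jitv [l Jl lbJ]] := FI _ FJ.
  exists l; last exact: lbJ.
  split; first exact: le_trans (lbJ _ Ju) us.
    move=> v; rewrite /= in_itv/= => /andP[lv vs]; have [vu|uv] := leP v u.
      by rewrite ZE; exists J => //; apply: (Jitv l u) => //; rewrite lv.
    by apply: usZ; rewrite /= in_itv/= vs ltW.
  exists J; split=> //; exists u; split=> //; rewrite /= in_itv/= us andbT.
  by apply: Z0; rewrite ZE; exists J.
have ss : `[s, s]%classic `<=` Z.
  by move=> v; rewrite /= in_itv/= => /le_anti <-.
have E0 : E !=set0.
  have [J FJ Js] : (\bigcup_(J in F) J) s by rewrite -ZE.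
  by have [l El _] := toE _ _ FJ Js (lexx _) ss; exists l.
have fE : finite_set E.
  apply: (@sub_finite_set _ _ (inf @` [set J | F J /\ J `&` `[0, s] !=set0])).
    move=> t [_ _ [J [FJ Js Jt lbJ]]]; exists J => //=.
    apply/eqP; rewrite eq_le; apply/andP; split.
      by apply: ge_inf => //; exists t.
    by apply: lb_le_inf => //; exists t.
  exact: finite_image.
have [t Et tmin] := finite_set_min fE E0; have [ts tsZ _] := Et.
exists t; split=> //; split; first by apply: tsZ; rewrite /= in_itv/= lexx.
move=> u Cu; rewrite leNgt; apply/negP => ut.
have utZ := component_itv Cu (ltW ut).
have usZ : `[u, s]%classic `<=` Z.
  move=> v; rewrite /= in_itv/= => /andP[uv vs]; have [vt|tv] := leP v t.
    by apply: utZ; rewrite /= in_itv/= uv.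
  by apply: tsZ; rewrite /= in_itv/= vs ltW.
have [J FJ Ju] : (\bigcup_(J in F) J) u.
  by rewrite -ZE; apply: usZ; rewrite /= in_itv/= lexx (le_trans (ltW ut)).
have [l El lu] := toE _ _ FJ Ju (le_trans (ltW ut) ts) usZ.
by have := tmin _ El; rewrite leNgt (le_lt_trans lu).
Qed.

(** By local finiteness, the intervals that start after [s] do not accumulate
    at [s]. *)
Lemma visits_dichotomy s : visits_after Z s \/ visits_after (~` Z) s.
Proof.
have [F [ZE FI Ffin]] := lfZ.
have [[J [FJ Js [u Ju su]]]|noJ] := pselect (exists J, [/\ F J, J s & exists2 u, J u & s < u]).
  left; exists (u - s); rewrite ?subr_gt0// => v.
  rewrite addrCA subrr addr0 => /andP[sv vu]; rewrite ZE; exists J => //.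
  have [Jitv _] := FI _ FJ; apply: (Jitv s u) => //.
  by rewrite !ltW.
right.
have [||e e0 He] := @finite_set_gap _ [set J | F J /\ J `&` `[0, s + 1] !=set0]
    (fun J e => forall u, s < u < s + e -> ~ J u) (Ffin (s + 1)).
- move=> J [FJ _]; have [Jitv [l Jl lbJ]] := FI _ FJ; have [sl|ls] := ltP s l.
    exists (l - s); first by rewrite subr_gt0.
    move=> u; rewrite addrCA subrr addr0 => /andP[_ ul] /lbJ.
    by rewrite leNgt ul.
  exists 1 => // u /andP[su _] Ju; apply: noJ; exists J; split=> //; last by exists u.
  by apply: (Jitv l u) => //; rewrite ls ltW.
- move=> J e e' e'0 ee' H u /andP[su ue]; apply: H.
  by rewrite su (lt_le_trans ue)// lerD2l.
exists (Order.min e 1); first by rewrite lt_min e0 ltr01.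
move=> u /andP[su ue] Zu; have u0 := Z0 Zu.
move: Zu; rewrite ZE => -[J FJ Ju]; apply: (He J _ u) => //.
  split=> //; exists u; split=> //; rewrite /= in_itv/= u0 ltW//.
  by rewrite (lt_le_trans ue)// lerD2l ge_min lexx orbT.
by rewrite su (lt_le_trans ue)// lerD2l ge_min lexx.
Qed.

Lemma visits_after_mem s : visits_after Z s -> Z s.
Proof.
move=> [e e0 eZ]; have e2 : 0 < e / 2 by rewrite divr_gt0.
have [|t [te st teZ]] := exists_start (s := s + e / 2).
  by apply: eZ; rewrite ltrDl e2 ltrD2l ltr_pdivrMr// ltr_pMr// ltr1n.
have [ts|st'] := leP t s; first by apply: teZ; rewrite /= in_itv/= ts lerDl ltW.
have [sm mt] := midf_lt st'.
exfalso; apply: (starts_separated st mt) => v; rewrite /= in_itv/= => /andP[mv vt].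
apply: eZ; rewrite (lt_le_trans sm mv)/= (le_lt_trans (le_trans vt te))//.
by rewrite ltrD2l ltr_pdivrMr// ltr_pMr// ltr1n.
Qed.

Lemma hitting_time0 : visits_after Z 0 -> hitting_time Z = 0%E.
Proof.
move=> [d d0 dZ]; apply/eqP; rewrite eq_le; apply/andP; split; last first.
  by apply: le_ereal_inf_tmp => _ [t [t0 _] <-]; rewrite lee_fin ltW.
apply/lee_addgt0Pr => e e0; rewrite add0e.
have m0 : 0 < Order.min (d / 2) e by rewrite lt_min divr_gt0.
apply: (@le_trans _ _ (Order.min (d / 2) e)%:E); last by rewrite lee_fin ge_min lexx orbT.
apply: ereal_inf_lbound; exists (Order.min (d / 2) e) => //; split=> //.
apply: dZ; rewrite m0 add0r gt_min; apply/orP; left.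
by rewrite ltr_pdivrMr// ltr_pMr// ltr1n.
Qed.

Lemma hitting_time_starts : ~ visits_after Z 0 ->
  hitting_time Z = ereal_inf [set t%:E | t in [set t | 0 < t /\ starts Z t]].
Proof.
move=> nR; apply/eqP; rewrite eq_le; apply/andP; split; last first.
  apply: le_ereal_inf_tmp => _ [s [s0 Zs] <-].
  have [t [ts st tsZ]] := exists_start Zs.
  have t0 : 0 < t.
    rewrite lt_neqAle (Z0 st.1) andbT; apply/eqP => t0.
    apply: nR; exists s => // u; rewrite add0r => /andP[u0 us].
    by apply: tsZ; rewrite /= in_itv/= -t0 !ltW.
  apply: (@le_trans _ _ t%:E); last by rewrite lee_fin.
  by apply: ereal_inf_lbound; exists t.
apply: le_ereal_inf_tmp => _ [t [t0 [Zt _]] <-].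
by apply: ereal_inf_lbound; exists t.
Qed.

Definition sojourn_length t : \bar R :=
  ereal_inf [set r%:E | r in [set r | 0 < r /\ ~ Z (t + r)]].

(** The visit begun at [t], stopped at time [b]. *)
Definition visit t (b : \bar R) : set R :=
  [set s | [/\ t <= s, `[t, s]%classic `<=` Z & (s%:E < b)%E]].

Lemma visit_interval t b : is_interval (visit t b).
Proof.
move=> s s' [ts tsZ sb] [ts' ts'Z s'b] v /andP[sv vs']; split.
- exact: le_trans sv.
- move=> u; rewrite /= in_itv/= => /andP[tu uv]; apply: ts'Z.
  by rewrite /= in_itv/= tu (le_trans uv).
- by apply: le_lt_trans s'b; rewrite lee_fin.
Qed.

Lemma sojourn_length_ge0 t : (0 <= sojourn_length t)%E.
Proof. by apply: le_ereal_inf_tmp => _ [r [r0 _] <-]; rewrite lee_fin ltW. Qed.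

(** With [D] its length, the visit contains the interval from [t] to [t + D]
    except perhaps its right end, and lies in the closed one; stopping it at [b]
    removes at most one point. *)
Lemma lebesgue_visit t b : Z t -> (t%:E < b)%E ->
  (forall s, t <= s -> `[t, s]%classic `<=` Z -> (s%:E <= b)%E) ->
  (@lebesgue_measure R) (visit t b) = sojourn_length t.
Proof.
move=> Zt tb maxb.
have mV : measurable (visit t b) by apply: is_interval_measurable; exact: visit_interval.
have D0 := sojourn_length_ge0 t.
have inZ s : t <= s -> (s%:E < t%:E + sojourn_length t)%E -> `[t, s]%classic `<=` Z.
  move=> ts slt v; rewrite /= in_itv/= => /andP[tv vs]; apply: contrapT => nZ.
  move: slt; rewrite ltNge => /negP; apply.
  have : (sojourn_length t <= (v - t)%:E)%E.
    apply: ereal_inf_lbound; exists (v - t) => //; split; last first.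
      by rewrite addrCA subrr addr0.
    rewrite subr_gt0 lt_neqAle tv andbT; apply/eqP => tE.
    by apply: nZ; rewrite -tE.
  move=> Dv; apply: (@le_trans _ _ (t%:E + (v - t)%:E)%E); first exact: leeD2l.
  by rewrite -EFinD lee_fin addrCA subrr addr0.
have inV s : t <= s -> (s%:E < t%:E + sojourn_length t)%E -> visit t b s.
  move=> ts slt; split=> //; first exact: inZ.
  have [s' ss' s't] : exists2 s', s < s' & (s'%:E < t%:E + sojourn_length t)%E.
    move: slt; case: (sojourn_length t) => [r| |//].
      rewrite -EFinD lte_fin => /midf_lt [sm mr].
      by exists ((s + (t + r)) / 2).
    by move=> _; exists (s + 1); rewrite ?ltrDl// addey// ltry.
  apply: (@lt_le_trans _ _ s'%:E); first by rewrite lte_fin.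
  have ts' := le_trans ts (ltW ss').
  by apply: maxb => //; exact: inZ.
have Vle s : visit t b s -> (s%:E <= t%:E + sojourn_length t)%E.
  move=> [ts tsZ _]; rewrite -leeBlDl// -EFinB.
  apply: le_ereal_inf_tmp => _ [r [r0 nZ] <-]; rewrite lee_fin leNgt.
  apply/negP => rs; apply: nZ; apply: tsZ.
  by rewrite /= in_itv/= lerDl ltW//= -lerBrDl ltW.
move: D0 inV Vle; case: (sojourn_length t) => [r| |//].
  rewrite lee_fin -EFinD => r0 inV Vle.
  have E1 : (@lebesgue_measure R) `[t, t + r[%classic = r%:E.
    rewrite lebesgue_measure_itv/= lte_fin ltrDl; case: ltP => [_|r0'].
      by rewrite -EFinB addrAC subrr add0r.
    by rewrite (@le_anti _ _ r 0)// r0 r0'.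
  have E2 : (@lebesgue_measure R) `[t, t + r]%classic = r%:E.
    rewrite lebesgue_measure_itv/= lte_fin ltrDl; case: ltP => [_|r0'].
      by rewrite -EFinB addrAC subrr add0r.
    by rewrite (@le_anti _ _ r 0)// r0 r0'.
  apply/eqP; rewrite eq_le; apply/andP; split.
    rewrite -[leRHS]E2; apply: le_measure; rewrite ?inE//.
    move=> s Vs; have [ts _ _] := Vs; rewrite /= in_itv/= ts/=.
    by have := Vle _ Vs; rewrite lee_fin.
  rewrite -[leLHS]E1; apply: le_measure; rewrite ?inE//.
  move=> s; rewrite /= in_itv/= => /andP[ts str]; apply: inV => //.
move=> _ inV _; apply/eqP; rewrite eq_le leey/=.
rewrite (_ : +oo%E = (@lebesgue_measure R) `[t, +oo[%classic); last first.
  by rewrite lebesgue_measure_itv/= ltry.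
apply: le_measure; rewrite ?inE//.
move=> s; rewrite /= in_itv/= andbT => ts; apply: inV => //.
by rewrite addey// ltry.
Qed.

End visits.

(** * Counts and sojourn times along one orbit *)

Section counting_image.
Context {R : realType}.

Lemma counting_image (C D : choiceType) (f : C -> D) (A : set C) : injective f ->
  counting (f @` A) = counting A :> \bar R.
Proof.
move=> injf; rewrite /counting.
have fE : finite_set (f @` A) <-> finite_set A.
  split; last exact: finite_image.
  move=> ffA; apply: (@sub_finite_set _ _ (f @^-1` (f @` A))).
    by move=> i Ai; exists i.
  by apply: finite_preimage => // i j _ _; exact: injf.
case: asboolP => [/fE fA|nfA]; case: asboolP => // fA'.
  by rewrite fset_set_image// card_imfset.
by exfalso; apply: nfA; exact/fE.
Qed.

End counting_image.

Section flow_entrances.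
Context {R : realType} d (Omega : measurableType d).
Variables (Y : R -> Omega -> Omega) (B : bool -> set Omega) (x : Omega).
Hypothesis Y0 : forall x, Y 0 x = x.
Hypothesis YD : forall s t x, 0 <= s -> 0 <= t -> Y (s + t) x = Y s (Y t x).
Hypothesis disjB : B false `&` B true = set0.
Hypothesis lfB : forall l, locally_finite_left_closed (visit_times Y (B l) x).

Local Notation visits l := (visit_times Y (B l) x).

Definition entrances : set (R * bool) := [set u | enters Y (B u.2) x u.1].

Let visits_ge0 l t : visits l t -> 0 <= t. Proof. by case. Qed.

Lemma flow_hittingE A y : flow_hitting Y A y = hitting_time (visit_times Y A y).
Proof.
congr ereal_inf; congr image; apply/seteqP; split=> t /=.
  by move=> [t0 At]; split=> //; split=> //; exact: ltW.
by move=> [t0 [_ At]].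
Qed.

Lemma flow_hitting_sojourn l t : 0 <= t ->
  flow_hitting Y (~` B l) (Y t x) = sojourn_length (visits l) t.
Proof.
move=> t0; congr ereal_inf; congr image; apply/seteqP; split=> r /= [r0 nB].
  split=> // -[_]; rewrite addrC YD//; exact: ltW.
split=> // BY; apply: nB; split; first by rewrite addr_ge0// ltW.
by rewrite addrC YD//; exact: ltW.
Qed.

(** Each visit contains its left endpoint, so a visit just after time 0 is
    already under way at time 0. *)
Lemma visits_after_visits l : visits_after (visits l) 0 -> B l x.
Proof.
by move/(visits_after_mem (visits_ge0 (l:=l)) (lfB l)) => [_]; rewrite Y0.
Qed.

Lemma flow_hitting_entrance l : ~ visits_after (visits l) 0 ->
  flow_hitting Y (B l) x = first_entrance entrances fst snd l.
Proof.
move=> nR; rewrite flow_hittingE hitting_time_starts//; last exact: visits_ge0.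
congr ereal_inf; apply/seteqP; split=> v /=.
  by move=> [t [t0 [Zt lt] <-]]; exists (t, l).
by move=> [u [[u0 Zu lu] <-] <-]; exists u.1.
Qed.

Lemma flow_count_entrances : ~ visits_after (visits false) 0 ->
  flow_count Y B x = counting (entrances_before_stop entrances fst snd).
Proof.
move=> nR; rewrite /flow_count flow_hitting_entrance//.
rewrite -(@counting_image _ _ _ (fun t : R => (t, true))); last by move=> s t [].
rewrite [X in counting X](_ : _ = entrances_before_stop entrances fst snd)//.
apply/seteqP; split=> [_ [t [et tlt] <-]|[t b]]; first by split.
rewrite /entrances_before_stop /entrances /= => -[et bE tlt].
by rewrite bE in et; rewrite bE; exists t.
Qed.

Lemma flow_count_after : visits_after (visits false) 0 -> flow_count Y B x = 0%E.
Proof.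
move=> R0; rewrite /flow_count flow_hittingE hitting_time0//.
rewrite (_ : [set t | _] = set0) ?counting_set0//.
apply/seteqP; split=> // t [[t0 _ _]]; rewrite lte_fin => /(lt_trans t0).
by rewrite ltxx.
Qed.

Local Notation J := (entrances_before_stop entrances fst snd).

(** Before the hitting time, the visits to [B true] are disjoint intervals, one
    for each entrance.  The hitting time cuts none of them, except perhaps for
    one point, because the two sets are disjoint. *)
Lemma flow_sojourn_entrances :
  ~ visits_after (visits false) 0 -> ~ visits_after (visits true) 0 ->
  finite_set J ->
  flow_sojourn Y B x =
  (\sum_(u <- fset_set J) flow_hitting Y (~` B true) (Y u.1 x))%E.
Proof.
move=> nR0 nR1 fJ; rewrite /flow_sojourn.
set tau := flow_hitting Y (B false) x.
have tauE : tau = first_entrance entrances fst snd false by exact: flow_hitting_entrance.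
pose W := \big[setU/set0]_(u <- fset_set J) visit (visits true) u.1 tau.
have inJ u : u \in (fset_set J : seq _) -> J u by rewrite in_fset_set// inE.
have mV (u : R * bool) : measurable (visit (visits true) u.1 tau).
  by apply: is_interval_measurable; exact: visit_interval.
have mW : measurable W by exact: bigsetU_measurable.
have WE : [set s | (0 < s%:E < tau)%E] `&` visits true = W.
  rewrite /W -bigcup_seq; apply/seteqP; split=> s /=.
    move=> [/andP[]]; rewrite lte_fin => s0 stau Zs.
    have [t [ts st tsZ]] := exists_start (visits_ge0 (l:=true)) (lfB true) Zs.
    have t0 : 0 < t.
      rewrite lt_neqAle (visits_ge0 st.1) andbT; apply/eqP => t0.
      apply: nR1; exists s => // v; rewrite add0r => /andP[v0 vs].
      by apply: tsZ; rewrite /= in_itv/= -t0 !ltW.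
    exists (t, true) => //=; rewrite in_fset_set// inE; split=> //=.
      by have [Zt lt] := st; split.
    by rewrite -tauE; apply: le_lt_trans stau; rewrite lee_fin.
  move=> [u /inJ[[u0 Zu lu] lu1 ult] [us usZ stau]]; split.
    by rewrite stau andbT lte_fin (lt_le_trans u0).
  by apply: usZ; rewrite /= in_itv/= us lexx.
have mtau : measurable [set s : R | (0 < s%:E < tau)%E].
  apply: is_interval_measurable => s s' /= /andP[s0 _] /andP[_ s'tau] v /andP[sv vs'].
  by rewrite (lt_le_trans s0) ?lee_fin//= (le_lt_trans _ s'tau)// lee_fin.
transitivity (\int[@lebesgue_measure R]_(s in [set s | (0 < s%:E < tau)%E])
    (\1_W s)%:E)%E.
  apply: eq_integral => s; rewrite inE => /= stau; rewrite !indicE; congr (_%:R%:E).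
  have [BY|nBY] := pselect (B true (Y s x)).
    rewrite !mem_set// -WE; split=> //; split=> //.
    by move: stau => /andP[]; rewrite lte_fin => /ltW.
  by rewrite !memNset// -WE => -[_ [_]].
rewrite integral_indic// (_ : W `&` _ = W); last first.
  by rewrite -WE setIAC setIid.
have uJ : uniq (fset_set J : seq _) by exact: fset_uniq.
rewrite /W measure_bigsetU_seq//=.
- rewrite big_seq [RHS]big_seq; apply: eq_bigr => u /inJ[[u0 Zu lu] lu1 ult].
  rewrite lu1 in Zu; rewrite flow_hitting_sojourn; last exact: ltW.
  apply: lebesgue_visit => //; first by rewrite tauE.
  move=> s us usZ; rewrite leNgt; apply/negP.
  rewrite tauE => /ereal_inf_lt[_ [v [Iv vf] <-]].
  rewrite lte_fin => vs.
  have uv : u.1 <= v.1.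
    rewrite -lee_fin; apply: le_trans (ltW ult) _.
    exact: first_entrance_le.
  have [_ B1] : visits true v.1 by apply: usZ; rewrite /= in_itv/= uv ltW.
  have [_ [_ B0] _] := Iv; rewrite vf in B0.
  by have : set0 (Y v.1 x) by rewrite -disjB.
- move=> u v /inJ[[u0 Zu ul] u1 _] /inJ[[v0 Zv vl] v1 _] [s [[us usZ _] [vs vsZ _]]].
  rewrite u1 in Zu ul; rewrite v1 in Zv vl.
  have [uv|vu|uv] := ltgtP u.1 v.1.
  + exfalso; apply: (@starts_separated _ (visits true) u.1 v.1) => // w.
    rewrite /= in_itv/= => /andP[uw wv]; apply: usZ.
    by rewrite /= in_itv/= uw (le_trans wv).
  + exfalso; apply: (@starts_separated _ (visits true) v.1 u.1) => // w.
    rewrite /= in_itv/= => /andP[vw wu]; apply: vsZ.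
    by rewrite /= in_itv/= vw (le_trans wu).
  + by case: u v uv u1 v1 {u0 Zu ul v0 Zv vl us usZ vs vsZ} => [? ?] [? ?] /= -> -> ->.
Qed.

End flow_entrances.

(** * Measurability of what the entrance process determines *)

Section random_entrances.
Context {R : realType} dT (T : topMeasurableType dT) (S : set T).
Variables (tm : T -> R) (lb : T -> bool) (mk : T -> \bar R).
Hypothesis HS : marked_space S tm lb mk.
Context d (Omega : measurableType d) (C : choiceType).
Variables (I : Omega -> set C) (t : C -> R) (l : C -> bool) (z : Omega -> C -> T) (h : R).
Hypothesis h0 : 0 < h.
Hypothesis zS : forall x i, I x i -> S (z x i).
Hypothesis tmz : forall x i, I x i -> tm (z x i) = t i * h.
Hypothesis lbz : forall x i, I x i -> lb (z x i) = l i.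
Local Notation G := (fun x => dirac_sum R (I x) (z x) : vague_measure R S).
Hypothesis mG : random_element (point_measures R S) G.

Local Notation before := (points_before S tm lb).

Lemma measurable_count_gt j q c :
  measurable [set x | (c%:E < (dirac_sum R (I x) (z x)) (before q j))%E].
Proof. exact: (cozero_measurable mG (cozero_count_gt HS j q c)). Qed.

Lemma measurable_count_eq0 j q :
  measurable [set x | (dirac_sum R (I x) (z x)) (before q j) = 0].
Proof.
rewrite (_ : mkset _ = ~` [set x | (0%:E < (dirac_sum R (I x) (z x)) (before q j))%E]).
  exact/measurableC/measurable_count_gt.
apply/seteqP; split=> x /=; first by move=> ->; rewrite ltxx.
by move=> /negP; rewrite lt0e negb_and measure_ge0 orbF negbK => /eqP.
Qed.

Lemma measurable_lt_first_entrance j (a : R) :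
  measurable [set x | (a%:E < first_entrance (I x) t l j)%E].
Proof.
rewrite (_ : mkset _ = \bigcup_(q in [set q : rat | a * h < ratr q])
  [set x | (dirac_sum R (I x) (z x)) (before (ratr q) j) = 0]).
  rewrite bigcup_mkcond; apply: bigcupT_measurable_rat => q.
  by case: ifP => _ //; exact: measurable_count_eq0.
apply/seteqP; split=> x /=.
  by move/(lt_first_entranceP h0 (@zS x) (@tmz x) (@lbz x)) => [q [? ?]]; exists q.
move=> [q aq q0].
by apply/(lt_first_entranceP h0 (@zS x) (@tmz x) (@lbz x)); exists q.
Qed.

Lemma measurable_first_entrance_lt :
  measurable [set x | (first_entrance (I x) t l false < first_entrance (I x) t l true)%E].
Proof.
rewrite (_ : mkset _ = \bigcup_(q : rat)
  ([set x | (0%:E < (dirac_sum R (I x) (z x)) (before (ratr q) false))%E] `&`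
   [set x | (dirac_sum R (I x) (z x)) (before (ratr q) true) = 0])).
  apply: bigcupT_measurable_rat => q.
  by apply: measurableI; [exact: measurable_count_gt|exact: measurable_count_eq0].
apply/seteqP; split=> x /=.
  by move/(first_entrance_ltP h0 (@zS x) (@tmz x) (@lbz x)) => [q [? ?]]; exists q.
move=> [q _ [q0 q1]].
by apply/(first_entrance_ltP h0 (@zS x) (@tmz x) (@lbz x)); exists q.
Qed.

Lemma measurable_count_before_stop (c : R) :
  measurable [set x | (c%:E < counting (entrances_before_stop (I x) t l))%E].
Proof.
rewrite (_ : mkset _ = \bigcup_(q : rat)
  ([set x | (dirac_sum R (I x) (z x)) (before (ratr q) false) = 0] `&`
   [set x | (c%:E < (dirac_sum R (I x) (z x)) (before (ratr q) true))%E])).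
  apply: bigcupT_measurable_rat => q.
  by apply: measurableI; [exact: measurable_count_eq0|exact: measurable_count_gt].
apply/seteqP; split=> x /=.
  by move/(count_before_stopP HS h0 (@zS x) (@tmz x) (@lbz x)) => [q [? ?]]; exists q.
move=> [q _ [q0 q1]].
by apply/(count_before_stopP HS h0 (@zS x) (@tmz x) (@lbz x)); exists q.
Qed.

End random_entrances.

Lemma emeasurable_fun_gt {R : realType} d (T : measurableType d) (f : T -> \bar R) :
  (forall c : R, measurable [set x | (c%:E < f x)%E]) -> measurable_fun setT f.
Proof.
move=> mf; apply: (measurability _ (ErealGenOInfty.measurableE R)) => //=.
move=> _ [_ [c ->] <-]; rewrite setTI (_ : _ @^-1` _ = [set x | (c%:E < f x)%E])//.
by apply/seteqP; split=> x /=; rewrite in_itv/= andbT.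
Qed.

(** * Measurability of the sojourn time *)

Section right_ends.
Context {R : realType}.

(** Distinct right ends are followed by disjoint gaps, and each gap contains a
    rational. *)
Lemma countable_right_ends (Z : set R) :
  countable [set s | Z s /\ visits_after (~` Z) s].
Proof.
pose gap s (q : rat) := exists2 e, 0 < e & s < ratr q < s + e /\ forall u, s < u < s + e -> ~ Z u.
have gapP s : [set s | Z s /\ visits_after (~` Z) s] s -> exists q, gap s q.
  move=> [_ [e e0 eZ]].
  have [q] := @rat_in_itvoo _ s (s + e) (ltac:(by rewrite ltrDl)).
  by rewrite in_itv/= => sq; exists q, e.
pose f s : rat := if pselect (exists q, gap s q) is left P then projT1 (cid P) else 0.
apply/countable_injP; exists (fun s => choice.pickle (f s)) => s s' /set_mem Es /set_mem Es'.
move=> /(pcan_inj choice.pickleK); rewrite /f.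
case: pselect => [P|/(_ (gapP _ Es))//]; case: pselect => [P'|/(_ (gapP _ Es'))//].
case: cid => q [e e0 [/andP[sq qe] eZ]] /=; case: cid => q' [e' e'0 [/andP[sq' qe'] eZ']] /= qq'.
rewrite -{q'}qq' in sq' qe'; have [ss'|s's|//] := ltgtP s s'.
- by have [Zs' _] := Es'; exfalso; apply: (eZ s') => //; rewrite ss' (lt_trans sq').
- by have [Zs _] := Es; exfalso; apply: (eZ' s) => //; rewrite s's (lt_trans sq).
Qed.

Lemma invS_lt (e : R) (n : nat) : 0 < e -> (Num.truncn e^-1 <= n)%N -> n.+1%:R^-1 < e.
Proof.
move=> e0 en; rewrite invf_plt ?posrE ?ltr0n// (lt_le_trans (truncnS_gt _))//.
by rewrite ler_nat.
Qed.

(** The first point after [s] of the grid of step [1 / n.+1]. *)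
Definition grid_next (n : nat) (s : R) : R :=
  (Num.truncn (s * n.+1%:R)).+1%:R / n.+1%:R.

Lemma grid_next_gt n s : s < grid_next n s.
Proof. by rewrite ltr_pdivlMr ?ltr0n// truncnS_gt. Qed.

Lemma grid_next_le n s : 0 <= s -> grid_next n s <= s + n.+1%:R^-1.
Proof.
move=> s0; rewrite ler_pdivrMr ?ltr0n// mulrDl mulVf ?pnatr_eq0// -natr1 lerD2r.
by have /andP[] := truncn_itv (mulr_ge0 s0 (ler0n R n.+1)).
Qed.

Lemma measurable_grid_cell n k :
  measurable [set s : R | 0 < s /\ Num.truncn (s * n.+1%:R) = k].
Proof.
apply: is_interval_measurable => s s' [s0 sk] [s'0 s'k] v /andP[sv vs']; split.
  exact: lt_le_trans sv.
apply/eqP; rewrite eqn_leq -{1}s'k -sk !le_truncn// ler_wpM2r//.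
Qed.

End right_ends.

Section flow_measurability.
Context {R : realType} dT (T : topMeasurableType dT) (S : set T).
Variables (tm : T -> R) (lb : T -> bool) (mk : T -> \bar R).
Hypothesis HS : marked_space S tm lb mk.
Context d (Omega : measurableType d).
Variables (Y : R -> Omega -> Omega) (B : bool -> set Omega).
Hypothesis mY : forall t, 0 <= t -> measurable_fun setT (Y t).
Hypothesis Y0 : forall x, Y 0 x = x.
Hypothesis mB : forall l, measurable (B l).
Hypothesis disjB : B false `&` B true = set0.
Hypothesis lfB : forall l x, locally_finite_left_closed (visit_times Y (B l) x).
Variables (z : Omega -> R * bool -> T) (h : R).
Hypothesis h0 : 0 < h.
Hypothesis zS : forall x i, entrances Y B x i -> S (z x i).
Hypothesis tmz : forall x i, entrances Y B x i -> tm (z x i) = i.1 * h.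
Hypothesis lbz : forall x i, entrances Y B x i -> lb (z x i) = i.2.
Hypothesis mG : random_element (point_measures R S)
  (fun x => dirac_sum R (entrances Y B x) (z x) : vague_measure R S).

Local Notation visits l x := (visit_times Y (B l) x).
Local Notation tau l := (flow_hitting Y (B l)).

Let visits_ge0 l x t : visits l x t -> 0 <= t. Proof. by case. Qed.

(** By [visits_dichotomy], it suffices to look at a sequence of times that tends
    to 0. *)
Lemma measurable_visits_after l : measurable [set x | visits_after (visits l x) 0].
Proof.
rewrite (_ : mkset _ = \bigcup_n \bigcap_(m in [set m | (n <= m)%N])
   (Y m.+1%:R^-1 @^-1` B l)).
  apply: bigcup_measurable => n _; apply: bigcap_measurableType => m _.
  by rewrite -[X in measurable X]setTI; apply: mY.
apply/seteqP; split=> x /=.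
  move=> [e e0 eZ]; exists (Num.truncn e^-1) => // m /= em.
  have [|//] := eZ m.+1%:R^-1.
  by rewrite add0r invS_lt// invr_gt0 ltr0n.
move=> [n _ nB]; have [//|[e e0 eZ]] := visits_dichotomy (@visits_ge0 l x) (lfB l x) 0.
exfalso; pose m := maxn n (Num.truncn e^-1); apply: (eZ m.+1%:R^-1).
  by rewrite add0r invS_lt ?leq_maxr// invr_gt0 ltr0n.
by split; rewrite ?invr_ge0//; apply: nB; rewrite /= leq_maxl.
Qed.

Lemma measurable_lt_hitting s : 0 <= s -> measurable [set x | (s%:E < tau false x)%E].
Proof.
move=> s0; rewrite (_ : mkset _ = ~` [set x | visits_after (visits false x) 0] `&`
  [set x | (s%:E < first_entrance (entrances Y B x) fst snd false)%E]).
  apply: measurableI; first exact/measurableC/measurable_visits_after.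
  exact: (measurable_lt_first_entrance HS h0 zS tmz lbz mG).
apply/seteqP; split=> x /=.
  move=> stau; have nR : ~ visits_after (visits false x) 0.
    move=> /hitting_time0; rewrite -flow_hittingE => t0.
    by move: stau; rewrite t0 lte_fin ltNge s0.
  by split=> //; rewrite -flow_hitting_entrance// => l; exact: lfB.
by move=> [nR]; rewrite -flow_hitting_entrance// => l; exact: lfB.
Qed.

Lemma measurable_hitting_lt : measurable [set x | (tau false x < tau true x)%E].
Proof.
rewrite (_ : mkset _ = [set x | visits_after (visits false x) 0] `|`
  (~` [set x | visits_after (visits false x) 0] `&`
  (~` [set x | visits_after (visits true x) 0] `&`
  [set x | (first_entrance (entrances Y B x) fst snd false <
            first_entrance (entrances Y B x) fst snd true)%E]))).
  apply: measurableU; first exact: measurable_visits_after.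
  apply: measurableI; first exact/measurableC/measurable_visits_after.
  apply: measurableI; first exact/measurableC/measurable_visits_after.
  exact: (measurable_first_entrance_lt HS h0 zS tmz lbz mG).
apply/seteqP; split=> x /=.
  move=> lt01; have [R0|R0] := pselect (visits_after (visits false x) 0); [by left|right].
  have R1 : ~ visits_after (visits true x) 0.
    move=> /hitting_time0; rewrite -flow_hittingE => t0.
    move: lt01; rewrite t0 ltNge => /negP; apply.
    by apply: le_ereal_inf_tmp => _ [s [/ltW s0 _] <-]; rewrite lee_fin.
  by split=> //; split=> //; rewrite -!flow_hitting_entrance// => l; exact: lfB.
move=> [R0|[R0 [R1]]]; last first.
  by rewrite -!flow_hitting_entrance// => l; exact: lfB.
rewrite !flow_hittingE (hitting_time0 R0).
have B0 := visits_after_visits Y0 (fun l => lfB l x) R0.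
have [R1|[e e0 eZ]] := visits_dichotomy (@visits_ge0 true x) (lfB true x) 0.
  have B1 := visits_after_visits Y0 (fun l => lfB l x) R1.
  by have : set0 x by rewrite -disjB.
apply: (@lt_le_trans _ _ e%:E); first by rewrite lte_fin.
apply: le_ereal_inf_tmp => _ [s [s0 Zs] <-]; rewrite lee_fin leNgt; apply/negP => se.
by apply: (eZ s) => //; rewrite add0r s0.
Qed.

Lemma measurable_flow_count : measurable_fun setT (flow_count Y B).
Proof.
apply: emeasurable_fun_gt => c.
have mc : measurable [set x | (c%:E <
    counting (entrances_before_stop (entrances Y B x) fst snd))%E].
  exact: (measurable_count_before_stop HS h0 zS tmz lbz mG).
have mR := measurable_visits_after false.
have [c0|c0] := leP 0 c.
  rewrite (_ : mkset _ = ~` [set x | visits_after (visits false x) 0] `&`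
   [set x | (c%:E < counting (entrances_before_stop (entrances Y B x) fst snd))%E]).
    by apply: measurableI => //; exact: measurableC.
  apply/seteqP; split=> x /=.
    have [R0|R0] := pselect (visits_after (visits false x) 0).
      by rewrite flow_count_after// lte_fin ltNge c0.
    by rewrite flow_count_entrances// => l; exact: lfB.
  by move=> [R0]; rewrite flow_count_entrances// => l; exact: lfB.
rewrite (_ : mkset _ = setT)//; apply/seteqP; split=> // x _ /=.
by apply: lt_le_trans (measure_ge0 (@counting R R) _); rewrite lte_fin.
Qed.

(** The flow is measurable at each fixed time.  Measurability jointly in time
    and space comes from evaluation at the next point of a finer and finer grid:
    the limit consists of the visits that last for some time after [s], which
    for a given orbit are all the visits but countably many. *)
Let stepped n : set (Omega * R) := [set u | 0 < u.2 /\
  ((grid_next n u.2)%:E < tau false u.1)%E /\ B true (Y (grid_next n u.2) u.1)].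

Let measurable_stepped n : measurable (stepped n).
Proof.
rewrite (_ : stepped n = \bigcup_k
  (([set x | ((k.+1%:R / n.+1%:R)%:E < tau false x)%E] `&` Y (k.+1%:R / n.+1%:R) @^-1` B true)
   `*` [set s : R | 0 < s /\ Num.truncn (s * n.+1%:R) = k])).
  apply: bigcup_measurable => k _; apply: measurableX; last exact: measurable_grid_cell.
  apply: measurableI; first by apply: measurable_lt_hitting; rewrite divr_ge0.
  by rewrite -[X in measurable X]setTI; apply: mY; rewrite ?divr_ge0.
apply/seteqP; split=> -[x s] /=.
  by move=> [s0 [lt Bs]]; exists (Num.truncn (s * n.+1%:R)).
by move=> [k _ [/= [lt Bs] [s0 sk]]]; rewrite /stepped /= /grid_next sk.
Qed.

Let eventually_stepped := \bigcup_N \bigcap_(n in [set n | (N <= n)%N]) stepped n.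

Let eventually_steppedE x : xsection eventually_stepped x =
  [set s | [/\ 0 < s, (s%:E < tau false x)%E & visits_after (visits true x) s]].
Proof.
apply/seteqP; split=> s; rewrite /xsection /= inE.
  move=> [N _ HN]; have [/= s0 [lt _]] := HN N (leqnn N); split=> //.
    by apply: lt_trans lt; rewrite lte_fin grid_next_gt.
  have [//|[e e0 eZ]] := visits_dichotomy (@visits_ge0 true x) (lfB true x) s.
  exfalso; pose m := maxn N (Num.truncn e^-1).
  have [/= _ [_ Bm]] := HN m (leq_maxl _ _).
  have sm := grid_next_gt m s.
  apply: (eZ (grid_next m s)).
    rewrite sm/= (le_lt_trans (grid_next_le m (ltW s0)))// ltrD2l invS_lt//.
    by rewrite leq_maxr.
  by split; [exact: ltW (lt_trans s0 sm)|exact: Bm].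
move=> [s0 stau [e e0 eZ]].
have [b sb btau] : exists2 b : R, s < b & (b%:E <= tau false x)%E.
  move: stau; case: (tau false x) => [r|_|//].
    by rewrite lte_fin => ar; exists r.
  by exists (s + 1); rewrite ?ltrDl// leey.
have m0 : 0 < Order.min e (b - s) by rewrite lt_min e0 subr_gt0.
exists (Num.truncn (Order.min e (b - s))^-1) => // n /= /(invS_lt m0).
rewrite lt_min => /andP[ne nb]; split=> //=.
have sm := grid_next_gt n s; have ms := grid_next_le n (ltW s0).
split.
  apply: lt_le_trans btau; rewrite lte_fin (le_lt_trans ms)//.
  by rewrite -ltrBrDl.
have [|//] := eZ (grid_next n s).
by rewrite sm (le_lt_trans ms)// ltrD2l.
Qed.

(** The sojourn is the measure of the sections of a measurable set of the
    product space, up to countably many times for each orbit. *)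
Lemma measurable_flow_sojourn : measurable_fun setT (flow_sojourn Y B).
Proof.
have mE : measurable eventually_stepped.
  apply: bigcup_measurable => N _; apply: bigcap_measurableType => n _.
  exact: measurable_stepped.
rewrite (_ : flow_sojourn Y B = (@lebesgue_measure R) \o xsection eventually_stepped).
  exact: measurable_fun_xsection.
apply/funext => x /=; have mEx := measurable_xsection x mE.
set D := [set s : R | (0 < s%:E < tau false x)%E].
have mD : measurable D.
  apply: is_interval_measurable => s s' /= /andP[s0 _] /andP[_ s'tau] v /andP[sv vs'].
  by rewrite /D /= (lt_le_trans s0) ?lee_fin//= (le_lt_trans _ s'tau)// lee_fin.
pose ends := D `&` visits true x `&` [set s | visits true x s /\ visits_after (~` visits true x) s].
have cends : countable ends.
  by apply: sub_countable (countable_right_ends (visits true x)); apply: subset_card_le => s [].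
have mends : measurable ends by apply: countable_measurable cends => s; exact: measurable_set1.
have WE : D `&` visits true x = xsection eventually_stepped x `|` ends.
  rewrite eventually_steppedE; apply/seteqP; split=> s.
    move=> [/andP[s0 stau] Zs].
    have [R1|R1] := visits_dichotomy (@visits_ge0 true x) (lfB true x) s.
      by left; split=> //; rewrite -lte_fin.
    by right; split=> //; split=> //; rewrite /D /= s0.
  move=> [[s0 stau R1]|[[]]//]; split; first by rewrite /D /= lte_fin s0.
  exact: (visits_after_mem (@visits_ge0 true x) (lfB true x)).
have mW : measurable (D `&` visits true x) by rewrite WE; exact: measurableU.
transitivity (\int[@lebesgue_measure R]_(s in D) (\1_(D `&` visits true x) s)%:E)%E.
  apply: eq_integral => s; rewrite inE => Ds; rewrite !indicE; congr (_%:R%:E).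
  have [BY|nBY] := pselect (B true (Y s x)).
    rewrite !mem_set//; split=> //; split=> //.
    by move: Ds => /andP[]; rewrite lte_fin => /ltW.
  by rewrite !memNset// => -[_ [_]].
rewrite integral_indic// setIAC setIid WE measureU0//.
exact: countable_lebesgue_measure0.
Qed.

End flow_measurability.

(** * Geometric variables and rewards *)

Section geometric_space.
Context {R : realType}.
Variable p : R.
Hypothesis p01 : 0 < p < 1.

Let weight_ge0 k : 0 <= p ^+ k * (1 - p).
Proof. by have /andP[? ?] := p01; rewrite mulr_ge0 ?exprn_ge0 ?subr_ge0// ltW. Qed.

Definition geometric_measure : set nat -> \bar R :=
  mseries (fun k => mscale (NngNum (weight_ge0 k)) (@dirac _ nat k R)) 0.

HB.instance Definition _ := Measure.on geometric_measure.

Lemma geometric_measureE A : geometric_measure A =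
  (\sum_(0 <= k <oo) (p ^+ k * (1 - p))%:E * \d_k A)%E.
Proof. by []. Qed.

Let geometric_setT : geometric_measure setT = 1%E.
Proof.
rewrite geometric_measureE; apply/cvg_lim => //.
have /andP[p0 p1] := p01; have p1' : `|p| < 1 by rewrite ger0_norm ?ltW.
rewrite (_ : (fun n => _) = EFin \o series (geometric (1 - p) p)).
  apply: cvg_EFin; first exact: nearW.
  have := @cvg_geometric_series R (1 - p) p p1'.
  by rewrite divff// subr_eq0 gt_eqF.
apply/funext => n /=; rewrite /series/= -sumEFin; apply: eq_bigr => k _.
by rewrite diracT mule1 /geometric/= mulrC.
Qed.

HB.instance Definition _ := Measure_isProbability.Build _ _ _ geometric_measure geometric_setT.

Lemma geometric_identity : geometric_variable (geometric_measure : probability nat R) p id.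
Proof.
move=> k; rewrite preimage_id; transitivity (geometric_measure [set k]) => //.
rewrite geometric_measureE (@nneseriesD1 _ _ k)//.
- rewrite diracE mem_set// mule1 eseries0 ?adde0// => i _ ik.
  by rewrite diracE memNset ?mule0// => /eqP; rewrite (negbTE ik).
- by move=> i _; rewrite mule_ge0// lee_fin.
Qed.

End geometric_space.

Section reward_laws.
Context {R : realType} d (Omega : measurableType d) (P : probability Omega R).
Variables (p : R) (M : Omega -> nat).
Hypothesis geomM : geometric_variable P p M.

Lemma unit_rewards_law k (D : nat -> set (\bar R)) :
  P [set w | M w = k /\ forall i, (i < k)%N -> D i 1%E] =
  ((p ^+ k * (1 - p))%:E * \prod_(i < k) \d_(1%E : \bar R) (D i))%E.
Proof.
have [allD|] := pselect (forall i, (i < k)%N -> D i 1%E).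
  rewrite big1 => [|i _]; last by rewrite diracE mem_set//; exact: allD.
  rewrite mule1 -geomM; congr (P _); apply/seteqP; split=> w /=; by [move=> []|split].
move/existsNP => [i /not_implyP[ik Di]]; rewrite (_ : [set w | _] = set0); last first.
  by apply/seteqP; split=> w // [_ /(_ i ik)].
rewrite (bigD1 (Ordinal ik))//= diracE memNset// mul0e mule0.
exact: measure0.
Qed.

(** Independence is applied to the finite family formed by [M], of index [None],
    and the first [k] rewards. *)
Lemma independent_rewards_law (m : probability (\bar R) R) (X : nat -> Omega -> \bar R) :
  (forall i A, measurable A -> P (X i @^-1` A) = m A) ->
  mutually_independent P
    (fun o : option nat => if o is Some i then X i else fun w => (M w)%:R%:E) ->
  forall k (D : nat -> set (\bar R)), (forall i, measurable (D i)) ->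
  P [set w | M w = k /\ forall i, (i < k)%N -> D i (X i w)] =
  ((p ^+ k * (1 - p))%:E * \prod_(i < k) m (D i))%E.
Proof.
move=> lawX indep k D mD.
pose s : seq (option nat) := None :: map Some (iota 0 k).
pose A (o : option nat) : set (\bar R) := if o is Some i then D i else [set k%:R%:E].
have mA o : measurable (A o) by case: o => [i|] /=; [exact: mD|exact: emeasurable_set1].
have us : uniq s.
  rewrite /= map_inj_uniq ?iota_uniq ?andbT; last by move=> i j [].
  by apply/mapP => -[].
have := indep [fset o in s]%fset A mA.
rewrite (perm_big s) /=; last first.
  by apply: uniq_perm => //; [exact: fset_uniq|move=> o; rewrite !inE].
rewrite big_cons big_map /= => {}indep.
transitivity (P (\bigcap_(i in [set` [fset o in s]%fset])
   ((if i is Some i0 then X i0 else fun w => (M w)%:R%:E) @^-1` A i))).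
  congr (P _); apply/seteqP; split=> w /=.
    move=> [Mk DX] [i|] /=; last by rewrite Mk.
    rewrite !inE/= => /mapP[j]; rewrite mem_iota/= add0n => jk [->].
    exact: DX.
  move=> H; split.
    have := H None; rewrite /= !inE eqxx => /(_ isT) /eqP.
    by rewrite eqe eqr_nat => /eqP.
  move=> i ik; apply: (H (Some i)) => /=.
  by rewrite !inE/=; apply/mapP; exists i => //; rewrite mem_iota.
rewrite indep; congr (_ * _)%E.
  rewrite -geomM; congr (P _); apply/seteqP; split=> w /=; last by move=> ->.
  by move=> /eqP; rewrite eqe eqr_nat => /eqP.
have -> : iota 0 k = index_iota 0 k by rewrite /index_iota subn0.
by rewrite big_mkord; apply: eq_bigr => i _; exact: lawX.
Qed.

End reward_laws.

(** * Limits of success counts *)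

Section unmarked_limits.
Context {R : realType}.

Lemma unmarked_stopped (C : choiceType) (I : set C) (t : C -> R) (l : C -> bool)
    (h q s : R) (k : nat) (O : set (\bar R)) :
  0 < h -> (forall i, I i -> 0 <= t i) -> q < s ->
  stopped_sum_at (fst : R * bool -> R) snd (fun=> 1%E) k O q s
    (dirac_sum R I (fun i => (t i * h, l i)) : vague_measure R (time_type R)) ->
  [/\ O k%:R%:E, counting (entrances_before_stop I t l) = k%:R%:E :> \bar R &
      (first_entrance I t l false < first_entrance I t l true)%E <-> k = 0%N].
Proof.
move=> h0 t0 qs stop.
have zS i : I i -> time_type R (t i * h, l i).
  by move=> Ii; rewrite /time_type /= mulr_ge0 ?t0// ltW.
have [fJ cJ k0 kpos OJ] := stopped_entrances unmarked_space h0 zS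
  (fun _ _ => erefl) (fun _ _ => erefl) qs stop.
split.
- move: OJ; rewrite sumEFin big_const_seq count_predT iter_addr_0.
  by rewrite -[size _]/(#|` _|) cJ.
- by rewrite /counting asboolT// cJ.
- split=> // lt01; case: k {stop} => // k in cJ k0 kpos *.
  by have := lt_trans lt01 (kpos isT); rewrite ltxx.
Qed.

Context d (Omega : measurableType d) (P : probability Omega R).
Context d' (Omega' : measurableType d') (P' : probability Omega' R).
Variables (N : Omega' -> vague_measure R (time_type R)) (p : R).
Hypothesis p01 : 0 < p < 1.
Hypothesis PN : poisson_point_process P' (halfline_lebesgue \x bernoulli_prob p)%E N.
Variables (L : R -> Omega -> vague_measure R (time_type R)) (bad : R -> set Omega).
Hypothesis cvgL : cvg_in_distribution P P' (point_measures R (time_type R)) L N.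
Hypothesis mbad : forall e : R, 0 < e -> measurable (bad e).
Hypothesis bad0 : P (bad e) @[e --> 0^'+] --> 0%E.
Variables (cnt : R -> Omega -> \bar R) (A : R -> set Omega).
Hypothesis mcnt : forall e : R, 0 < e -> measurable_fun setT (cnt e).
Hypothesis mA : forall e : R, 0 < e -> measurable (A e).
Hypothesis stopped : forall e x q s k O, 0 < e -> ~ bad e x -> q < s ->
  stopped_sum_at (fst : R * bool -> R) snd (fun=> 1%E) k O q s (L e x) ->
  [/\ O k%:R%:E, cnt e x = k%:R%:E & (A e x <-> k = 0%N)].

(** The number of successes is a stopped sum of unit marks.  Its limit is
    realized as the identity of the integers under their geometric measure. *)
Lemma success_count_limits :
  [/\ exists (d2 : measure_display) (Omega2 : measurableType d2)
         (P2 : probability Omega2 R) (M : {mfun Omega2 >-> nat}),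
         geometric_variable P2 p M /\
         cvg_in_distribution P P2 [set: \bar R] cnt (fun w => (M w)%:R%:E),
      P (A e) @[e --> 0^'+] --> (1 - p)%:E &
      P [set x | cnt e x = 0%E] @[e --> 0^'+] --> (1 - p)%:E].
Proof.
pose P2 : probability nat R := geometric_measure p01.
pose m (j : bool) : probability (\bar R) R := \d_(1%E : \bar R).
pose X (i : nat) : nat -> \bar R := cst 1%E.
have geomM : geometric_variable P2 p id := geometric_identity p01.
have intens (a b : R) (j : bool) (D : set (\bar R)) : 0 <= a <= b -> measurable D ->
    (halfline_lebesgue \x bernoulli_prob p)%E
      (block (time_type R) fst snd (fun=> 1%E) a b j D) =
    (((b - a) * (if j then p else 1 - p))%:E * m j D)%E.
  by move=> ab mD; exact: unmarked_intensity.
have m_ge0 : m true [set y | (0 <= y)%E] = 1%E.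
  by rewrite /m /= diracE mem_set//= lee_fin.
have X_ge0 i : P2 [set w | (X i w < 0)%E] = 0%E.
  rewrite (_ : [set w | _] = set0) ?measure0//; apply/seteqP; split=> w //=.
  by rewrite lte_fin ltr10.
have law k (D : nat -> set (\bar R)) (mD : forall i, measurable (D i)) :
    P2 [set w | id w = k /\ forall i, (i < k)%N -> D i (X i w)] =
    ((p ^+ k * (1 - p))%:E * \prod_(i < k) m true (D i))%E.
  exact: unit_rewards_law.
have mM : measurable_fun setT (id : nat -> nat) by exact: measurable_id.
have mX i : measurable_fun setT (X i) by exact: measurable_cst.
have success (A' : R -> set Omega) : (forall e : R, 0 < e -> measurable (A' e)) ->
    (forall e x q s k O, 0 < e -> ~ bad e x -> q < s ->
      stopped_sum_at (fst : R * bool -> R) snd (fun=> 1%E) k O q s (L e x) ->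
      O k%:R%:E /\ (A' e x <-> k = 0%N)) ->
    P (A' e) @[e --> 0^'+] --> (1 - p)%:E.
  exact: (cvg_no_success unmarked_space PN p01 intens m_ge0 mM mX X_ge0 law cvgL mbad bad0).
split.
- pose M : {mfun nat >-> nat} :=
    HB.pack_for {mfun nat >-> nat} (@id nat) (isMeasurableFun.Build _ _ _ _ _ mM).
  exists _, nat, P2, M; split=> //.
  have := cvg_stopped_sum unmarked_space PN p01 intens m_ge0 mM mX X_ge0 law cvgL mbad bad0 mcnt.
  rewrite (_ : (fun w : nat => _) = fun w => w%:R%:E).
    apply => e x O e0 nb [q [s [k [qs stop]]]].
    by have [Ok -> _] := stopped e0 nb qs stop.
  by apply/funext => w; rewrite sumEFin sumr_const card_ord.
- apply: success => // e x q s k O e0 nb qs stop.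
  by have [Ok _ Ak] := stopped e0 nb qs stop.
- apply: success => [e e0|e x q s k O e0 nb qs stop].
    by have := mcnt e0 measurableT (emeasurable_set1 0%E); rewrite setTI.
  have [Ok cE _] := stopped e0 nb qs stop; split=> //=; rewrite cE.
  by split=> [/eqP|->//]; rewrite eqe pnatr_eq0 => /eqP.
Qed.

End unmarked_limits.

(** * Transformations and flows *)

Section map_entrances.
Context {R : realType} d (Omega : measurableType d).
Variables (T : Omega -> Omega) (B : bool -> set Omega).
Hypothesis disjB : B false `&` B true = set0.

Definition map_entrances (x : Omega) : set (nat * bool) :=
  [set u | (1 <= u.1)%N /\ B u.2 (iter u.1 T x)].

Local Notation time := (fun u : nat * bool => u.1%:R : R).

Lemma map_hitting_entrance l x :
  map_hitting R T (B l) x = first_entrance (map_entrances x) time snd l.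
Proof.
congr ereal_inf; apply/seteqP; split=> v /=.
  by move=> [n [n1 Bn] <-]; exists (n, l).
by move=> [u [[u1 Bu] ul] <-]; exists u.1 => //; rewrite -ul.
Qed.

Lemma map_count_entrances x :
  map_count R T B x = counting (entrances_before_stop (map_entrances x) time snd).
Proof.
rewrite /map_count -[LHS]/(dirac_sum R [set n | (1 <= n)%N /\
  (n%:R%:E <= map_hitting R T (B false) x)%E] (fun n => iter n T x) (B true)).
rewrite dirac_sum_counting.
rewrite -(@counting_image _ _ _ (fun n : nat => (n, true))); last by move=> n k [].
rewrite [X in counting X](_ : _ = entrances_before_stop (map_entrances x) time snd)//.
apply/seteqP; split=> [_ [n [[n1 ntau] Bn] <-]|].
  split=> //=; rewrite -map_hitting_entrance lt_neqAle ntau andbT.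
  (* The times of the two kinds of entrances never coincide. *)
  apply/eqP => nE; have [_ [k [k1 Bk] <-] kn] : exists2 y : \bar R,
      [set k%:R%:E | k in [set k | (1 <= k)%N /\ B false (iter k T x)]] y &
      (y < n.+1%:R%:E)%E.
    by apply: ereal_inf_lt; rewrite -/(map_hitting R T (B false) x) -nE lte_fin ltr_nat.
  have nk : (n%:R%:E <= k%:R%:E :> \bar R)%E.
    by rewrite nE; apply: ereal_inf_lbound; exists k.
  rewrite lte_fin ltr_nat ltnS in kn; rewrite lee_fin ler_nat in nk.
  have kE : k = n by apply/eqP; rewrite eqn_leq kn.
  have : set0 (iter n T x) by rewrite -disjB; split=> //; rewrite -kE.
  by [].
move=> -[n b] [/= [n1 Bn] /= bE]; rewrite bE in Bn *.
rewrite -map_hitting_entrance => /ltW ntau; exists n => //.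
Qed.

End map_entrances.

Section limits.
Context {R : realType} d (Omega : measurableType d) (P : probability Omega R).
Variables (B : R -> bool -> set Omega) (p : R).
Hypothesis mB : forall (e : R) l, 0 < e -> measurable (B e l).
Hypothesis disjB : forall e : R, 0 < e -> B e false `&` B e true = set0.
Hypothesis p01 : 0 < p < 1.
Context d' (Omega' : measurableType d') (P' : probability Omega' R).

Section map_limits.
Variables (T : Omega -> Omega) (h : R -> R) (N : Omega' -> vague_measure R (time_type R)).
Hypothesis h0 : forall e, 0 < e -> 0 < h e.
Hypothesis PN : poisson_point_process P' (halfline_lebesgue \x bernoulli_prob p)%E N.
Hypothesis cvgN : cvg_in_distribution P P' (point_measures R (time_type R))
  (fun e => map_process T (B e) (h e) (time_type R)) N.

Lemma map_limits :
  [/\ exists (d2 : measure_display) (Omega2 : measurableType d2)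
         (P2 : probability Omega2 R) (M : {mfun Omega2 >-> nat}),
         geometric_variable P2 p M /\
         cvg_in_distribution P P2 [set: \bar R]
           (fun e : R => map_count R T (B e)) (fun w => (M w)%:R%:E),
      P [set x | (map_hitting R T (B e false) x < map_hitting R T (B e true) x)%E]
        @[e --> 0^'+] --> (1 - p)%:E &
      P [set x | map_count R T (B e) x = 0%E] @[e --> 0^'+] --> (1 - p)%:E].
Proof.
have [rN _ _] := cvgN.
have zS e : 0 < e -> forall x (i : nat * bool), map_entrances T (B e) x i ->
    time_type R (i.1%:R * h e, i.2).
  by move=> e0 x i _; rewrite /time_type /= mulr_ge0// ltW// h0.
apply: (success_count_limits p01 PN cvgN (bad := fun=> set0)).
- by [].
- by rewrite measure0; exact: cvg_cst.
- move=> e e0; apply: emeasurable_fun_gt => c; under eq_set do rewrite map_count_entrances ?disjB//.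
  exact: (measurable_count_before_stop unmarked_space (h0 e0) (zS _ e0)
    (fun _ _ _ => erefl) (fun _ _ _ => erefl) (rN e e0)).
- move=> e e0; under eq_set do rewrite !map_hitting_entrance.
  exact: (measurable_first_entrance_lt unmarked_space (h0 e0) (zS _ e0)
    (fun _ _ _ => erefl) (fun _ _ _ => erefl) (rN e e0)).
- move=> e x q s k O e0 _ qs stop.
  rewrite /= map_count_entrances ?disjB// !map_hitting_entrance.
  by apply: (unmarked_stopped (h0 e0) _ qs stop) => i _; rewrite ler0n.
Qed.

End map_limits.

Section flow_limits.
Variables (Y : R -> Omega -> Omega) (h : R -> R).
Hypothesis mY : forall t, 0 <= t -> measurable_fun setT (Y t).
Hypothesis Y0 : forall x, Y 0 x = x.
Hypothesis YD : forall s t x, 0 <= s -> 0 <= t -> Y (s + t) x = Y s (Y t x).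
Hypothesis h0 : forall e, 0 < e -> 0 < h e.
Hypothesis lfB : forall (e : R) l x, 0 < e ->
  locally_finite_left_closed (visit_times Y (B e l) x).
Hypothesis PB0 : P (B e false `|` B e true) @[e --> 0^'+] --> 0%E.

Let mbad (e : R) : 0 < e -> measurable (B e false `|` B e true).
Proof. by move=> e0; apply: measurableU; exact: mB. Qed.

Let not_after e x l : 0 < e -> ~ (B e false `|` B e true) x ->
  ~ visits_after (visit_times Y (B e l) x) 0.
Proof.
move=> e0 nB /(visits_after_visits Y0 (fun l => lfB l x e0)) Bx.
by apply: nB; case: l Bx; [right|left].
Qed.

(** The exceptional event is that the orbit starts in one of the two sets: the
    visit under way at time 0 is counted by no entrance. *)
Lemma flow_limits (N : Omega' -> vague_measure R (time_type R)) :
  poisson_point_process P' (halfline_lebesgue \x bernoulli_prob p)%E N ->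
  cvg_in_distribution P P' (point_measures R (time_type R))
    (fun e => flow_process Y (B e) (h e) (time_type R)) N ->
  [/\ exists (d2 : measure_display) (Omega2 : measurableType d2)
         (P2 : probability Omega2 R) (M : {mfun Omega2 >-> nat}),
         geometric_variable P2 p M /\
         cvg_in_distribution P P2 [set: \bar R]
           (fun e => flow_count Y (B e)) (fun w => (M w)%:R%:E),
      P [set x | (flow_hitting Y (B e false) x < flow_hitting Y (B e true) x)%E]
        @[e --> 0^'+] --> (1 - p)%:E &
      P [set x | flow_count Y (B e) x = 0%E] @[e --> 0^'+] --> (1 - p)%:E].
Proof.
move=> PN cvgN; have [rN _ _] := cvgN.
have ent_ge0 e x (i : R * bool) : entrances Y (B e) x i -> 0 <= i.1.
  by move=> [/ltW].
have zS e : 0 < e -> forall x (i : R * bool), entrances Y (B e) x i ->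
    time_type R (i.1 * h e, i.2).
  by move=> e0 x i /ent_ge0 i0; rewrite /time_type /= mulr_ge0// ltW// h0.
apply: (success_count_limits p01 PN cvgN mbad PB0).
- move=> e e0.
  exact: (measurable_flow_count unmarked_space mY (fun l => mB l e0)
    (fun l x => lfB l x e0) (h0 e0) (zS _ e0) (fun _ _ _ => erefl)
    (fun _ _ _ => erefl) (rN e e0)).
- move=> e e0.
  exact: (measurable_hitting_lt unmarked_space mY Y0 (fun l => mB l e0)
    (disjB e0) (fun l x => lfB l x e0) (h0 e0) (zS _ e0) (fun _ _ _ => erefl)
    (fun _ _ _ => erefl) (rN e e0)).
- move=> e x q s k O e0 nb qs stop.
  have lfx l : locally_finite_left_closed (visit_times Y (B e l) x) by exact: lfB.
  rewrite /= flow_count_entrances//; last exact: not_after.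
  rewrite !flow_hitting_entrance//; try exact: not_after.
  by apply: (unmarked_stopped (h0 e0) _ qs stop) => i; exact: ent_ge0.
Qed.

(** Each entrance carries the rescaled length of its visit as a mark, so the
    rescaled sojourn is the stopped sum of these marks. *)
Lemma flow_sojourn_limit (a : R -> R) (m : bool -> probability (\bar R) R)
    (L : Omega' -> vague_measure R (time_type_mark R)) :
  (forall e : R, 0 < e -> 0 < a e) ->
  (forall j, m j [set y | (0 <= y)%E] = 1%E) ->
  poisson_point_process P' (marked_intensity p m) L ->
  cvg_in_distribution P P' (point_measures R (time_type_mark R))
    (fun e => flow_marked_process Y (B e) (h e) (a e) (time_type_mark R)) L ->
  forall (d2 : measure_display) (Omega2 : measurableType d2)
    (P2 : probability Omega2 R)
    (M : {mfun Omega2 >-> nat}) (X : nat -> {mfun Omega2 >-> \bar R}),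
  geometric_variable P2 p M ->
  (forall i A, measurable A -> distribution P2 (X i) A = m true A) ->
  mutually_independent P2
    (fun o : option nat =>
       if o is Some i then X i : Omega2 -> \bar R
       else fun w => (M w)%:R%:E) ->
  cvg_in_distribution P P2 [set: \bar R]
    (fun e x => ((a e)%:E * flow_sojourn Y (B e) x)%E)
    (fun w => (\sum_(i < M w) X i w)%E).
Proof.
move=> a0 m1 PL cvgL d2 Omega2 P2 M X geomM lawX indep; have [rL _ _] := cvgL.
pose z e x (u : R * bool) : R * (bool * \bar R) :=
  (u.1 * h e, (u.2, ((a e)%:E * flow_hitting Y (~` B e u.2) (Y u.1 x))%E)).
have hit_ge0 A y : (0 <= flow_hitting Y A y)%E.
  by apply: le_ereal_inf_tmp => _ [r [/ltW r0 _] <-]; rewrite lee_fin.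
have zS e : 0 < e -> forall x i, entrances Y (B e) x i -> time_type_mark R (z e x i).
  move=> e0 x i [/ltW i0 _]; split; first by rewrite /= mulr_ge0// ltW// h0.
  by rewrite /= mule_ge0// lee_fin ltW// a0.
have mneg : measurable [set y : \bar R | (y < 0)%E].
  by rewrite -[X in measurable X]setTI; exact: emeasurable_fun_infty_o.
have X_ge0 i : P2 [set w | (X i w < 0)%E] = 0%E.
  transitivity (m true [set y | (y < 0)%E]); first exact: lawX.
  rewrite (_ : [set y | _] = ~` [set y | (0 <= y)%E]); last first.
    by apply/seteqP; split=> y /=; rewrite ltNge => /negP.
  rewrite probability_setC ?m1 ?subee//.
  by rewrite -[X in measurable X]setTI; exact: emeasurable_fun_c_infty.
apply: (cvg_stopped_sum marked_time_space PL p01 _ (m1 true) _ _ X_ge0 _ cvgL mbad PB0).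
- by move=> c b j D cb mD; exact: marked_intensity_block.
- exact: measurable_funPT.
- by move=> i; exact: measurable_funPT.
- by apply: independent_rewards_law => // i A mA; exact: lawX.
- move=> e e0; apply: measurable_funeM.
  exact: (measurable_flow_sojourn marked_time_space mY (fun l => mB l e0)
    (fun l x => lfB l x e0) (h0 e0) (zS _ e0) (fun _ _ _ => erefl)
    (fun _ _ _ => erefl) (rL e e0)).
- move=> e x O e0 nb [q [s [k [qs stop]]]].
  have lfx l : locally_finite_left_closed (visit_times Y (B e l) x) by exact: lfB.
  have [fJ _ _ _] := stopped_entrances marked_time_space (h0 e0) (zS _ e0 x)
    (fun _ _ => erefl) (fun _ _ => erefl) qs stop.
  rewrite (flow_sojourn_entrances YD (disjB e0) lfx) //; try exact: not_after.
  rewrite ge0_sume_distrr// [X in O X -> _](_ : _ = \sum_(u <-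
    fset_set (entrances_before_stop (entrances Y (B e) x) fst snd))
    ((a e)%:E * flow_hitting Y (~` B e true) (Y u.1 x)))%E//.
  rewrite big_seq [RHS]big_seq; apply: eq_bigr => u.
  by rewrite in_fset_set// inE /z => -[_ /= -> _].
Qed.

End flow_limits.
End limits.

Theorem theorem3p1 (R : realType) (d : measure_display)
  (Omega : measurableType d) (mu P : probability Omega R)
  (B : R -> bool -> set Omega)
  (mB : forall (e : R) l, 0 < e -> measurable (B e l))
  (disjB : forall e : R, 0 < e -> B e false `&` B e true = set0)
  (muB_gt0 : forall e : R, 0 < e -> (0 < mu (B e false `|` B e true))%E)
  (muB_cvg0 : mu (B e false `|` B e true) @[e --> 0^'+] --> 0%E)
  (p : R) (p_gt0 : 0 < p) (p_lt1 : p < 1) :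
  (* transformation *)
  (forall T : Omega -> Omega, measure_preserving_map mu T ->
    (forall (d' : measure_display) (Omega' : measurableType d')
        (P' : probability Omega' R)
        (N : Omega' -> vague_measure R (time_type R)),
      poisson_point_process P' (halfline_lebesgue \x bernoulli_prob p)%E N ->
      cvg_in_distribution P P' (point_measures R (time_type R))
        (fun e => map_process T (B e)
                    (fine (mu (B e false `|` B e true))) (time_type R)) N ->
      [/\ exists (d2 : measure_display) (Omega2 : measurableType d2)
             (P2 : probability Omega2 R) (M : {mfun Omega2 >-> nat}),
             geometric_variable P2 p M /\
             cvg_in_distribution P P2 [set: \bar R]
               (fun e : R => map_count R T (B e)) (fun w => (M w)%:R%:E),
          P [set x | (map_hitting R T (B e false) x
                      < map_hitting R T (B e true) x)%E]
            @[e --> 0^'+] --> (1 - p)%:E &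
          P [set x | map_count R T (B e) x = 0%E]
            @[e --> 0^'+] --> (1 - p)%:E]))
  /\
  (* flow *)
  (forall (Y : R -> Omega -> Omega) (h : R -> R),
    measure_preserving_flow mu Y ->
    (forall e : R, 0 < e -> 0 < h e) ->
    (forall (e : R) l x, 0 < e ->
      locally_finite_left_closed (visit_times Y (B e l) x)) ->
    P (B e false `|` B e true) @[e --> 0^'+] --> 0%E ->
    (forall (d' : measure_display) (Omega' : measurableType d')
        (P' : probability Omega' R)
        (N : Omega' -> vague_measure R (time_type R)),
      poisson_point_process P' (halfline_lebesgue \x bernoulli_prob p)%E N ->
      cvg_in_distribution P P' (point_measures R (time_type R))
        (fun e => flow_process Y (B e) (h e) (time_type R)) N ->
      [/\ exists (d2 : measure_display) (Omega2 : measurableType d2)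
             (P2 : probability Omega2 R) (M : {mfun Omega2 >-> nat}),
             geometric_variable P2 p M /\
             cvg_in_distribution P P2 [set: \bar R]
               (fun e => flow_count Y (B e)) (fun w => (M w)%:R%:E),
          P [set x | (flow_hitting Y (B e false) x
                      < flow_hitting Y (B e true) x)%E]
            @[e --> 0^'+] --> (1 - p)%:E &
          P [set x | flow_count Y (B e) x = 0%E]
            @[e --> 0^'+] --> (1 - p)%:E])
    /\
    (forall (a : R -> R) (m : bool -> probability (\bar R) R),
      (forall e : R, 0 < e -> 0 < a e) ->
      (forall j, m j [set y | (0 <= y)%E] = 1%E) ->
      cvg_in_probability0 P
        (fun e x => ((a e)%:E * flow_hitting Y (~` B e true) x)%E) ->
      forall (d' : measure_display) (Omega' : measurableType d')
        (P' : probability Omega' R)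
        (L : Omega' -> vague_measure R (time_type_mark R)),
      poisson_point_process P' (marked_intensity p m) L ->
      cvg_in_distribution P P' (point_measures R (time_type_mark R))
        (fun e => flow_marked_process Y (B e) (h e) (a e)
                    (time_type_mark R)) L ->
      forall (d2 : measure_display) (Omega2 : measurableType d2)
        (P2 : probability Omega2 R)
        (M : {mfun Omega2 >-> nat}) (X : nat -> {mfun Omega2 >-> \bar R}),
      geometric_variable P2 p M ->
      (forall i A, measurable A -> distribution P2 (X i) A = m true A) ->
      (* M and all the X i are mutually independent *)
      mutually_independent P2
        (fun o : option nat =>
           if o is Some i then X i : Omega2 -> \bar R
           else fun w => (M w)%:R%:E) ->
      cvg_in_distribution P P2 [set: \bar R]
        (fun e x => ((a e)%:E * flow_sojourn Y (B e) x)%E)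
        (fun w => (\sum_(i < M w) X i w)%E))).
Proof.
have p01 : 0 < p < 1 by rewrite p_gt0.
split=> [T _ d' Omega' P' N PN cvgN|Y h [mY Y0 YD _] h0 lfB PB0].
  apply: (map_limits disjB p01 _ PN cvgN) => e e0.
  by rewrite fine_gt0// muB_gt0// ltey_eq fin_num_measure//; apply: measurableU; exact: mB.
split=> [d' Omega' P' N PN cvgN|].
  exact: (flow_limits mB disjB p01 mY Y0 h0 lfB PB0 PN cvgN).
move=> a m a0 m1 _ d' Omega' P' L PL cvgL d2 Omega2 P2 M X geomM lawX indep.
exact: (flow_sojourn_limit mB disjB p01 mY Y0 YD h0 lfB PB0 a0 m1 PL cvgL geomM lawX indep).
Qed.
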